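(* Let $d\ge1$, $a>0$, $V=[-a,a]^d\subseteq\mathbb{R}^d$, $0<s<d$, and consider $$I[\phi\cdot\sigma]=\int_V \phi(\boldsymbol{x})\sigma(\boldsymbol{x})\,\mathrm{d}\boldsymbol{x},\qquad \sigma(\boldsymbol{x})=\frac{1}{|\boldsymbol{x}|^s},$$ where $\phi$ is smooth and compactly supported in $V$. For a correction order $p\in\mathbb{N}$, let $Q_h^p$ be the SinCoTrap rule with mesh size $h=a/N$ ($N\in\mathbb{N}_+$), $$Q_h^p[\phi\cdot\sigma] = T_h^0[\phi\cdot\sigma] + h^{d-s}\sum_{\boldsymbol{i}\in\mathcal{X}_p} w_{\boldsymbol{i}}\,\phi(\boldsymbol{i}h).$$ Then, as $h\to0^+$, $$I[\phi\cdot\sigma] = Q_h^p[\phi\cdot\sigma] + O(h^{2p+2+d-s}).$$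
   Context: $\mathbb{N}$ includes $0$; $|\cdot|$ is the Euclidean norm, $|\boldsymbol{i}|_1=\sum_j|i_j|$, $|\boldsymbol{i}|_\infty=\max_j|i_j|$; $\boldsymbol{x}^{\boldsymbol{\alpha}}=\prod_j x_j^{\alpha_j}$ with $0^0=1$. Punctured trapezoidal rule: for $h=a/N$, $T_h^0[f]:=h^d\sum_{\boldsymbol{i}\in\mathbb{Z}^d,\,0<|\boldsymbol{i}|_\infty\le N} c_{\boldsymbol{i}}\,f(\boldsymbol{i}h)$, with $c_{\boldsymbol{i}}=2^{-m(\boldsymbol{i})}$, $m(\boldsymbol{i})=\#\{j:|i_j|=N\}$. Stencil: $\mathcal{X}_p=\{\boldsymbol{i}\in\mathbb{Z}^d: 0\le|\boldsymbol{i}|_1\le p\}$. For $\boldsymbol{\beta}\in\mathbb{N}^d$ the sign-orbit is the set $\mathcal{G}_{\boldsymbol{\beta}}=\{(\pm\beta_1,\dots,\pm\beta_d)\}\subset\mathbb{Z}^d$. Generalized zeta function: $Z_{2\boldsymbol{\alpha}}(s)$ denotes the meromorphic continuation to $\mathbb{C}$ of $\sum_{\boldsymbol{n}\in\mathbb{Z}^d\setminus\{\boldsymbol{0}\}}\boldsymbol{n}^{2\boldsymbol{\alpha}}/|\boldsymbol{n}|^{s}$ (initially defined for $\mathrm{Re}(s)>d+2|\boldsymbol{\alpha}|_1$); its only pole is at $s=d+2|\boldsymbol{\alpha}|_1$. Converged weights: $(w_{\boldsymbol{\beta}})_{\boldsymbol{\beta}\in\mathbb{N}^d,\,|\boldsymbol{\beta}|_1\le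 p}$ is the solution of the (nonsingular) square linear system $\sum_{|\boldsymbol{\beta}|_1\le p}A_{\boldsymbol{\alpha},\boldsymbol{\beta}}w_{\boldsymbol{\beta}}=b_{\boldsymbol{\alpha}}$ for all $\boldsymbol{\alpha}\in\mathbb{N}^d$ with $|\boldsymbol{\alpha}|_1\le p$, where $A_{\boldsymbol{\alpha},\boldsymbol{\beta}}=\sum_{\boldsymbol{i}\in\mathcal{G}_{\boldsymbol{\beta}}}\boldsymbol{i}^{2\boldsymbol{\alpha}}$ and $b_{\boldsymbol{\alpha}}=-Z_{2\boldsymbol{\alpha}}(s)$; the weights are extended to all of $\mathcal{X}_p$ by $w_{\boldsymbol{i}}=w_{\boldsymbol{\beta}}$ for $\boldsymbol{i}\in\mathcal{G}_{\boldsymbol{\beta}}$. ''Smooth and compactly supported in $V$'' means $\phi\in C_c^\infty(\mathbb{R}^d)$ with $\operatorname{supp}\phi\subset V$. The implied constant in $O(\cdot)$ may depend on $\phi,d,s,p,a$ but not on $h$. *)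

(* Defs.v *)
From HB Require Import structures.
From mathcomp Require Import all_boot all_order all_algebra.
From mathcomp Require Import complex.
From mathcomp Require Import all_classical all_reals all_analysis.
From mathcomp Require summability.

Set Implicit Arguments.
Unset Strict Implicit.
Unset Printing Implicit Defensive.

Import Order.TTheory GRing.Theory Num.Theory.
Import numFieldNormedType.Exports.

Local Open Scope classical_set_scope.
Local Open Scope ring_scope.
Local Open Scope complex_scope.

(* Lebesgue measure on R^d, carried by the measurable type [d.-tuple R]: the
   Dirac mass of the unique point for d = 0, and the image of the product
   measure on R * R^d under (x, t) |-> x :: t for d.+1. *)
Section lebesgue_tuple.
Context (R : realType).

Definition cons_pair (d : nat) (xt : measurableTypeR R * d.-tuple (measurableTypeR R))
  : d.+1.-tuple (measurableTypeR R) := [tuple of xt.1 :: xt.2].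

Lemma measurable_cons_pair (d : nat) : measurable_fun setT (@cons_pair d).
Proof. exact: measurable_cons. Qed.

Section step.
Context (d : nat)
  (mu : {sigma_finite_measure set (d.-tuple (measurableTypeR R)) -> \bar R}).

Definition lebesgue_cons : set (d.+1.-tuple (measurableTypeR R)) -> \bar R :=
  pushforward (@lebesgue_measure R \x mu)%E (@cons_pair d).

Let lebesgue_cons0 : lebesgue_cons set0 = 0%E.
Proof. by rewrite /lebesgue_cons /pushforward preimage_set0 measure0. Qed.

Let lebesgue_cons_ge0 A : (0 <= lebesgue_cons A)%E.
Proof. by rewrite /lebesgue_cons /pushforward; exact: measure_ge0. Qed.

Let lebesgue_cons_sigma_additive : semi_sigma_additive lebesgue_cons.
Proof.
move=> F mF tF mUF; rewrite /lebesgue_cons /pushforward preimage_bigcup.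
have mf := @measurable_cons_pair d.
apply: measure_semi_sigma_additive.
- by move=> n; rewrite -[X in measurable X]setTI; exact: mf.
- apply/trivIsetP => /= i j _ _ ij; rewrite -preimage_setI.
  by move/trivIsetP : tF => /(_ _ _ _ _ ij) ->//; rewrite preimage_set0.
- by rewrite -preimage_bigcup -[X in measurable X]setTI; exact: mf.
Qed.

HB.instance Definition _ := isMeasure.Build _ _ _ lebesgue_cons
  lebesgue_cons0 lebesgue_cons_ge0 lebesgue_cons_sigma_additive.

Let lebesgue_cons_sigma_finite : sigma_finite setT lebesgue_cons.
Proof.
pose lambda : {sigma_finite_measure set (measurableTypeR R) -> \bar R} :=
  @lebesgue_measure R.
have /sigma_finiteP[F [FT ndF Foo]] := sigma_finiteT lambda.
have /sigma_finiteP[G [GT ndG Goo]] := sigma_finiteT mu.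
pose g (t : d.+1.-tuple (measurableTypeR R)) := (thead t, [tuple of behead t]).
have mg : measurable_fun setT g.
  apply/measurable_fun_pairP; split; first exact: measurable_tnth.
  exact: measurable_behead.
have cK : cancel (@cons_pair d) g.
  by case=> x t; congr pair; apply/val_inj.
exists (fun n => g @^-1` (F n `*` G n)).
  apply/esym; rewrite -subTset => t _.
  have [n _ Fn] : (\bigcup_n F n) (g t).1 by rewrite -FT.
  have [k _ Gk] : (\bigcup_n G n) (g t).2 by rewrite -GT.
  exists (maxn n k) => //; split.
    by move: Fn; exact/subsetPset/ndF/leq_maxl.
  by move: Gk; exact/subsetPset/ndG/leq_maxr.
move=> n; have [mF Fnoo] := Foo n; have [mG Gnoo] := Goo n; split.
  by rewrite -[X in measurable X]setTI; apply: mg => //; exact: measurableX.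
rewrite /lebesgue_cons /pushforward -comp_preimage.
rewrite (_ : g \o _ = id); last by apply/funext => xt; exact: cK.
rewrite preimage_id [ltLHS](@product_measure1E _ _ _ _ _ lambda mu)//.
by rewrite lte_mul_pinfty// ge0_fin_numE.
Qed.

HB.instance Definition _ := Measure_isSigmaFinite.Build _ _ _ lebesgue_cons
  lebesgue_cons_sigma_finite.

End step.

Fixpoint lebesgue_tuple (d : nat) :
    {sigma_finite_measure set (d.-tuple (measurableTypeR R)) -> \bar R} :=
  if d is d'.+1 then lebesgue_cons (lebesgue_tuple d')
  else dirac [tuple].

End lebesgue_tuple.

Section multi_index.
Context (d : nat).

Definition absv (i : 'rV[int]_d) : 'rV[nat]_d := map_mx absz i.

Definition norm1 (b : 'rV[nat]_d) : nat := (\sum_j b ord0 j)%N.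

Definition norm_inf (b : 'rV[nat]_d) : nat := (\max_j b ord0 j)%N.

(* i^(2 alpha), with 0^0 = 1 *)
Definition monomial2 (alpha : 'rV[nat]_d) (i : 'rV[int]_d) : int :=
  \prod_j i 0 j ^+ (2 * alpha ord0 j).

Definition stencil (p : nat) : set 'rV[int]_d :=
  [set i | (norm1 (absv i) <= p)%N].

Definition sign_orbit (beta : 'rV[nat]_d) : set 'rV[int]_d :=
  [set i | forall j, i 0 j = (beta 0 j)%:Z \/ i 0 j = - (beta 0 j)%:Z].

End multi_index.

Section euclidean_space.
Context (R : realType) (d : nat).

Definition enorm (x : 'rV[R]_d) : R := Num.sqrt (\sum_j x 0 j ^+ 2).

Definition cube (a : R) : set 'rV[R]_d :=
  [set x | forall j, - a <= x 0 j <= a].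

Definition grid_point (h : R) (i : 'rV[int]_d) : 'rV[R]_d :=
  \row_j ((i 0 j)%:~R * h).

Definition vec (t : d.-tuple R) : 'rV[R]_d := \row_j tnth t j.

Definition integral_on (V : set 'rV[R]_d) (f : 'rV[R]_d -> R) : R :=
  \int[@lebesgue_tuple R d]_(t in [set t | V (vec t)]) f (vec t).

(* D_(i_1) ... D_(i_k) f for l = [:: i_1; ...; i_k] *)
Definition partial_derivative (l : seq 'I_d) (f : 'rV[R]_d -> R)
    : 'rV[R]_d -> R :=
  foldr (fun i g => 'D_(delta_mx 0 i) g) f l.

(* C^infty: the partial derivatives of all orders exist and are continuous *)
Definition smooth (f : 'rV[R]_d -> R) : Prop :=
  forall l : seq 'I_d,
    continuous (partial_derivative l f) /\
    forall (i : 'I_d) (x : 'rV[R]_d),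
      derivable (partial_derivative l f) x (delta_mx 0 i).

Definition support (f : 'rV[R]_d -> R) : set 'rV[R]_d :=
  closure [set x | f x != 0].

Definition smooth_compactly_supported_in (V : set 'rV[R]_d)
    (f : 'rV[R]_d -> R) : Prop :=
  [/\ smooth f, compact (support f) & support f `<=` V].

Definition sigma (s : R) (x : 'rV[R]_d) : R := (enorm x `^ s)^-1.

(* c_i = 2^(-m(i)), m(i) being the number of coordinates with |i_j| = N *)
Definition trapezoidal_weight (N : nat) (i : 'rV[int]_d) : R :=
  2 ^- #|[pred j : 'I_d | absv i 0 j == N]|.

Definition punctured_trapezoidal (a : R) (N : nat) (f : 'rV[R]_d -> R) : R :=
  (a / N%:R) ^+ d *
  \sum_(i \in [set i : 'rV[int]_d | (0 < norm_inf (absv i) <= N)%N])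
     trapezoidal_weight N i * f (grid_point (a / N%:R) i).

End euclidean_space.

Section zeta.
Context (R : realType) (d : nat).

(* x^z for x > 0 *)
Definition cpow (x : R) (z : R[i]) : R[i] :=
  (x `^ complex.Re z)%:C *
  (cos (complex.Im z * ln x) +i* sin (complex.Im z * ln x)).

(* general term of the series over Z^d \ {0}, extended by 0 at n = 0 *)
Definition zeta_term (alpha : 'rV[nat]_d) (z : R[i]) (n : 'rV[int]_d) : R[i] :=
  if n == 0 then 0
  else (monomial2 alpha n)%:~R / cpow (enorm (grid_point 1 n)) z.

Definition entire (g : R[i] -> R[i]) : Prop :=
  forall z : R[i], derivable (g : R[i]^o -> R[i]^o) z 1.

(* f is holomorphic on C minus {z0} and meromorphic at z0; the value f z0 is
   irrelevant *)
Definition meromorphic_with_only_pole (z0 : R[i]) (f : R[i] -> R[i]) : Prop :=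
  exists (k : nat) (g : R[i] -> R[i]),
    entire g /\ forall z, z != z0 -> g z = (z - z0) ^+ k * f z.

(* Z is the meromorphic continuation to C of the series of [zeta_term alpha],
   summed unconditionally, i.e. along the net of finite subsets of Z^d *)
Definition is_generalized_zeta (alpha : 'rV[nat]_d) (Z : R[i] -> R[i]) : Prop :=
  meromorphic_with_only_pole (d + 2 * norm1 alpha)%:R Z /\
  forall z : R[i], (d + 2 * norm1 alpha)%:R < complex.Re z ->
    (summability.partial_sum (zeta_term alpha z) : _ -> R[i]^o)
      @ @summability.totally 'rV[int]_d --> (Z z : R[i]^o).

End zeta.

Section sincotrap.
Context (R : realType) (d : nat).

Definition system_matrix (alpha beta : 'rV[nat]_d) : int :=
  \sum_(i \in sign_orbit beta) monomial2 alpha i.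

(* w solves the square system defining the converged weights; Z alpha stands
   for Z_(2 alpha) *)
Definition converged_weights (Z : 'rV[nat]_d -> R[i] -> R[i]) (s : R) (p : nat)
    (w : 'rV[nat]_d -> R[i]) : Prop :=
  forall alpha : 'rV[nat]_d, (norm1 alpha <= p)%N ->
    \sum_(beta \in [set beta : 'rV[nat]_d | (norm1 beta <= p)%N])
       (system_matrix alpha beta)%:~R * w beta = - Z alpha s%:C.

(* i lies in the sign orbit of beta iff beta = absv i, so that w (absv i) is
   the extension of the weights to the stencil *)
Definition sincotrap (a s : R) (p : nat) (w : 'rV[nat]_d -> R[i]) (N : nat)
    (phi : 'rV[R]_d -> R) : R[i] :=
  (punctured_trapezoidal a N (fun x => phi x * sigma s x))%:C +
  ((a / N%:R) `^ (d%:R - s))%:C *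
    \sum_(i \in @stencil d p) w (absv i) * (phi (grid_point (a / N%:R) i))%:C.

End sincotrap.

(* Main.v *)
Require Import Defs.
From HB Require Import structures.
From mathcomp Require Import all_boot all_order all_algebra.
From mathcomp Require Import complex.
From mathcomp Require Import all_classical all_reals all_analysis.
From mathcomp Require Import measurable_realfun finmap ring lra zify.
From mathcomp Require summability.
Import Order.TTheory GRing.Theory Num.Theory.
Import numFieldNormedType.Exports.
Local Open Scope classical_set_scope.
Local Open Scope ring_scope.
Local Open Scope complex_scope.
Set Implicit Arguments.
Unset Strict Implicit.
Unset Printing Implicit Defensive.
Import Normc.

(** Let [Q h] be the corrected rule and [T h] its punctured trapezoidal part. The
    proof compares two consecutive meshes, [h] and [h / 2], and never the rule
    with the integral directly.

    With eta = h / 2, the points of the coarse mesh are the even points of the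
    fine one, hence T h - T (h / 2) is eta ^ (d - s) times the sum over the
    lattice of eps m * phi (eta m) * |m| ^ (- s), where eps m is 2 ^ d - 1 at the
    points with even coordinates and - 1 elsewhere ([parity_weight],
    [has_sum_halving]). This weight is the sum of the nontrivial characters of
    (Z / 2) ^ d, which change sign under a unit translation; averaging with the
    translate [K] times replaces the summand by its [K]-th differences
    ([regularize]). The differences of a symbol, that is of a function that loses
    one power of growth with each difference, become summable, so that every
    monomial m ^ l gets a regularized sum lambda_l of
    eps m * m ^ l * |m| ^ (- s). The function |m| ^ (- s) is a symbol
    ([norm_pow_symbol]), and so is the Taylor remainder of [phi] divided by
    eta ^ (2 p + 2), uniformly in eta ([taylor_rem_symbol]). Therefore
    T h - T (h / 2) is eta ^ (d - s) times the sum of c_l * eta ^ |l| * lambda_l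
    over |l| < 2 p + 2, up to O(eta ^ (2 p + 2 + d - s)), the c_l being the Taylor
    coefficients of [phi].

    To compute lambda_l, let a complex [z] take the place of [s]. For a large
    real part all the series converge absolutely, and separating the even
    points gives lambda_l = (2 ^ (d + |l| - z) - 1) * Z_l z, which is zero if some
    exponent of m ^ l is odd. Both sides are holomorphic for [Re z > - 1], once
    multiplied by a power of z - (d + |l|), so the equality persists at [z = s]
    ([regularized_continuation]). The identity theorem that this requires is
    derived from Goursat's theorem and a Cauchy estimate on rectangles
    ([goursat], [cauchy_estimate], [identity_limit]).

    The correction term of [Q h] expands with the moments mu_l of the weights
    instead; passing from [h / 2] to [h] multiplies its term of degree |l| by
    2 ^ (d + |l| - s). The linear system says that mu_l is the opposite of the
    zeta value, or zero by symmetry, so all the terms of degree below 2 p + 2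
    cancel ([moment_cancel]) and Q h - Q (h / 2) = O(h ^ (2 p + 2 + d - s))
    ([mesh_difference]). Finally [Q (h / 2 ^ k)] tends to the integral, by
    dominated convergence of step functions ([riemann_cvg], [sincotrap_cvg]), and
    the geometric series of the increments bounds the error
    ([dyadic_telescope]). *)

(** * The modulus of a complex number *)

Section complex_norm.
Context {R : realType}.
Implicit Types z : R[i].

Lemma normr_normc z : `|z| = (normc z)%:C.
Proof. by case: z. Qed.

Lemma normc_ge0 z : 0 <= normc z.
Proof. by case: z => a b; exact: sqrtr_ge0. Qed.

Lemma ler_normcD z1 z2 : normc (z1 + z2) <= normc z1 + normc z2.
Proof. exact: le_normcD. Qed.

Lemma normc_opp z : normc (- z) = normc z.
Proof. exact: normcN. Qed.

Lemma ler_normcB z1 z2 : normc (z1 - z2) <= normc z1 + normc z2.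
Proof. by rewrite -[normc z2]normc_opp ler_normcD. Qed.

Lemma normc_real (x : R) : normc x%:C = `|x|.
Proof. by rewrite /= expr0n addr0 sqrtr_sqr. Qed.

Lemma ler_normc_Re z : `|complex.Re z| <= normc z.
Proof.
case: z => a b /=; rewrite -[leLHS]sqrtr_sqr ler_wsqrtr//.
by rewrite lerDl sqr_ge0.
Qed.

Lemma ler_normc_Im z : `|complex.Im z| <= normc z.
Proof.
case: z => a b /=; rewrite -[leLHS]sqrtr_sqr ler_wsqrtr//.
by rewrite lerDr sqr_ge0.
Qed.

Lemma normc_le_ReIm z : normc z <= `|complex.Re z| + `|complex.Im z|.
Proof.
case: z => a b /=; rewrite -[leRHS]ger0_norm ?addr_ge0//.
rewrite -sqrtr_sqr ler_wsqrtr// sqrrD !real_normK ?num_real//.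
by rewrite addrAC lerDl mulrn_wge0// mulr_ge0.
Qed.

Lemma normcX z n : normc (z ^+ n) = normc z ^+ n.
Proof. by elim: n => [|n ih]; rewrite ?expr0 ?normc1// !exprS normcM ih. Qed.

Lemma normc_gt0 z : (0 < normc z) = (z != 0).
Proof.
rewrite lt_def normc_ge0 andbT; congr (~~ _); apply/eqP/eqP => [/eq0_normc//|->].
exact: normc0.
Qed.

Lemma ReD z1 z2 : complex.Re (z1 + z2) = complex.Re z1 + complex.Re z2.
Proof. by case: z1 z2 => ? ? []. Qed.
Lemma ImD z1 z2 : complex.Im (z1 + z2) = complex.Im z1 + complex.Im z2.
Proof. by case: z1 z2 => ? ? []. Qed.
Lemma ReN z : complex.Re (- z) = - complex.Re z.
Proof. by case: z. Qed.
Lemma ImN z : complex.Im (- z) = - complex.Im z.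
Proof. by case: z. Qed.
Lemma ReM z1 z2 : complex.Re (z1 * z2) =
  complex.Re z1 * complex.Re z2 - complex.Im z1 * complex.Im z2.
Proof. by case: z1 z2 => ? ? []. Qed.
Lemma ImM z1 z2 : complex.Im (z1 * z2) =
  complex.Re z1 * complex.Im z2 + complex.Im z1 * complex.Re z2.
Proof. by case: z1 z2 => ? ? []. Qed.

End complex_norm.
Arguments normc {R} x : simpl never.

(** * Complex derivatives *)

Section complex_derivative.
Context {R : realType}.
Local Notation C := R[i].

(** Measured by the real-valued modulus, while [derivable] over [C^o] uses the
    complex-valued norm. *)
Definition has_cderiv (F : C -> C) (z l : C) :=
  forall e : R, 0 < e -> exists2 r : R, 0 < r &
    forall u : C, normc u < r -> normc (F (z + u) - F z - l * u) <= e * normc u.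

Definition cdiff (F : C -> C) (z : C) := exists l, has_cderiv F z l.

Lemma derivable_cdiff (F : C -> C) z :
  derivable (F : C^o -> C^o) z 1 -> cdiff F z.
Proof.
move=> dF; exists ('D_1 (F : C^o -> C^o) z).
move=> e e0; have := dF; rewrite /derivable => /cvgrPdist_le /(_ e%:C).
rewrite ltcR e0 => /(_ isT).
rewrite near_withinE => /nbhs_ballP[r /= r0 hr].
have [r1 r1E] : exists r1, r = r1%:C.
  by case: r r0 {hr} => a b; rewrite ltcE/= => /andP[/eqP-> _]; exists a.
exists r1; first by rewrite -ltcR -r1E.
move=> u ur; have [->|u0] := eqVneq u 0.
  by rewrite addr0 mulr0 subr0 subrr normc0 mulr0.
have : ball (0 : C^o) r u by rewrite /ball/= sub0r normrN normr_normc r1E ltcR.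
move=> /hr /(_ u0); rewrite normr_normc lecR.
rewrite -/(derive (F : C^o -> C^o) z 1) => h.
have -> : F (z + u) - F z - 'D_1 (F : C^o -> C^o) z * u =
   - (('D_1 (F : C^o -> C^o) z - u^-1 * (F (u * 1 + z) - F z)) * u).
  by rewrite mulrBl mulrAC mulVf// mul1r mulr1 opprB [u + z]addrC.
by rewrite normc_opp normcM ler_wpM2r ?normc_ge0.
Qed.

Lemma cdiff_derivable (F : C -> C) z :
  cdiff F z -> derivable (F : C^o -> C^o) z 1.
Proof.
move=> [l hl]; apply/cvg_ex; exists l; apply/cvgrPdist_le => e.
case: e => e e'; rewrite ltcE/= => /andP[/eqP-> e0].
have [r r0 hr] := hl _ e0.
rewrite near_withinE; apply/nbhs_ballP; exists r%:C; first by rewrite /= ltcR.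
move=> u; rewrite /ball/= sub0r normrN normr_normc ltcR => ur u0.
rewrite normr_normc lecR.
rewrite -(ler_pM2r (_ : 0 < normc u)) ?normc_gt0//.
apply: le_trans (hr _ ur); rewrite -normcM -normc_opp le_eqVlt; apply/orP; left; apply/eqP.
congr normc; rewrite mulrBl opprB -[_ *: _]/(_ * _) mulrAC mulVf// mul1r.
by rewrite -[_ *: _]/(_ * _) mulr1 [u + z]addrC.
Qed.

Lemma cdiffP (F : C -> C) z :
  cdiff F z <-> derivable (F : C^o -> C^o) z 1.
Proof. by split; [exact: cdiff_derivable|exact: derivable_cdiff]. Qed.

Lemma cdiffD F G z : cdiff F z -> cdiff G z -> cdiff (fun z => F z + G z) z.
Proof. by move=> /cdiffP ? /cdiffP ?; apply/cdiffP/derivableD. Qed.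

Lemma cdiffB F G z : cdiff F z -> cdiff G z -> cdiff (fun z => F z - G z) z.
Proof. by move=> /cdiffP ? /cdiffP ?; apply/cdiffP/derivableB. Qed.

Lemma cdiffM F G z : cdiff F z -> cdiff G z -> cdiff (fun z => F z * G z) z.
Proof.
move=> /cdiffP dF /cdiffP dG; apply/cdiffP.
have h := @derivableM C C^o F G z 1 dF dG.
rewrite mulrfctE in h.
exact: h.
Qed.

Lemma cdiff_cst c z : cdiff (fun=> c) z.
Proof. exact/cdiffP/derivable_cst. Qed.

Lemma cdiff_id z : cdiff id z.
Proof. exact/cdiffP/derivable_id. Qed.

Lemma cdiffX F n z : cdiff F z -> cdiff (fun z => F z ^+ n) z.
Proof.
move=> dF; elim: n => [|n ih].
  by under eq_fun do rewrite expr0; exact: cdiff_cst.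
by under eq_fun do rewrite exprS; exact: cdiffM.
Qed.

Lemma cdiffV F z : F z != 0 -> cdiff F z -> cdiff (fun z => (F z)^-1) z.
Proof.
move=> F0 /cdiffP dF; apply/cdiffP.
have h := @derivableV C C^o F z 1 F0 dF.
exact: h.
Qed.

Lemma cdiff_sum (I : Type) (r : seq I) (F : I -> C -> C) z :
  (forall i, cdiff (F i) z) -> cdiff (fun z => \sum_(i <- r) F i z) z.
Proof.
move=> dF; elim: r => [|i r ih].
  by under eq_fun do rewrite big_nil; exact: cdiff_cst.
by under eq_fun do rewrite big_cons; exact: cdiffD.
Qed.

End complex_derivative.

(** * Integrals of complex functions along the sides of rectangles *)

Section segment_integral.
Context {R : realType}.
Local Notation C := R[i].
Local Notation mu := (@lebesgue_measure R).

Definition rint (a b : R) (u : R -> R) : R := \int[mu]_(x in `[a, b]) u x.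

Definition rcont (a b : R) (u : R -> R) :=
  forall x, a <= x <= b -> {for x, continuous u}.

Lemma rcont_integrable a b u : rcont a b u ->
  mu.-integrable `[a, b] (EFin \o u).
Proof.
move=> cu; apply: continuous_compact_integrable; first exact: segment_compact.
apply: continuous_in_subspaceT => x /set_mem /=; rewrite in_itv/= => abx.
exact: cu.
Qed.

Lemma rcontS a b c d u : c <= a -> b <= d -> rcont c d u -> rcont a b u.
Proof.
move=> ca bd h x /andP[ax xb]; apply: h.
by rewrite (le_trans ca ax) (le_trans xb bd).
Qed.

Lemma rintD a b u v : rcont a b u -> rcont a b v ->
  rint a b (fun x => u x + v x) = rint a b u + rint a b v.
Proof. by move=> /rcont_integrable ? /rcont_integrable ?; exact: RintegralD. Qed.

Lemma rintZ a b c u : rcont a b u ->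
  rint a b (fun x => c * u x) = c * rint a b u.
Proof. by move=> /rcont_integrable ?; exact: RintegralZl. Qed.

Lemma rcontD a b u v : rcont a b u -> rcont a b v -> rcont a b (fun x => u x + v x).
Proof. by move=> cu cv x abx; apply: continuousD; [exact: cu|exact: cv]. Qed.

Lemma rcontB a b u v : rcont a b u -> rcont a b v -> rcont a b (fun x => u x - v x).
Proof. by move=> cu cv x abx; apply: cvgB; [exact: cu|exact: cv]. Qed.

Lemma rcontZ a b c u : rcont a b u -> rcont a b (fun x => c * u x).
Proof. by move=> cu x abx; apply: continuousM; [exact: cst_continuous|exact: cu]. Qed.

Lemma rintB a b u v : rcont a b u -> rcont a b v ->
  rint a b (fun x => u x - v x) = rint a b u - rint a b v.
Proof. by move=> /rcont_integrable ? /rcont_integrable ?; exact: RintegralB. Qed.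

Lemma rcont_cst a b c : rcont a b (fun=> c).
Proof. by move=> x _; exact: cst_continuous. Qed.

Lemma rint_cst a b c : a <= b -> rint a b (fun=> c) = c * (b - a).
Proof.
move=> ab; rewrite /rint Rintegral_cst//= lebesgue_measure_itv/= lte_fin.
by case: ltgtP ab => // -> _; rewrite subrr.
Qed.

Lemma rint_chasles a b c u : a <= b -> b <= c -> rcont a c u ->
  rint a c u = rint a b u + rint b c u.
Proof.
move=> ab bc cu; apply/eqP; rewrite addrC -subr_eq; apply/eqP.
rewrite /rint Rintegral_itvB ?bnd_simp//; last exact: rcont_integrable.
rewrite Rintegral_itv_obnd_cbnd//.
apply: integrableS (rcont_integrable (rcontS ab (lexx c) cu)) => //.
by apply: subset_itvr; rewrite bnd_simp.
Qed.

Lemma ler_rint a b u v : rcont a b u -> rcont a b v ->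
  (forall x, a <= x <= b -> u x <= v x) -> rint a b u <= rint a b v.
Proof.
by move=> /rcont_integrable ? /rcont_integrable ? h; exact: le_Rintegral.
Qed.

Lemma rint_norm a b u B : a <= b -> rcont a b u ->
  (forall x, a <= x <= b -> `|u x| <= B) -> `|rint a b u| <= B * (b - a).
Proof.
move=> ab cu h; rewrite ler_norml -mulNr -!rint_cst//; apply/andP; split.
- by apply: ler_rint => //; [exact: rcont_cst|move=> x /h; rewrite ler_norml => /andP[]].
- by apply: ler_rint => //; [exact: rcont_cst|move=> x /h; rewrite ler_norml => /andP[]].
Qed.

Lemma rint_id a b : a <= b -> rint a b id = (b ^+ 2 - a ^+ 2) / 2.
Proof.
rewrite le_eqVlt => /predU1P[->|ab].
  rewrite subrr mul0r /rint set_itv1 Rintegral_set1//.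
rewrite /rint /Rintegral (@continuous_FTC2 _ id (fun x : R => x ^+ 2 / 2))//=.
- by rewrite mulrBl.
- by apply: continuous_subspaceT => x; exact: cvg_id.
- split.
  + by move=> x _; apply: derivableM => //; exact: exprn_derivable.
  + by apply: cvg_at_right_filter; apply: cvgMr_tmp; exact: exprn_continuous.
  + by apply: cvg_at_left_filter; apply: cvgMr_tmp; exact: exprn_continuous.
- move=> x _; rewrite derive1Mr; last exact: exprn_derivable.
  rewrite derive1E exp_derive -[_ *: 1]/(2 *: x ^+ 1 * 1) -[_ *: _]/(2 * x ^+ 1).
  by rewrite mulr1 expr1 mulrC mulKf.
Qed.

Definition cint (a b : R) (f : R -> C) : C :=
  rint a b (fun x => complex.Re (f x)) +i* rint a b (fun x => complex.Im (f x)).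

Definition ccont (a b : R) (f : R -> C) :=
  rcont a b (fun x => complex.Re (f x)) /\ rcont a b (fun x => complex.Im (f x)).

Lemma cintD a b f g : ccont a b f -> ccont a b g ->
  cint a b (fun x => f x + g x) = cint a b f + cint a b g.
Proof.
move=> [f1 f2] [g1 g2]; apply/eqP; rewrite eq_complex ReD ImD /=.
rewrite -!rintD//; apply/andP; split; apply/eqP; congr rint; apply/funext => x.
  exact: ReD.
exact: ImD.
Qed.

Lemma cintZ a b c f : ccont a b f ->
  cint a b (fun x => c * f x) = c * cint a b f.
Proof.
case: c => c1 c2 [f1 f2]; rewrite /cint; simpc; congr (_ +i* _).
  rewrite -!rintZ// -rintB; [|exact: rcontZ..]; congr rint; apply/funext => x.
  by rewrite ReM.
rewrite -!rintZ// -rintD; [|exact: rcontZ..]; congr rint; apply/funext => x.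
by rewrite ImM.
Qed.

Lemma ccontZ a b c f : ccont a b f -> ccont a b (fun x => c * f x).
Proof.
case: c => c1 c2 [f1 f2]; split.
  under eq_fun do rewrite ReM/=.
  by apply: rcontB; exact: rcontZ.
under eq_fun do rewrite ImM/=.
by apply: rcontD; exact: rcontZ.
Qed.

Lemma cint_cst a b c : a <= b -> cint a b (fun=> c) = c * (b - a)%:C.
Proof.
by move=> ab; rewrite /cint !rint_cst//; case: c => c1 c2; simpc.
Qed.

Lemma ccont_cst a b c : ccont a b (fun=> c).
Proof. by split; exact: rcont_cst. Qed.

Lemma cint_chasles a b c f : a <= b -> b <= c -> ccont a c f ->
  cint a c f = cint a b f + cint b c f.
Proof. by move=> ab bc [f1 f2]; rewrite /cint !(rint_chasles ab bc)//; simpc. Qed.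

Lemma cint_norm a b f B : a <= b -> ccont a b f ->
  (forall x, a <= x <= b -> normc (f x) <= B) ->
  normc (cint a b f) <= 2 * B * (b - a).
Proof.
move=> ab [f1 f2] h; apply: le_trans (normc_le_ReIm _) _.
rewrite (_ : 2 * B * (b - a) = B * (b - a) + B * (b - a)); last by ring.
apply: lerD; apply: rint_norm => // x /h; apply: le_trans.
  exact: ler_normc_Re.
exact: ler_normc_Im.
Qed.

Lemma cint_id a b : a <= b -> cint a b (fun x => x%:C) = ((b ^+ 2 - a ^+ 2) / 2)%:C.
Proof. by move=> ab; rewrite /cint/= rint_id// rint_cst// mul0r. Qed.

Lemma ccont_id a b : ccont a b (fun x => x%:C).
Proof. by split => x _; [exact: cvg_id|exact: cst_continuous]. Qed.

Lemma cdiff_lip (F : C -> C) z : cdiff F z ->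
  exists M r : R, [/\ 0 <= M, 0 < r & forall u, normc u < r ->
    normc (F (z + u) - F z) <= M * normc u].
Proof.
move=> [l /(_ _ ltr01)[r r0 h]]; exists (normc l + 1), r; split => //.
  by rewrite addr_ge0 ?normc_ge0.
move=> u /h {}h; rewrite -[X in normc X](subrK (l * u)).
by apply: le_trans (ler_normcD _ _) _; rewrite normcM mulrDl addrC lerD2l.
Qed.

Lemma cdiff_continuous_line (F : C -> C) (z v : C) (t : R) :
  cdiff F (z + v * t%:C) ->
  {for t, continuous (fun t : R => complex.Re (F (z + v * t%:C)))} /\
  {for t, continuous (fun t : R => complex.Im (F (z + v * t%:C)))}.
Proof.
move=> /cdiff_lip[M [r [M0 r0 h]]].
suff H e : 0 < e -> \forall t' \near t,
    normc (F (z + v * t%:C) - F (z + v * t'%:C)) <= e.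
  split; apply/cvgrPdist_le => e e0; near=> t'.
    have : normc (F (z + v * t%:C) - F (z + v * t'%:C)) <= e by near: t'; exact: H.
    by apply: le_trans; rewrite -ReN -ReD; exact: ler_normc_Re.
  have : normc (F (z + v * t%:C) - F (z + v * t'%:C)) <= e by near: t'; exact: H.
  by apply: le_trans; rewrite -ImN -ImD; exact: ler_normc_Im.
move=> e0; set D := (M + 1) * (normc v + 1).
have D0 : 0 < D by rewrite mulr_gt0// ltr_wpDl ?normc_ge0.
near=> t'.
have tt' : `|t' - t| < Num.min (r / (normc v + 1)) (e / D).
  rewrite distrC; near: t'; apply: (@cvgr_dist_lt _ _ _ _ _ id t) => //.
  by rewrite lt_min !divr_gt0// ltr_wpDl ?normc_ge0.
have nu : normc (v * (t' - t)%:C) <= (normc v + 1) * `|t' - t|.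
  by rewrite normcM normc_real ler_wpM2r// lerDl.
have -> : z + v * t'%:C = z + v * t%:C + v * (t' - t)%:C.
  by rewrite rmorphB/=; ring.
rewrite -normc_opp opprB; move: tt'; rewrite lt_min => /andP[tt1 tt2].
have v1 : 0 < normc v + 1 by rewrite ltr_wpDl ?normc_ge0.
apply: le_trans (h _ _) _.
  by apply: le_lt_trans nu _; rewrite mulrC -ltr_pdivlMr.
apply: (@le_trans _ _ (D * `|t' - t|)); last first.
  by rewrite mulrC -ler_pdivlMr// ltW.
rewrite /D -mulrA; apply: ler_pM => //; first exact: normc_ge0.
by rewrite lerDl.
Unshelve. all: by end_near.
Qed.

Lemma cdiff_ccont_hor (F : C -> C) a b y :
  (forall x, a <= x <= b -> cdiff F (x +i* y)) -> ccont a b (fun x => F (x +i* y)).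
Proof.
have E x : x +i* y = 'i * y%:C + 1 * x%:C by simpc.
move=> dF; split => x xab; have := dF x xab; rewrite E => /cdiff_continuous_line[h1 h2].
  by apply: (eq_ind _ (fun g : R -> R => {for x, continuous g}) h1); apply/funext => ?; rewrite E.
by apply: (eq_ind _ (fun g : R -> R => {for x, continuous g}) h2); apply/funext => ?; rewrite E.
Qed.

Lemma cdiff_ccont_ver (F : C -> C) a b x :
  (forall y, a <= y <= b -> cdiff F (x +i* y)) -> ccont a b (fun y => F (x +i* y)).
Proof.
have E y : x +i* y = x%:C + 'i * y%:C by simpc.
move=> dF; split => y yab; have := dF y yab; rewrite E => /cdiff_continuous_line[h1 h2].
  by apply: (eq_ind _ (fun g : R -> R => {for y, continuous g}) h1); apply/funext => ?; rewrite E.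
by apply: (eq_ind _ (fun g : R -> R => {for y, continuous g}) h2); apply/funext => ?; rewrite E.
Qed.

End segment_integral.

(** * Goursat's theorem and the Cauchy estimate *)

Section goursat.
Context {R : realType}.
Local Notation C := R[i].

(** the contour integral, run counterclockwise *)
Definition rect_int (F : C -> C) (x0 x1 y0 y1 : R) : C :=
  cint x0 x1 (fun x => F (x +i* y0)) - cint x0 x1 (fun x => F (x +i* y1)) +
  'i * (cint y0 y1 (fun y => F (x1 +i* y)) - cint y0 y1 (fun y => F (x0 +i* y))).

(** Continuity on the sides only, so as to allow integrands with a singularity
    inside the rectangle. *)
Definition rect_cont (F : C -> C) (x0 x1 y0 y1 : R) :=
  (forall y, y = y0 \/ y = y1 -> ccont x0 x1 (fun x => F (x +i* y))) /\
  (forall x, x = x0 \/ x = x1 -> ccont y0 y1 (fun y => F (x +i* y))).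

Definition rect_boundary (x0 x1 y0 y1 x y : R) :=
  [/\ x0 <= x <= x1, y0 <= y <= y1 & x = x0 \/ x = x1 \/ y = y0 \/ y = y1].

Definition cdiff_on (F : C -> C) (x0 x1 y0 y1 : R) :=
  forall x y, x0 <= x <= x1 -> y0 <= y <= y1 -> cdiff F (x +i* y).

Lemma boundary_rect_cont F x0 x1 y0 y1 : x0 <= x1 -> y0 <= y1 ->
  (forall x y, rect_boundary x0 x1 y0 y1 x y -> cdiff F (x +i* y)) ->
  rect_cont F x0 x1 y0 y1.
Proof.
move=> xx yy dF; split => [y hy|x hx].
  apply: cdiff_ccont_hor => x hx; apply: dF; split => //; last tauto.
  by case: hy => ->; rewrite lexx yy.
apply: cdiff_ccont_ver => y hy; apply: dF; split => //; last tauto.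
by case: hx => ->; rewrite lexx xx.
Qed.

Lemma cdiff_rect_cont F x0 x1 y0 y1 : x0 <= x1 -> y0 <= y1 ->
  cdiff_on F x0 x1 y0 y1 -> rect_cont F x0 x1 y0 y1.
Proof. by move=> ? ? dF; apply: boundary_rect_cont => // x y [? ? _]; exact: dF. Qed.

Lemma cdiff_onS F x0 x1 y0 y1 x0' x1' y0' y1' :
  x0 <= x0' -> x1' <= x1 -> y0 <= y0' -> y1' <= y1 ->
  cdiff_on F x0 x1 y0 y1 -> cdiff_on F x0' x1' y0' y1'.
Proof.
move=> h1 h2 h3 h4 dF x y /andP[hx hx'] /andP[hy hy']; apply: dF.
  by rewrite (le_trans h1 hx) (le_trans hx' h2).
by rewrite (le_trans h3 hy) (le_trans hy' h4).
Qed.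

Lemma rect_intD F G x0 x1 y0 y1 : x0 <= x1 -> y0 <= y1 ->
  rect_cont F x0 x1 y0 y1 -> rect_cont G x0 x1 y0 y1 ->
  rect_int (fun z => F z + G z) x0 x1 y0 y1 =
  rect_int F x0 x1 y0 y1 + rect_int G x0 x1 y0 y1.
Proof.
move=> xx yy [F1 F2] [G1 G2]; rewrite /rect_int !cintD; first ring.
all: (apply: F1 || apply: F2 || apply: G1 || apply: G2); tauto.
Qed.

Lemma rect_intZ F c x0 x1 y0 y1 : x0 <= x1 -> y0 <= y1 ->
  rect_cont F x0 x1 y0 y1 ->
  rect_int (fun z => c * F z) x0 x1 y0 y1 = c * rect_int F x0 x1 y0 y1.
Proof.
move=> xx yy [F1 F2]; rewrite /rect_int !cintZ; first ring.
all: (apply: F1 || apply: F2); tauto.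
Qed.

Lemma rect_int_affine a b x0 x1 y0 y1 : x0 <= x1 -> y0 <= y1 ->
  rect_int (fun z => a + b * z) x0 x1 y0 y1 = 0.
Proof.
move=> xx yy.
have hor y : cint x0 x1 (fun x => a + b * (x +i* y)) =
    (a + b * 'i * y%:C) * (x1 - x0)%:C + b * ((x1 ^+ 2 - x0 ^+ 2) / 2)%:C.
  rewrite -(cint_cst _ xx) -(cint_id xx) -cintZ; last exact: ccont_id.
  rewrite -cintD; [|exact: ccont_cst|exact/ccontZ/ccont_id].
  congr cint; apply/funext => x.
  have -> : x +i* y = x%:C + 'i * y%:C by simpc.
  ring.
have ver x : cint y0 y1 (fun y => a + b * (x +i* y)) =
    (a + b * x%:C) * (y1 - y0)%:C + b * 'i * ((y1 ^+ 2 - y0 ^+ 2) / 2)%:C.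
  rewrite -(cint_cst _ yy) -(cint_id yy) -cintZ; last exact: ccont_id.
  rewrite -cintD; [|exact: ccont_cst|exact/ccontZ/ccont_id].
  congr cint; apply/funext => y.
  have -> : x +i* y = x%:C + 'i * y%:C by simpc.
  ring.
rewrite /rect_int !hor !ver !(rmorphM, rmorphB, rmorphXn)/=; ring.
Qed.

Lemma rect_int_splitx F x0 x x1 y0 y1 : x0 <= x -> x <= x1 -> y0 <= y1 ->
  rect_cont F x0 x1 y0 y1 ->
  rect_int F x0 x1 y0 y1 = rect_int F x0 x y0 y1 + rect_int F x x1 y0 y1.
Proof.
move=> h1 h2 yy [F1 F2]; rewrite /rect_int !(cint_chasles h1 h2); first ring.
all: by apply: F1; tauto.
Qed.

Lemma rect_int_splity F x0 x1 y0 y y1 : x0 <= x1 -> y0 <= y -> y <= y1 ->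
  rect_cont F x0 x1 y0 y1 ->
  rect_int F x0 x1 y0 y1 = rect_int F x0 x1 y0 y + rect_int F x0 x1 y y1.
Proof.
move=> xx h1 h2 [F1 F2]; rewrite /rect_int !(cint_chasles h1 h2); first ring.
all: by apply: F2; tauto.
Qed.

Lemma rect_int_norm F x0 x1 y0 y1 B : x0 <= x1 -> y0 <= y1 ->
  rect_cont F x0 x1 y0 y1 ->
  (forall x y, rect_boundary x0 x1 y0 y1 x y -> normc (F (x +i* y)) <= B) ->
  normc (rect_int F x0 x1 y0 y1) <= 4 * B * ((x1 - x0) + (y1 - y0)).
Proof.
move=> xx yy [F1 F2] FB.
have hx y : y = y0 \/ y = y1 ->
    normc (cint x0 x1 (fun x => F (x +i* y))) <= 2 * B * (x1 - x0).
  move=> hy; apply: cint_norm => //; first exact: F1.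
  move=> x hx; apply: FB; split => //; last tauto.
  by case: hy => ->; rewrite lexx yy.
have hy x : x = x0 \/ x = x1 ->
    normc (cint y0 y1 (fun y => F (x +i* y))) <= 2 * B * (y1 - y0).
  move=> hx'; apply: cint_norm => //; first exact: F2.
  move=> y hy; apply: FB; split => //; last tauto.
  by case: hx' => ->; rewrite lexx xx.
rewrite /rect_int; apply: le_trans (ler_normcD _ _) _.
rewrite (mulrDr (4 * B)); apply: lerD.
  apply: le_trans (ler_normcB _ _) _.
  rewrite (_ : 4 * B * (x1 - x0) = 2 * B * (x1 - x0) + 2 * B * (x1 - x0)); last by ring.
  by apply: lerD; apply: hx; tauto.
rewrite normcM (_ : normc 'i = 1); last by rewrite /normc/= expr0n expr1n add0r sqrtr1.
rewrite mul1r; apply: le_trans (ler_normcB _ _) _.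
rewrite (_ : 4 * B * (y1 - y0) = 2 * B * (y1 - y0) + 2 * B * (y1 - y0)); last by ring.
by apply: lerD; apply: hy; tauto.
Qed.

Lemma nested_intervals (l r : nat -> R) :
  (forall n, l n <= l n.+1) -> (forall n, r n.+1 <= r n) -> (forall n, l n <= r n) ->
  exists x, forall n, l n <= x <= r n.
Proof.
move=> hl hr lr.
have hl' : {homo l : n m / (n <= m)%N >-> n <= m} by exact/nondecreasing_seqP.
have hr' : {homo r : n m / (n <= m)%N >-> m <= n} by exact/nonincreasing_seqP.
have lr' n m : l n <= r m.
  apply: (@le_trans _ _ (l (maxn n m))); first by apply: hl'; exact: leq_maxl.
  by apply: le_trans (lr _) _; apply: hr'; exact: leq_maxr.
have ub m : ubound (range l) (r m) by move=> _ [n _ <-].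
exists (sup (range l)) => n; apply/andP; split.
  by apply: ub_le_sup; [exists (r 0%N)|exists n].
by apply: ge_sup; [exists (l 0%N), 0%N|exact: ub].
Qed.

(** Bisection: among the four quarters of a rectangle, one carries at least a
    quarter of the integral; at the common point of the nested rectangles the
    affine approximation of [F] makes the integral small with respect to the
    area. *)
Lemma goursat F x0 x1 y0 y1 : x0 <= x1 -> y0 <= y1 ->
  cdiff_on F x0 x1 y0 y1 -> rect_int F x0 x1 y0 y1 = 0.
Proof.
move=> xx yy dF; apply: eq0_normc; apply/eqP; rewrite eq_le normc_ge0 andbT.
rewrite leNgt; apply/negP; set E := normc _ => E0.
pose w n := (x1 - x0) / 2 ^+ n; pose h n := (y1 - y0) / 2 ^+ n.
have w0 n : 0 <= w n by rewrite divr_ge0 ?subr_ge0 ?exprn_ge0.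
have h0 n : 0 <= h n by rewrite divr_ge0 ?subr_ge0 ?exprn_ge0.
have wS n : w n = w n.+1 + w n.+1.
  by rewrite /w exprS; field; exact: expf_neq0.
have hS n : h n = h n.+1 + h n.+1.
  by rewrite /h exprS; field; exact: expf_neq0.
(* [q] is the lower left corner of a rectangle whose sides are those of the
   initial one divided by 2 ^ n *)
pose P n (q : R * R) := [/\ x0 <= q.1, q.1 + w n <= x1, y0 <= q.2, q.2 + h n <= y1 &
  E / 4 ^+ n <= normc (rect_int F q.1 (q.1 + w n) q.2 (q.2 + h n))].
have step (u : {nq : nat * (R * R) | P nq.1 nq.2}) :
    { v : {nq : nat * (R * R) | P nq.1 nq.2} | [/\ (sval v).1 = (sval u).1.+1,
    (sval u).2.1 <= (sval v).2.1, (sval u).2.2 <= (sval v).2.2,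
    (sval v).2.1 + w (sval v).1 <= (sval u).2.1 + w (sval u).1 &
    (sval v).2.2 + h (sval v).1 <= (sval u).2.2 + h (sval u).1] }.
  apply: cid; case: u => [[n [x y]] /= [/= hx hx' hy hy' hE]].
  move: (w0 n.+1) (h0 n.+1) => w0' h0'.
  have cF : cdiff_on F x (x + w n) y (y + h n).
    exact: (cdiff_onS hx hx' hy hy').
  have a1 : x <= x + w n.+1 by rewrite lerDl.
  have a2 : x + w n.+1 <= x + w n by rewrite (wS n) addrA lerDl.
  have a3 : y <= y + h n.+1 by rewrite lerDl.
  have a4 : y + h n.+1 <= y + h n by rewrite (hS n) addrA lerDl.
  have xw : x <= x + w n by rewrite lerDl.
  have yh : y <= y + h n by rewrite lerDl.
  move: hE; rewrite (rect_int_splitx a1 a2 yh (cdiff_rect_cont xw yh cF)).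
  rewrite (rect_int_splity a1 a3 a4); last first.
    by apply: cdiff_rect_cont => //; exact: cdiff_onS cF.
  rewrite (rect_int_splity a2 a3 a4); last first.
    by apply: cdiff_rect_cont => //; exact: cdiff_onS cF.
  have xE : x + w n = x + w n.+1 + w n.+1 by rewrite (wS n) addrA.
  have yE : y + h n = y + h n.+1 + h n.+1 by rewrite (hS n) addrA.
  rewrite xE yE.
  set q1 := rect_int F x (x + w n.+1) y (y + h n.+1).
  set q2 := rect_int F x (x + w n.+1) (y + h n.+1) (y + h n.+1 + h n.+1).
  set q3 := rect_int F (x + w n.+1) (x + w n.+1 + w n.+1) y (y + h n.+1).
  set q4 := rect_int F (x + w n.+1) (x + w n.+1 + w n.+1) (y + h n.+1) _ => hE.
  have EE : E / 4 ^+ n = 4 * (E / 4 ^+ n.+1).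
    by clearbody E; rewrite exprS; field; exact: expf_neq0.
  have : E / 4 ^+ n.+1 <= normc q1 \/ E / 4 ^+ n.+1 <= normc q2 \/
         E / 4 ^+ n.+1 <= normc q3 \/ E / 4 ^+ n.+1 <= normc q4.
    have := ler_normcD (q1 + q2) (q3 + q4); have := ler_normcD q3 q4.
    have := ler_normcD q1 q2; move: hE; rewrite EE.
    set e := E / _.
    case: (lerP e (normc q1)) => [|h1]; first by left.
    case: (lerP e (normc q2)) => [|h2]; first by right; left.
    case: (lerP e (normc q3)) => [|h3]; first by right; right; left.
    case: (lerP e (normc q4)) => [|h4]; first by right; right; right.
    clear -h1 h2 h3 h4; lra.
  have bx : x + w n.+1 + w n.+1 <= x1 by rewrite -addrA -(wS n).
  have by' : y + h n.+1 + h n.+1 <= y1 by rewrite -addrA -(hS n).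
  have c1 : x + w n.+1 <= x1 by lra.
  have c2 : y + h n.+1 <= y1 by lra.
  have c3 : x0 <= x + w n.+1 by lra.
  have c4 : y0 <= y + h n.+1 by lra.
  move=> [hq|[hq|[hq|hq]]].
  - have p : P n.+1 (x, y) by split.
    by exists (exist _ (n.+1, (x, y)) p) => /=; split => //; rewrite ?xE ?yE; lra.
  - have p : P n.+1 (x, y + h n.+1) by split.
    by exists (exist _ (n.+1, (x, y + h n.+1)) p) => /=; split => //; rewrite ?xE ?yE; lra.
  - have p : P n.+1 (x + w n.+1, y) by split.
    by exists (exist _ (n.+1, (x + w n.+1, y)) p) => /=; split => //; rewrite ?xE ?yE; lra.
  - have p : P n.+1 (x + w n.+1, y + h n.+1) by split.
    by exists (exist _ (n.+1, (x + w n.+1, y + h n.+1)) p) => /=; split => //; rewrite ?xE ?yE; lra.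
have p0 : P 0%N (x0, y0).
  by rewrite /P /w /h /= !expr0 !divr1 !subrKC; split.
have [f [f0 fS]] := dependent_choice step (exist (fun nq => P nq.1 nq.2) (0%N, (x0, y0)) p0).
have fn n : (sval (f n)).1 = n.
  by elim: n => [|n ih]; rewrite ?f0//; case: (fS n) => ->; rewrite ih.
pose X n := (sval (f n)).2.1; pose Y n := (sval (f n)).2.2.
have PX n : P n (X n, Y n).
  by have := svalP (f n); rewrite fn /X /Y; case: (sval _).2.
have [x hx] : exists x, forall n, X n <= x <= X n + w n.
  apply: nested_intervals => n; last by rewrite lerDl.
    by case: (fS n).
  by have [_ _ _] := fS n; rewrite !fn.
have [y hy] : exists y, forall n, Y n <= y <= Y n + h n.
  apply: nested_intervals => n; last by rewrite lerDl.
    by case: (fS n).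
  by have [_ _ _ _] := fS n; rewrite !fn.
have [l hl] : cdiff F (x +i* y).
  have [/= b1 b2 b3 b4 _] := PX 0%N; apply: dF.
    by have /andP[c1 c2] := hx 0%N; rewrite (le_trans b1 c1) (le_trans c2 b2).
  by have /andP[c1 c2] := hy 0%N; rewrite (le_trans b3 c1) (le_trans c2 b4).
set D := (x1 - x0) + (y1 - y0).
have D0 : 0 <= D by rewrite addr_ge0 ?subr_ge0.
(* at scale n the error of the affine approximation contributes at most
   4 * e * D ^ 2 / 4 ^ n, which this choice keeps below E / 4 ^ n *)
pose e := E / (4 * (D + 1) ^+ 2 + 1).
have D2 : 0 < 4 * (D + 1) ^+ 2 + 1 by rewrite ltr_wpDl// mulr_ge0// sqr_ge0.
have e0 : 0 < e by rewrite divr_gt0.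
have [r r0 hr] := hl _ e0.
have [n nr] : exists n : nat, D / 2 ^+ n < r.
  have := @cvg_geometric R D 2^-1.
  rewrite ger0_norm ?invr_ge0// invf_lt1// ltr1n => /(_ isT).
  move=> /cvgr0_norm_lt /(_ _ r0)[n _ /(_ n (leqnn n))].
  rewrite /geometric/= ger0_norm ?mulr_ge0 ?exprn_ge0 ?invr_ge0// => hn.
  by exists n; rewrite -exprVn.
have [/= b1 b2 b3 b4 hE] := PX n.
have cE : cdiff_on (fun z => F z - (F (x +i* y) - l * (x +i* y) + l * z))
    (X n) (X n + w n) (Y n) (Y n + h n).
  move=> u v hu hv; apply: cdiffB.
    by apply: (cdiff_onS b1 b2 b3 b4 dF).
  apply: cdiffD; first exact: cdiff_cst.
  by apply: cdiffM; [exact: cdiff_cst|exact: cdiff_id].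
have cA : cdiff_on (fun z => F (x +i* y) - l * (x +i* y) + l * z)
    (X n) (X n + w n) (Y n) (Y n + h n).
  move=> u v hu hv; apply: cdiffD; first exact: cdiff_cst.
  by apply: cdiffM; [exact: cdiff_cst|exact: cdiff_id].
have xw : X n <= X n + w n by rewrite lerDl.
have yh : Y n <= Y n + h n by rewrite lerDl.
have : normc (rect_int F (X n) (X n + w n) (Y n) (Y n + h n)) <=
    4 * (e * (w n + h n)) * (w n + h n).
  rewrite (_ : F = fun z => (F z - (F (x +i* y) - l * (x +i* y) + l * z)) +
     (F (x +i* y) - l * (x +i* y) + l * z)); last by apply/funext => z; rewrite subrK.
  rewrite rect_intD//; [|exact: cdiff_rect_cont..].
  rewrite rect_int_affine// addr0.
  have : rect_cont (fun z => F z - (F (x +i* y) - l * (x +i* y) + l * z))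
    (X n) (X n + w n) (Y n) (Y n + h n) by exact: cdiff_rect_cont.
  move=> /(rect_int_norm xw yh) hN.
  have -> : 4 * (e * (w n + h n)) * (w n + h n) =
      4 * (e * (w n + h n)) * ((X n + w n - X n) + (Y n + h n - Y n)).
    by rewrite ![_ + _ n - _]addrAC !subrr !add0r.
  apply: hN => u v [hu hv _].
  have E1 : u +i* v = x +i* y + ((u - x) +i* (v - y)) by simpc; rewrite !subrKC.
  have nu : normc ((u - x) +i* (v - y)) <= w n + h n.
    apply: le_trans (normc_le_ReIm _) _; apply: lerD => /=.
      move: (hx n) hu => /andP[h1 h2] /andP[h3 h4]; rewrite ler_norml; clear -h1 h2 h3 h4.
      by apply/andP; split; lra.
    move: (hy n) hv => /andP[h1 h2] /andP[h3 h4]; rewrite ler_norml; clear -h1 h2 h3 h4.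
    by apply/andP; split; lra.
  apply: (@le_trans _ _ (e * normc ((u - x) +i* (v - y)))); last first.
    by apply: ler_wpM2l nu; exact: ltW.
  rewrite E1; apply: le_trans (hr _ _).
    rewrite le_eqVlt; apply/orP; left; apply/eqP; congr normc; ring.
  by apply: le_lt_trans nu _; rewrite /w /h -mulrDl.
move=> /(le_trans hE); apply/negP; rewrite -ltNge.
rewrite /w /h -mulrDl -/D.
have -> : 4 * (e * (D / 2 ^+ n)) * (D / 2 ^+ n) = (4 * D ^+ 2 * e) / 4 ^+ n.
  have -> : 4 ^+ n = (2 ^+ n) ^+ 2 :> R by rewrite -exprM mulnC exprM expr2 -natrM.
  by rewrite expr2 invfM; ring.
rewrite ltr_pM2r ?invr_gt0 ?exprn_gt0// /e mulrA ltr_pdivrMr// mulrC ltr_pM2l//.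
clear -D0; nra.
Qed.

Lemma rint_ge_cst a b (u : R -> R) m : a <= b -> rcont a b u ->
  (forall t, a <= t <= b -> m <= u t) -> m * (b - a) <= rint a b u.
Proof. by move=> ab cu h; rewrite -rint_cst//; apply: ler_rint => //; exact: rcont_cst. Qed.

Section cauchy.
Variables (x0 x1 y0 y1 x y : R).
Hypotheses (x0x : x0 < x) (xx1 : x < x1) (y0y : y0 < y) (yy1 : y < y1).
Let c := x +i* y.

Let xx : x0 <= x1. Proof. exact: ltW (lt_trans x0x xx1). Qed.
Let yy : y0 <= y1. Proof. exact: ltW (lt_trans y0y yy1). Qed.

Lemma boundary_neq_center u v : rect_boundary x0 x1 y0 y1 u v -> u +i* v != c.
Proof.
move=> [_ _ h]; apply/eqP => -[ux vy]; case: h => [|[|[|]]] E.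
- by move: x0x; rewrite -ux E ltxx.
- by move: xx1; rewrite -ux E ltxx.
- by move: y0y; rewrite -vy E ltxx.
- by move: yy1; rewrite -vy E ltxx.
Qed.

Lemma cdiff_kernel z : z != c -> cdiff (fun z => (z - c)^-1) z.
Proof.
move=> zc; apply: cdiffV; first by rewrite subr_eq0.
by apply: cdiffB; [exact: cdiff_id|exact: cdiff_cst].
Qed.

(** The difference quotient is bounded near [c], and by Goursat's theorem its
    integral is that over any small square around [c]. *)
Lemma rect_int_difference_quotient F : cdiff_on F x0 x1 y0 y1 ->
  rect_int (fun z => (F z - F c) * (z - c)^-1) x0 x1 y0 y1 = 0.
Proof.
move=> dF; set G := fun z => _.
have dG u v : x0 <= u <= x1 -> y0 <= v <= y1 -> u +i* v != c -> cdiff G (u +i* v).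
  move=> hu hv uv; apply: cdiffM; last exact: cdiff_kernel.
  by apply: cdiffB; [exact: dF|exact: cdiff_cst].
have [l [r [l0 r0 Fl]]] : exists M r : R, [/\ 0 <= M, 0 < r & forall u, normc u < r ->
    normc (F (c + u) - F c) <= M * normc u].
  by apply: cdiff_lip; apply: dF; rewrite !ltW.
suff H e : 0 < e -> normc (rect_int G x0 x1 y0 y1) <= 16 * l * e.
  apply: eq0_normc; apply/eqP; rewrite eq_le normc_ge0 andbT.
  apply/ler_addgt0Pr => e e0; rewrite add0r.
  apply: le_trans (H (e / (16 * l + 1)) _) _.
    by rewrite divr_gt0// ltr_wpDl// mulr_ge0.
  rewrite mulrCA ler_piMr//; first exact: ltW.
  by rewrite ler_pdivrMr ?mul1r ?lerDl// ltr_wpDl// mulr_ge0.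
move=> e0.
have [t [t0 tx0 tx1 ty0 ty1] [tr te]] : exists2 t, [/\ 0 < t, x0 < x - t, x + t < x1,
    y0 < y - t & y + t < y1] & t + t < r /\ t <= e.
  exists (Num.min (Num.min ((x - x0) / 2) ((x1 - x) / 2)) (Num.min
     (Num.min ((y - y0) / 2) ((y1 - y) / 2)) (Num.min (r / 3) e))).
    set m := Num.min _ _.
    have : m <= (x - x0) / 2 by rewrite /m !ge_min lexx.
    have : m <= (x1 - x) / 2 by rewrite /m !ge_min lexx !orbT.
    have : m <= (y - y0) / 2 by rewrite /m !ge_min lexx !orbT.
    have : m <= (y1 - y) / 2 by rewrite /m !ge_min lexx !orbT.
    have : 0 < m by rewrite /m !lt_min !divr_gt0 ?subr_gt0.
    clearbody m; clear -x0x xx1 y0y yy1 => *; split; lra.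
  set m := Num.min _ _.
  have : m <= e by rewrite /m !ge_min lexx !orbT.
  have : m <= r / 3 by rewrite /m !ge_min lexx !orbT.
  clearbody m; move: r0 => r0' *; split => //; lra.
have rc u0 u1 v0 v1 : x0 <= u0 -> u0 <= u1 -> u1 <= x1 -> y0 <= v0 -> v0 <= v1 -> v1 <= y1 ->
    u0 != x -> u1 != x -> v0 != y \/ x < u0 \/ u1 < x ->
    v1 != y \/ x < u0 \/ u1 < x -> rect_cont G u0 u1 v0 v1.
  move=> h1 h2 h3 h4 h5 h6 h7 h8 h9 h10; apply: boundary_rect_cont => // u v [hu hv hb].
  move: hu hv => /andP[hu1 hu2] /andP[hv1 hv2].
  apply: dG.
  - by rewrite (le_trans h1 hu1) (le_trans hu2 h3).
  - by rewrite (le_trans h4 hv1) (le_trans hv2 h6).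
  apply/eqP => -[ux vy]; move: hb; rewrite ux vy.
  move: hu1 hu2; rewrite ux => hu1 hu2.
  move=> [E|[E|[E|E]]].
  - by move: h7; rewrite -E eqxx.
  - by move: h8; rewrite -E eqxx.
  - case: h9 => [|[]]; first by rewrite -E eqxx.
      by rewrite ltNge hu1.
    by rewrite ltNge hu2.
  - case: h10 => [|[]]; first by rewrite -E eqxx.
      by rewrite ltNge hu1.
    by rewrite ltNge hu2.
have gz u0 u1 v0 v1 : x0 <= u0 -> u0 <= u1 -> u1 <= x1 -> y0 <= v0 -> v0 <= v1 -> v1 <= y1 ->
    x < u0 \/ u1 < x \/ y < v0 \/ v1 < y -> rect_int G u0 u1 v0 v1 = 0.
  move=> h1 h2 h3 h4 h5 h6 h7; apply: goursat => // u v /andP[hu1 hu2] /andP[hv1 hv2].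
  apply: dG.
  - by rewrite (le_trans h1 hu1) (le_trans hu2 h3).
  - by rewrite (le_trans h4 hv1) (le_trans hv2 h6).
  apply/eqP => -[ux vy]; move: hu1 hu2 hv1 hv2; rewrite ux vy.
  move=> p1 p2 p3 p4; move: h7; rewrite !ltNge p1 p2 p3 p4.
  by move=> [|[|[|]]].
have a1 : x0 <= x - t by exact: ltW.
have a2 : x + t <= x1 by exact: ltW.
have a3 : y0 <= y - t by exact: ltW.
have a4 : y + t <= y1 by exact: ltW.
have tt : x - t <= x + t by rewrite lerD2l (le_trans _ (ltW t0))// oppr_le0 ltW.
have tt' : y - t <= y + t by rewrite lerD2l (le_trans _ (ltW t0))// oppr_le0 ltW.
have b1 : x - t <= x1 by exact: le_trans tt a2.
have b2 : y - t <= y1 by exact: le_trans tt' a4.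
have m1 : x0 != x by rewrite lt_eqF.
have m2 : x1 != x by rewrite gt_eqF.
have m3 : y0 != y by rewrite lt_eqF.
have m4 : y1 != y by rewrite gt_eqF.
have n1 : x - t != x by rewrite lt_eqF// gtrBl.
have n2 : x + t != x by rewrite gt_eqF// ltrDl.
have n3 : y - t != y by rewrite lt_eqF// gtrBl.
have n4 : y + t != y by rewrite gt_eqF// ltrDl.
rewrite (rect_int_splitx a1 b1 yy); last first.
  by apply: rc; rewrite ?lexx//; left.
rewrite gz ?lexx//; last by right; left; rewrite gtrBl.
rewrite add0r (rect_int_splitx tt a2 yy); last first.
  by apply: rc; rewrite ?lexx//; left.
rewrite [X in _ + X]gz ?lexx//; first last.
- by left; rewrite ltrDl.
- exact: le_trans a1 tt.
rewrite addr0 (rect_int_splity tt a3 b2); last first.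
  by apply: rc; rewrite ?lexx//; left.
rewrite gz ?lexx//; last by right; right; right; rewrite gtrBl.
rewrite add0r (rect_int_splity tt tt' a4); last first.
  by apply: rc; rewrite ?lexx//; left.
rewrite [X in _ + X]gz ?lexx//; first last.
- by right; right; left; rewrite ltrDl.
- exact: le_trans a3 tt'.
rewrite addr0.
apply: (@le_trans _ _ (4 * l * ((x + t - (x - t)) + (y + t - (y - t))))); last first.
  apply: (@le_trans _ _ (16 * l * t)); last by rewrite ler_wpM2l ?mulr_ge0.
  by rewrite le_eqVlt; apply/orP; left; apply/eqP; ring.
apply: rect_int_norm => //.
  by apply: rc => //; left.
move=> u v [/andP[hu1 hu2] /andP[hv1 hv2] hb].
have uvc : u +i* v - c != 0.
  rewrite subr_eq0; apply/eqP => -[ux vy]; move: hb; rewrite ux vy.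
  by move=> [E|[E|[E|E]]]; [move: n1|move: n2|move: n3|move: n4]; rewrite -E eqxx.
rewrite /G normcM normcV ler_pdivrMr ?normc_gt0//.
have {1}-> : u +i* v = c + (u +i* v - c) by rewrite subrKC.
apply: Fl; apply: le_lt_trans (normc_le_ReIm _) _; rewrite /c/=.
apply: le_lt_trans tr; apply: lerD; rewrite ler_norml.
  by rewrite lerBrDr addrC hu1 lerBlDr addrC hu2.
by rewrite lerBrDr addrC hv1 lerBlDr addrC hv2.
Qed.

(** The four sides contribute nonnegative imaginary parts, and the bottom side
    a positive one; the exact value 2 pi i is not computed. *)
Lemma rect_int_kernel_neq0 : rect_int (fun z => (z - c)^-1) x0 x1 y0 y1 != 0.
Proof.
suff : 0 < complex.Im (rect_int (fun z => (z - c)^-1) x0 x1 y0 y1).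
  by apply: contraTneq => ->; rewrite ltxx.
have [k1 k2] : rect_cont (fun z => (z - c)^-1) x0 x1 y0 y1.
  by apply: boundary_rect_cont => // u v /boundary_neq_center; exact: cdiff_kernel.
rewrite /rect_int ImD ImD ImN ImM ReD ReN /= mul0r add0r mul1r.
have [_ c1] := k1 y0 (or_introl erefl); have [_ c2] := k1 y1 (or_intror erefl).
have [c3 _] := k2 x1 (or_intror erefl); have [c4 _] := k2 x0 (or_introl erefl).
have D2 (u v : R) : 0 <= u ^+ 2 + v ^+ 2 by rewrite addr_ge0 ?sqr_ge0.
have yy0 : 0 < (y0 - y) ^+ 2 by rewrite exprn_even_gt0//= subr_eq0 lt_eqF.
pose m := (y - y0) / ((x1 - x0) ^+ 2 + (y0 - y) ^+ 2).
have m0 : 0 < m.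
  by rewrite divr_gt0 ?subr_gt0// ltr_wpDl ?sqr_ge0.
have I1 : m * (x1 - x0) <=
    rint x0 x1 (fun t => complex.Im ((t +i* y0 - c)^-1)).
  apply: rint_ge_cst => // t /andP[t1 t2]; rewrite /= -mulNr opprB.
  rewrite /m ler_pM2l ?subr_gt0// lef_pV2 ?posrE.
  - rewrite lerD2r -[leLHS]real_normK ?num_real// -[leRHS]real_normK ?num_real//.
    rewrite lerXn2r ?nnegrE// [leRHS]ger0_norm ?subr_ge0// ler_norml.
    by rewrite opprB !lerB//; exact: ltW.
  - by rewrite ltr_wpDl ?sqr_ge0.
  - by rewrite ltr_wpDl ?sqr_ge0.
have I2 : 0 <= - rint x0 x1 (fun t => complex.Im ((t +i* y1 - c)^-1)).
  rewrite oppr_ge0 -[leRHS](mul0r (x1 - x0)) -rint_cst//.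
  apply: ler_rint => //; first exact: rcont_cst.
  by move=> t _ /=; rewrite oppr_le0 divr_ge0// subr_ge0 ltW.
have I3 : 0 <= rint y0 y1 (fun t => complex.Re ((x1 +i* t - c)^-1)).
  rewrite -[leLHS](mul0r (y1 - y0)); apply: rint_ge_cst => //.
  by move=> t _ /=; rewrite divr_ge0// subr_ge0 ltW.
have I4 : 0 <= - rint y0 y1 (fun t => complex.Re ((x0 +i* t - c)^-1)).
  rewrite oppr_ge0 -[leRHS](mul0r (y1 - y0)) -rint_cst//.
  apply: ler_rint => //; first exact: rcont_cst.
  by move=> t _ /=; rewrite mulr_le0_ge0 ?invr_ge0// subr_le0 ltW.
have : 0 < m * (x1 - x0) by rewrite mulr_gt0// subr_gt0 (lt_trans x0x).
by move=> /lt_le_trans; apply; apply: le_trans I1 _; rewrite -addrA lerDl !addr_ge0.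
Qed.

(** Cauchy's integral formula, up to the value of the kernel integral. The
    constant depends on the rectangle and on the point, not on the function. *)
Lemma cauchy_estimate : exists2 K : R, 0 <= K & forall F B,
  cdiff_on F x0 x1 y0 y1 ->
  (forall u v, rect_boundary x0 x1 y0 y1 u v -> normc (F (u +i* v)) <= B) ->
  normc (F c) <= K * B.
Proof.
set kap := rect_int (fun z => (z - c)^-1) x0 x1 y0 y1.
have k0 : 0 < normc kap by rewrite normc_gt0 rect_int_kernel_neq0.
pose rho := Num.min (Num.min (x - x0) (x1 - x)) (Num.min (y - y0) (y1 - y)).
have rho0 : 0 < rho by rewrite /rho !lt_min !subr_gt0 x0x xx1 y0y.
have hrho u v : rect_boundary x0 x1 y0 y1 u v -> rho <= normc (u +i* v - c).
  move=> [_ _ [E|[E|[E|E]]]]; rewrite E.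
  - apply: le_trans (ler_normc_Re _); rewrite /= ler0_norm ?subr_le0 ?(ltW x0x)// opprB.
    by rewrite /rho !ge_min lexx.
  - apply: le_trans (ler_normc_Re _); rewrite /= ger0_norm ?subr_ge0 ?(ltW xx1)//.
    by rewrite /rho !ge_min lexx !orbT.
  - apply: le_trans (ler_normc_Im _); rewrite /= ler0_norm ?subr_le0 ?(ltW y0y)// opprB.
    by rewrite /rho !ge_min lexx !orbT.
  - apply: le_trans (ler_normc_Im _); rewrite /= ger0_norm ?subr_ge0 ?(ltW yy1)//.
    by rewrite /rho !ge_min lexx !orbT.
exists (4 * rho^-1 * ((x1 - x0) + (y1 - y0)) / normc kap).
  apply: divr_ge0; last exact: normc_ge0.
  apply: mulr_ge0; last by rewrite addr_ge0 ?subr_ge0.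
  by rewrite mulr_ge0// invr_ge0 ltW.
move=> F B dF FB.
have cK : rect_cont (fun z => (z - c)^-1) x0 x1 y0 y1.
  by apply: boundary_rect_cont => // u v /boundary_neq_center; exact: cdiff_kernel.
have cFK : rect_cont (fun z => F z * (z - c)^-1) x0 x1 y0 y1.
  apply: boundary_rect_cont => // u v b; have [hu hv _] := b.
  apply: cdiffM; first exact: dF.
  exact/cdiff_kernel/boundary_neq_center.
have E : F c * kap = rect_int (fun z => F z * (z - c)^-1) x0 x1 y0 y1.
  have := rect_int_difference_quotient dF.
  rewrite (_ : (fun z => (F z - F c) * (z - c)^-1) = fun z => F z * (z - c)^-1 + (- F c) * (z - c)^-1);
    last by apply/funext => z; rewrite mulrBl mulNr.
  rewrite rect_intD//; last first.
    by case: cK => h1 h2; split => ? ?; apply: ccontZ; [exact: h1|exact: h2].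
  by rewrite rect_intZ// mulNr => /eqP; rewrite subr_eq0 => /eqP ->.
rewrite mulrAC ler_pdivlMr// -normcM E mulrAC.
rewrite -(mulrA 4); apply: rect_int_norm => // u v b.
rewrite normcM normcV [leRHS]mulrC; apply: ler_pM; rewrite ?invr_ge0 ?normc_ge0//.
  exact: FB.
by rewrite lef_pV2 ?posrE ?hrho// (lt_le_trans rho0)// hrho.
Qed.

End cauchy.

End goursat.

(** * An identity theorem for limits of holomorphic functions *)

Section identity.
Context {R : realType}.
Local Notation C := R[i].

Lemma rcont_bounded a b (u : R -> R) : a <= b -> rcont a b u ->
  exists M, forall x, a <= x <= b -> `|u x| <= M.
Proof.
move=> ab cu.
have cu' : {within `[a, b], continuous (fun x => `|u x|)}.
  apply: continuous_in_subspaceT => x /set_mem /=; rewrite in_itv/= => abx.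
  by apply: continuous_comp; [exact: cu|exact: norm_continuous].
have [c _ hc] := EVT_max ab cu'.
by exists `|u c| => x hx; apply: hc; rewrite in_itv.
Qed.

Lemma ccont_bounded a b (f : R -> C) : a <= b -> ccont a b f ->
  exists M, forall x, a <= x <= b -> normc (f x) <= M.
Proof.
move=> ab [/(rcont_bounded ab)[M1 h1] /(rcont_bounded ab)[M2 h2]].
exists (M1 + M2) => x hx; apply: le_trans (normc_le_ReIm _) _.
by apply: lerD; [exact: h1|exact: h2].
Qed.

Lemma boundary_bounded F (x0 x1 y0 y1 : R) : x0 <= x1 -> y0 <= y1 ->
  cdiff_on F x0 x1 y0 y1 ->
  exists M, forall u v, rect_boundary x0 x1 y0 y1 u v -> normc (F (u +i* v)) <= M.
Proof.
move=> xx yy /(cdiff_rect_cont xx yy)[hh hv].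
have [M1 h1] := ccont_bounded xx (hh y0 (or_introl erefl)).
have [M2 h2] := ccont_bounded xx (hh y1 (or_intror erefl)).
have [M3 h3] := ccont_bounded yy (hv x0 (or_introl erefl)).
have [M4 h4] := ccont_bounded yy (hv x1 (or_intror erefl)).
exists (Num.max (Num.max M1 M2) (Num.max M3 M4)) => u v [hu hv' E].
rewrite !le_max; case: E => [E|[E|[E|E]]]; rewrite E.
- by rewrite h3 ?orbT.
- by rewrite h4 ?orbT.
- by rewrite h1.
- by rewrite h2 ?orbT.
Qed.

(** Let [F], a locally uniform limit of holomorphic functions, vanish to the
    right of [x0].  Multiplying by the powers of the inverse of [z - c], where
    [c] is real and lies to the right of the rectangle, the part of the boundary
    on which [F] is not known to vanish is farther from [c] than [s], so the
    Cauchy estimate forces [F s] to be zero. *)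
Lemma identity_limit (Fn : nat -> C -> C) (F : C -> C) (s x0 : R) : s < x0 ->
  (forall n z, s - 1 <= complex.Re z -> cdiff (Fn n) z) ->
  (forall B e, 0 < e -> exists n, forall z, s - 1 <= complex.Re z ->
     normc z <= B -> normc (Fn n z - F z) <= e) ->
  (forall z, x0 <= complex.Re z -> F z = 0) -> F s%:C = 0.
Proof.
move=> sx0 dF cvgF F0.
(* the distance from [c] to [s] is L - 1, while the top, the bottom and the left
   side of the rectangle below are at distance at least [L] from [c] *)
pose c := x0 + 2; pose L := c - s + 1.
have cs : 2 < c - s by rewrite /c; lra.
have L0 : 3 < L by rewrite /L; lra.
have s1 : s - 1 < s by lra.
have s2 : s < x0 + 1 by lra.
have L1 : - L < 0 by lra.
have L2 : 0 < L by lra.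
have [K K0 hK] := cauchy_estimate s1 s2 L1 L2.
pose k z := (z - c%:C)^-1.
have knorm z : complex.Re z <= x0 + 1 -> normc (k z) <= 1.
  move=> hz; rewrite /k normcV invf_le1.
    apply: le_trans (ler_normc_Re _); rewrite ReD ReN /= ler0_norm; rewrite /c; lra.
  apply: lt_le_trans (ler_normc_Re _); rewrite ReD ReN /= ltr0_norm; rewrite /c; lra.
have kL u v : rect_boundary (s - 1) (x0 + 1) (- L) L u v -> u <= x0 ->
    normc (k (u +i* v)) <= L^-1.
  move=> [/andP[hu hu'] hv hb] ux0; rewrite /k normcV lef_pV2 ?posrE//; last first.
    apply: lt_le_trans (ler_normc_Re _); rewrite /= ltr0_norm; rewrite /c; lra.
  case: hb => [E|[E|[E|E]]].
  - apply: le_trans (ler_normc_Re _); rewrite /= E ler0_norm; rewrite /L /c; lra.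
  - by move: ux0; rewrite E; lra.
  - by apply: le_trans (ler_normc_Im _); rewrite /= E subr0 normrN ger0_norm// ltW.
  - by apply: le_trans (ler_normc_Im _); rewrite /= E subr0 ger0_norm// ltW.
pose B := (`|s| + `|x0| + 2) + L.
have hB u v : s - 1 <= u <= x0 + 1 -> - L <= v <= L -> normc (u +i* v) <= B.
  move=> /andP[u1 u2] hv; apply: le_trans (normc_le_ReIm _) _ => /=.
  rewrite lerD ?ler_norml//.
  have := ler_norm s; have := ler_norm (- s); have := ler_norm x0; have := ler_norm (- x0).
  by rewrite !normrN; lra.
have dk z : complex.Re z <= x0 + 1 -> cdiff k z.
  move=> hz; apply: cdiffV; last by apply: cdiffB; [exact: cdiff_id|exact: cdiff_cst].
  rewrite subr_eq0; apply/eqP => E; move: hz; rewrite E/= /c; lra.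
have xx : s - 1 <= x0 + 1 by lra.
have yy : - L <= L by lra.
have [M hM] : exists M, forall u v, rect_boundary (s - 1) (x0 + 1) (- L) L u v ->
    normc (F (u +i* v)) <= M.
  have [n hn] := cvgF B 1 ltr01.
  have [M hM] := @boundary_bounded (Fn n) _ _ _ _ xx yy
    (fun u v hu hv => dF n (u +i* v) (proj1 (andP hu))).
  exists (M + 1) => u v hb; have [/andP[hu hu'] hv _] := hb.
  rewrite -[X in normc X](subKr (Fn n (u +i* v))).
  apply: le_trans (ler_normcB _ _) _; apply: lerD; first exact: hM.
  by apply: hn => //; apply: hB => //; rewrite hu.
have M0 : 0 <= M.
  apply: le_trans (normc_ge0 (F ((s - 1) +i* L))) (hM _ _ _).
  by split; rewrite ?lexx ?xx ?yy//; left.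
have main n : normc (F s%:C) * (c - s)^-1 ^+ n <= K * (M * L^-1 ^+ n).
  apply/ler_addgt0Pr => e e0.
  have [N hN] := cvgF B (e / (K + 1)) (divr_gt0 e0 (ltr_wpDl K0 ltr01)).
  have ks : normc (k s%:C) = (c - s)^-1.
    by rewrite /k normcV -rmorphB/= normc_real distrC ger0_norm// ltW// (lt_trans _ cs).
  have e1 : 0 <= e / (K + 1) by apply: divr_ge0; [exact: ltW|exact: addr_ge0].
  have : normc (Fn N s%:C * k s%:C ^+ n) <= K * (M * L^-1 ^+ n + e / (K + 1)).
    apply: (hK (fun z => Fn N z * k z ^+ n)).
      move=> u v /andP[hu hu'] hv; apply: cdiffM; first exact: dF.
      by apply: cdiffX; exact: dk.
    move=> u v hb; have [/andP[hu hu'] hv _] := hb.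
    rewrite normcM normcX.
    have hF : normc (Fn N (u +i* v)) <= normc (F (u +i* v)) + e / (K + 1).
      rewrite -[X in normc X](subrK (F (u +i* v))) addrC.
      apply: le_trans (ler_normcD _ _) _; rewrite lerD2l.
      by apply: hN => //; apply: hB => //; rewrite hu.
    have kn1 : normc (k (u +i* v)) ^+ n <= 1.
      by rewrite exprn_ile1 ?normc_ge0// knorm.
    apply: le_trans (ler_wpM2r (exprn_ge0 _ (normc_ge0 _)) hF) _.
    rewrite mulrDl; apply: lerD; last by rewrite ler_piMr.
    have [ux0|/ltW x0u] := leP u x0.
      apply: ler_pM; rewrite ?normc_ge0 ?exprn_ge0 ?normc_ge0//; first exact: hM.
      by rewrite lerXn2r ?nnegrE ?normc_ge0 ?kL// invr_ge0 ltW.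
    by rewrite F0// normc0 mul0r mulr_ge0// exprn_ge0// invr_ge0 ltW.
  rewrite normcM normcX ks => h.
  have : normc (F s%:C) <= normc (Fn N s%:C) + e / (K + 1).
    rewrite -[X in normc X](subKr (Fn N s%:C)).
    apply: le_trans (ler_normcB _ _) _; rewrite lerD2l; apply: hN => /=; first exact: ltW.
    by apply: hB; rewrite ?(ltW s1) ?(ltW s2) ?(ltW L1) ?(ltW L2).
  have cs0 : 0 <= (c - s)^-1 ^+ n by rewrite exprn_ge0// invr_ge0 ltW// (lt_trans _ cs).
  have cs1 : (c - s)^-1 ^+ n <= 1.
    rewrite exprn_ile1// ?invr_ge0 ?invf_le1; lra.
  move=> /(ler_wpM2r cs0) /le_trans; apply.
  rewrite mulrDl; apply: le_trans (lerD h (ler_piMr e1 cs1)) _.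
  rewrite mulrDr -addrA lerD2l -{2}[e / _]mul1r -mulrDl mulrCA mulfV ?mulr1//.
  by rewrite gt_eqF// ltr_wpDl.
apply: eq0_normc; apply/eqP; rewrite eq_le normc_ge0 andbT.
have cs0 : 0 < c - s by rewrite (lt_trans _ cs).
have h n : normc (F s%:C) <= K * M * ((c - s) / L) ^+ n.
  have := main n; rewrite exprVn ler_pdivrMr ?exprn_gt0// => /le_trans; apply.
  by rewrite expr_div_n exprVn; rewrite le_eqVlt; apply/orP; left; apply/eqP; ring.
have q1 : `|(c - s) / L| < 1.
  rewrite ger0_norm ?divr_ge0 ?ltW// ltr_pdivrMr// mul1r /L; lra.
rewrite leNgt; apply/negP => F0'.
have := @cvg_geometric R (K * M) _ q1.
move=> /cvgr0_norm_lt /(_ _ F0')[n _ /(_ n (leqnn n))]; apply/negP; rewrite -leNgt.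
by apply: le_trans (h n) _; exact: ler_norm.
Qed.

End identity.

(** * Complex powers of a positive real *)

Section cpow.
Context {R : realType}.
Local Notation C := R[i].

Lemma is_derive_approx (f : R -> R) (x l : R) : is_derive x 1 f l ->
  forall e, 0 < e -> exists2 r, 0 < r & forall u, `|u| < r ->
    `|f (x + u) - f x - l * u| <= e * `|u|.
Proof.
move=> [df fl] e e0; have := df; rewrite /derivable => /cvgrPdist_le /(_ e e0).
rewrite near_withinE => /nbhs_ballP[r /= r0 hr].
exists r => // u ur; have [->|u0] := eqVneq u 0.
  by rewrite addr0 mulr0 subr0 subrr normr0 mulr0.
have : ball (0 : R) r u by rewrite /ball/= sub0r normrN.
move=> /hr /(_ u0); rewrite -/(derive f x 1) fl => h.
have -> : f (x + u) - f x - l * u = - ((l - u^-1 * (f (u * 1 + x) - f x)) * u).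
  by rewrite mulrBl mulrAC mulVf// mul1r mulr1 opprB [u + x]addrC.
by rewrite normrN normrM ler_wpM2r.
Qed.

Lemma cpowD (x : R) (z1 z2 : C) : 0 < x -> cpow x (z1 + z2) = cpow x z1 * cpow x z2.
Proof.
move=> x0; rewrite /cpow ReD ImD powRD; last by apply/implyP => _; rewrite gt_eqF.
rewrite mulrDl cosD sinD rmorphM/=; simpc; congr (_ +i* _); ring.
Qed.

Lemma cpow0 (x : R) : cpow x 0 = 1.
Proof. by rewrite /cpow /= powRr0 mul0r cos0 sin0 mul1r. Qed.

Lemma cpow_real (x y : R) : cpow x y%:C = (x `^ y)%:C.
Proof. by rewrite /cpow /= mul0r cos0 sin0 mulr1. Qed.

Lemma normc_cpow (x : R) (z : C) : normc (cpow x z) = x `^ complex.Re z.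
Proof.
rewrite /cpow normcM normc_real ger0_norm ?powR_ge0// [X in _ * X](_ : _ = 1) ?mulr1//.
by rewrite /normc cos2Dsin2 sqrtr1.
Qed.

Lemma cpow_neq0 (x : R) z : 0 < x -> cpow x z != 0.
Proof. by move=> x0; rewrite -normc_gt0 normc_cpow powR_gt0. Qed.

Lemma cpowN (x : R) z : 0 < x -> cpow x (- z) = (cpow x z)^-1.
Proof.
move=> x0; apply: (mulIf (cpow_neq0 z x0)).
by rewrite -cpowD// addNr cpow0 mulVf// cpow_neq0.
Qed.

(** First-order expansion of the complex exponential at the origin. *)
Lemma cexp_approx (e : R) : 0 < e -> exists2 r, 0 < r & forall a b : R, `|a| < r -> `|b| < r ->
  normc ((expR a)%:C * (cos b +i* sin b) - 1 - (a +i* b)) <= e * (`|a| + `|b|).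
Proof.
move=> e0; pose e1 := Num.min 1 e / 8.
have e10 : 0 < e1 by rewrite /e1 divr_gt0// lt_min ltr01.
have e1e : 8 * e1 <= e by rewrite /e1 mulrCA mulfV// mulr1 ge_min lexx orbT.
have e11 : e1 <= 1 / 8 by rewrite /e1 ler_wpM2r ?invr_ge0// ge_min lexx.
have [r1 r10 h1] := is_derive_approx (is_derive_expR (0 : R)) e10.
have [r2 r20 h2] := is_derive_approx (is_derive_sin (0 : R)) e10.
have [r3 r30 h3] := is_derive_approx (is_derive_cos (0 : R)) e10.
exists (Num.min (Num.min r1 r2) (Num.min r3 e1)).
  by rewrite !lt_min r10 r20 r30.
move=> a b; rewrite !lt_min => /andP[/andP[a1 _] /andP[_ a4]] /andP[/andP[_ b2] /andP[b3 b4]].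
have := h1 _ a1; rewrite add0r expR0 mul1r => k1.
have := h2 _ b2; rewrite add0r sin0 subr0 cos0 mul1r => k2.
have := h3 _ b3; rewrite add0r cos0 sin0 oppr0 mul0r subr0 => k3.
set A := `|a|; set D := `|b|.
have A0 : 0 <= A by exact: normr_ge0.
have D0 : 0 <= D by exact: normr_ge0.
have E1 : `|expR a - 1| <= e1 * A + A.
  rewrite -[X in `|X|](subrK a); apply: le_trans (ler_normD _ _) _; exact: lerD.
have E2 : `|expR a| <= 2.
  rewrite -[X in `|X|](subrK 1); apply: le_trans (ler_normD _ _) _; rewrite normr1.
  move: (le_trans E1 (lexx _)); rewrite -/A in a4; nra.
have -> : (expR a)%:C * (cos b +i* sin b) - 1 - (a +i* b) =
    (expR a - 1 - a)%:C + (expR a)%:C * ((cos b - 1) +i* (sin b - b)) +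
    'i * (b * (expR a - 1))%:C.
  by simpc; congr (_ +i* _); ring.
apply: le_trans (ler_normcD _ _) _.
have T1 : normc ((expR a - 1 - a)%:C + (expR a)%:C * ((cos b - 1) +i* (sin b - b))) <=
    e1 * A + 2 * (e1 * D + e1 * D).
  apply: le_trans (ler_normcD _ _) _; apply: lerD; first by rewrite normc_real.
  rewrite normcM normc_real; apply: ler_pM => //; first exact: normc_ge0.
  by apply: le_trans (normc_le_ReIm _) _; exact: lerD.
have T2 : normc ('i * (b * (expR a - 1))%:C) <= D * (2 * e1).
  rewrite normcM (_ : normc 'i = 1); last by rewrite /normc/= expr0n expr1n add0r sqrtr1.
  rewrite mul1r normc_real normrM ler_wpM2l// (le_trans E1)//.
  rewrite -/A in a4; nra.
apply: le_trans (lerD T1 T2) _; nra.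
Qed.

Lemma cdiff_cpow (x : R) (z : C) : 0 < x -> cdiff (cpow x) z.
Proof.
move=> x0; exists (cpow x z * (ln x)%:C) => e e0.
set N := normc (cpow x z).
have N0 : 0 <= N by exact: normc_ge0.
pose l := `|ln x|.
have l0 : 0 <= l by exact: normr_ge0.
have D0 : 0 < N * (2 * l) + 1 by rewrite ltr_wpDl// mulr_ge0// mulr_ge0.
have [r r0 hr] := cexp_approx (divr_gt0 e0 D0).
exists (r / (l + 1)); first by rewrite divr_gt0// ltr_wpDl.
move=> u; rewrite ltr_pdivlMr ?ltr_wpDl// => ur.
have hl (t : R) : `|t| <= normc u -> `|t * ln x| < r.
  move=> tu; apply: le_lt_trans ur; rewrite normrM; apply: ler_pM => //.
  by rewrite lerDl.
have := hr _ _ (hl _ (ler_normc_Re u)) (hl _ (ler_normc_Im u)).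
have -> : (expR (complex.Re u * ln x))%:C *
   (cos (complex.Im u * ln x) +i* sin (complex.Im u * ln x)) = cpow x u.
  by rewrite /cpow /powR gt_eqF.
have -> : (complex.Re u * ln x) +i* (complex.Im u * ln x) = u * (ln x)%:C.
  by case: u {ur hl} => a b; simpc.
move=> h; rewrite cpowD//.
have -> : cpow x z * cpow x u - cpow x z - cpow x z * (ln x)%:C * u =
   cpow x z * (cpow x u - 1 - u * (ln x)%:C) by ring.
rewrite normcM -/N; apply: le_trans (ler_wpM2l N0 h) _.
apply: (@le_trans _ _ (N * (e / (N * (2 * l) + 1) * (2 * l * normc u)))).
  apply: (ler_wpM2l N0); apply: ler_wpM2l; first by apply: divr_ge0; exact: ltW.
  rewrite !normrM -/l -mulrDl mulrC -mulrA mulrCA; apply: (ler_wpM2l l0).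
  rewrite mulr_natl mulr2n; apply: lerD; [exact: ler_normc_Re|exact: ler_normc_Im].
have -> : N * (e / (N * (2 * l) + 1) * (2 * l * normc u)) =
    e * normc u * ((N * (2 * l)) / (N * (2 * l) + 1)) by ring.
apply: ler_piMr; first by apply: mulr_ge0; [exact: ltW|exact: normc_ge0].
by rewrite ler_pdivrMr ?mul1r ?lerDl.
Qed.

End cpow.

(** * Unconditional sums of complex families *)

Section has_sum.
Context {R : realType} {I : choiceType}.
Local Notation C := R[i].
Implicit Types (f g : I -> C) (w : I -> R) (J : {fset I}).

(** Convergence along the net of finite subsets, as [summability.partial_sum],
    but measured by the real-valued modulus. *)
Definition has_sum f (V : C) := forall e : R, 0 < e ->
  exists J0, forall J, {subset J0 <= J} -> normc (\sum_(i <- J) f i - V) <= e.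

Lemma big_fset_split (A : nmodType) (f : I -> A) J0 J : {subset J0 <= J} ->
  \sum_(i <- J) f i = \sum_(i <- J0) f i + \sum_(i <- J | i \notin J0) f i.
Proof.
move=> J0J; rewrite (bigID (mem J0))/=; congr (_ + _).
rewrite -big_filter; apply: perm_big; apply: uniq_perm.
- by rewrite filter_uniq// fset_uniq.
- exact: fset_uniq.
- by move=> i; rewrite mem_filter; case: (boolP (i \in J0)) => //= /J0J ->.
Qed.

Lemma normc_sum (r : seq I) (P : pred I) f :
  normc (\sum_(i <- r | P i) f i) <= \sum_(i <- r | P i) normc (f i).
Proof.
elim/big_ind2 : _ => [|x1 x2 y1 y2 h1 h2|//]; first by rewrite normc0.
by apply: le_trans (ler_normcD _ _) _; exact: lerD.
Qed.

Lemma has_sum_cvg f (V : C) :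
  (summability.partial_sum f : _ -> C^o) @ @summability.totally I --> (V : C^o) ->
  has_sum f V.
Proof.
move=> /cvgrPdist_le h e e0; have := h (@filter_filter _ _ (@summability.totally_filter I)) e%:C; rewrite ltcR => /(_ e0) [J0 _ hJ].
exists J0 => J J0J; have /= := hJ J; rewrite normr_normc lecR -normc_opp opprB.
rewrite /summability.partial_sum -(big_seq_fsetE _ _ predT f); apply.
exact/fsubsetP.
Qed.

Lemma has_sum_unique f V V' : has_sum f V -> has_sum f V' -> V = V'.
Proof.
move=> h h'; apply/eqP; rewrite -subr_eq0; apply/eqP/eq0_normc/eqP.
rewrite eq_le normc_ge0 andbT; apply/ler_addgt0Pr => e e0; rewrite add0r.
have e2 : 0 < e / 2 by rewrite divr_gt0.
have [J hJ] := h _ e2; have [J' hJ'] := h' _ e2.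
have s1 : {subset J <= (J `|` J')%fset} by move=> i; rewrite in_fsetU => ->.
have s2 : {subset J' <= (J `|` J')%fset} by move=> i; rewrite in_fsetU orbC => ->.
have := hJ _ s1; have := hJ' _ s2; set S := \sum_(i <- _) _ => k1 k2.
have -> : V - V' = (S - V') - (S - V) by ring.
apply: le_trans (ler_normcB _ _) _; rewrite [leRHS](splitr e); exact: lerD.
Qed.

Lemma has_sumD f g V W : has_sum f V -> has_sum g W ->
  has_sum (fun i => f i + g i) (V + W).
Proof.
move=> h h' e e0; have e2 : 0 < e / 2 by rewrite divr_gt0.
have [J hJ] := h _ e2; have [J' hJ'] := h' _ e2.
exists (J `|` J')%fset => K sK; rewrite big_split/= opprD addrACA.
apply: le_trans (ler_normcD _ _) _; rewrite [leRHS](splitr e); apply: lerD.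
  by apply: hJ => i iJ; apply: sK; rewrite in_fsetU iJ.
by apply: hJ' => i iJ; apply: sK; rewrite in_fsetU iJ orbT.
Qed.

Lemma has_sumZ c f V : has_sum f V -> has_sum (fun i => c * f i) (c * V).
Proof.
move=> h e e0; have c0 : 0 < normc c + 1 by rewrite ltr_wpDl ?normc_ge0.
have [J hJ] := h _ (divr_gt0 e0 c0).
exists J => K sK; rewrite -mulr_sumr -mulrBr normcM.
apply: le_trans (ler_wpM2l (normc_ge0 c) (hJ _ sK)) _.
rewrite mulrCA ler_piMr ?ltW//.
by rewrite ltr_pdivrMr// mul1r ltrDl.
Qed.

Lemma has_sum0 : has_sum (fun=> 0) 0.
Proof.
by move=> e e0; exists fset0 => J _; rewrite big1 ?subr0 ?normc0// ltW.
Qed.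

Lemma has_sum_big (T : Type) (r : seq T) (P : pred T) (f : T -> I -> C) (V : T -> C) :
  (forall t, P t -> has_sum (f t) (V t)) ->
  has_sum (fun i => \sum_(t <- r | P t) f t i) (\sum_(t <- r | P t) V t).
Proof.
move=> h; elim: r => [|t r ih].
  rewrite big_nil (_ : (fun=> _) = fun=> 0); first exact: has_sum0.
  by apply/funext => i; rewrite big_nil.
rewrite big_cons; case: ifPn => Pt.
  rewrite (_ : (fun=> _) = fun i => f t i + \sum_(t <- r | P t) f t i).
    by apply: has_sumD => //; exact: h.
  by apply/funext => i; rewrite big_cons Pt.
rewrite (_ : (fun=> _) = fun i => \sum_(t <- r | P t) f t i)//.
by apply/funext => i; rewrite big_cons (negbTE Pt).
Qed.

Lemma has_sum_finite f J : (forall i, i \notin J -> f i = 0) ->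
  has_sum f (\sum_(i <- J) f i).
Proof.
move=> f0 e e0; exists J => K JK; rewrite (big_fset_split _ JK) [X in _ + X - _]big1 ?addr0//.
by rewrite subrr normc0 ltW.
Qed.

Definition tail_le w J0 (e : R) :=
  forall J, \sum_(i <- J | i \notin J0) w i <= e.

Lemma has_sum_tail f V w (c e : R) J0 : (forall i, 0 <= w i) -> 0 <= c ->
  (forall i, normc (f i) <= c * w i) -> has_sum f V -> tail_le w J0 e ->
  normc (V - \sum_(i <- J0) f i) <= c * e.
Proof.
move=> w0 c0 fw fV tl; apply/ler_addgt0Pr => e' e'0.
have [J hJ] := fV _ e'0.
have s1 : {subset J <= (J0 `|` J)%fset} by move=> i; rewrite in_fsetU orbC => ->.
have s2 : {subset J0 <= (J0 `|` J)%fset} by move=> i; rewrite in_fsetU => ->.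
have := hJ _ s1; rewrite (big_fset_split _ s2) => {}hJ.
set S := \sum_(i <- J0) _ in hJ *; set T := \sum_(i <- _ | _) _ in hJ.
have -> : V - S = T - (S + T - V) by ring.
apply: le_trans (ler_normcB _ _) _; apply: lerD => //.
apply: le_trans (normc_sum _ _ _) _.
apply: (@le_trans _ _ (\sum_(i <- (J0 `|` J)%fset | i \notin J0) c * w i)).
  by apply: ler_sum => i _; exact: fw.
by rewrite -mulr_sumr ler_wpM2l.
Qed.

Lemma has_sum_le f V w (c e : R) : (forall i, 0 <= w i) -> 0 <= c ->
  (forall i, normc (f i) <= c * w i) -> has_sum f V ->
  (forall J, \sum_(i <- J) w i <= e) -> normc V <= c * e.
Proof.
move=> w0 c0 fw fV we; have := @has_sum_tail f V w c e fset0 w0 c0 fw fV.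
rewrite big_seq_fset0 subr0; apply => J.
rewrite (eq_bigl predT) ?we// => i; by rewrite in_fset0.
Qed.

Section bounded_sums.
Variables (w : I -> R) (B : R).
Hypotheses (w0 : forall i, 0 <= w i) (wB : forall J, \sum_(i <- J) w i <= B).

Let sums := [set x | exists J, x = \sum_(i <- J) w i].

Let has_sup_sums : has_sup sums.
Proof.
split; first by exists (\sum_(i <- fset0) w i), fset0.
by exists B => _ [J ->].
Qed.

Lemma bounded_tail e : 0 < e -> exists J0, tail_le w J0 e.
Proof.
move=> e0; have [_ [J0 ->] hJ0] := sup_adherent e0 has_sup_sums.
exists J0 => J; have s : {subset J0 <= (J0 `|` J)%fset} by move=> i; rewrite in_fsetU => ->.
have /(ub_le_sup (proj2 has_sup_sums)) : sums (\sum_(i <- (J0 `|` J)%fset) w i) by exists (J0 `|` J)%fset.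
rewrite (big_fset_split _ s) => h.
apply: (@le_trans _ _ (\sum_(i <- (J0 `|` J)%fset | i \notin J0) w i)); last first.
  by move: hJ0 h; set a := sup _; set b := \sum_(i <- J0) _; lra.
have s' : {subset J <= (J0 `|` J)%fset} by move=> i; rewrite in_fsetU orbC => ->.
rewrite big_mkcond/= [leRHS]big_mkcond/= (big_fset_split _ s') lerDl.
by apply: sumr_ge0 => i _; case: ifP.
Qed.

Lemma has_sum_bounded : has_sum (fun i => (w i)%:C) (sup sums)%:C.
Proof.
move=> e e0; have [_ [J0 ->] hJ0] := sup_adherent e0 has_sup_sums.
exists J0 => J J0J; rewrite -rmorph_sum -rmorphB/= normc_real.
have h : \sum_(i <- J) w i <= sup sums by apply: ub_le_sup; [exact: (proj2 has_sup_sums)|exists J].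
rewrite ler0_norm ?subr_le0// opprB lerBlDr.
apply: le_trans (_ : e + \sum_(i <- J0) w i <= _).
  by move: hJ0; set a := sup _; set b := \sum_(i <- J0) _; lra.
by rewrite lerD2l (big_fset_split _ J0J) lerDl sumr_ge0.
Qed.

End bounded_sums.

(** A nonnegative family with bounded partial sums is summed by their supremum;
    a dominated real family is the difference of two such families. *)
Lemma has_sum_dominated f w (c B : R) : (forall i, 0 <= w i) -> 0 <= c ->
  (forall J, \sum_(i <- J) w i <= B) ->
  (forall i, normc (f i) <= c * w i) -> exists V, has_sum f V.
Proof.
move=> w0 c0 wB fw.
have real_case (u : I -> R) : (forall i, `|u i| <= c * w i) ->
    exists V, has_sum (fun i => (u i)%:C) V.
  move=> uw.
  have h0 i : 0 <= u i + c * w i.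
    by have := uw i; rewrite ler_norml => /andP[+ _]; rewrite lerNl -subr_ge0 opprK addrC.
  have hB J : \sum_(i <- J) (u i + c * w i) <= 2 * c * B.
    apply: (@le_trans _ _ (\sum_(i <- J) (2 * c) * w i)).
      apply: ler_sum => i _; have := uw i; rewrite ler_norml => /andP[_].
      by rewrite -mulrA mulr_natl mulr2n lerD2r.
    by rewrite -mulr_sumr ler_wpM2l// mulr_ge0.
  have s1 := has_sum_bounded h0 hB; have s2 := has_sumZ (- c%:C) (has_sum_bounded w0 wB).
  eexists; move: (has_sumD s1 s2); congr has_sum; apply/funext => i.
  by rewrite rmorphD rmorphM/= mulNr addrK.
have [V1 h1] := real_case (fun i => complex.Re (f i)) (fun i => le_trans (ler_normc_Re _) (fw i)).
have [V2 h2] := real_case (fun i => complex.Im (f i)) (fun i => le_trans (ler_normc_Im _) (fw i)).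
eexists; move: (has_sumD h1 (has_sumZ 'i h2)); congr has_sum; apply/funext => i.
by rewrite -complexE.
Qed.

End has_sum.

Lemma has_sum_reindex {R : realType} {I J : choiceType} (h : I -> J) (g : J -> I)
    (f : J -> R[i]) V : cancel h g -> (forall j, f j != 0 -> h (g j) = j) ->
  has_sum (f \o h) V -> has_sum f V.
Proof.
move=> hK f0 hV e e0; have [K0 hK0] := hV _ e0.
exists (h @` K0)%fset => K sK.
pose K' := [fset j in K | h (g j) == j]%fset.
have -> : \sum_(j <- K) f j = \sum_(i <- (g @` K')%fset) f (h i).
  rewrite big_imfset/=; last first.
    by move=> j j'; rewrite !inE/= => /andP[_ /eqP jE] /andP[_ /eqP j'E] gE; rewrite -jE -j'E gE.
  rewrite (bigID (fun j => h (g j) == j))/= [X in _ + X]big1 ?addr0; last first.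
    by move=> j; apply: contraNeq => /f0 ->.
  rewrite -big_filter; apply: etrans (_ : \sum_(j <- K') f j = _); last first.
    by apply: eq_big_seq => j; rewrite !inE/= => /andP[_ /eqP ->].
  apply: perm_big; apply: uniq_perm.
  - by rewrite filter_uniq// fset_uniq.
  - exact: fset_uniq.
  - by move=> j; rewrite mem_filter !inE/= andbC.
apply: hK0 => i iK0; apply/imfsetP; exists (h i); last by rewrite hK.
by rewrite !inE/= hK eqxx andbT; apply: sK; apply/imfsetP; exists i.
Qed.

(** * Lattice sums, differences and symbols *)

Section lattice.
Context {R : realType} {d : nat}.
Local Notation C := R[i].
Local Notation L := 'rV[int]_d.
Implicit Types (m : L) (f g : L -> C) (i j : 'I_d) (S : {set 'I_d}) (J : {fset L}).

Definition unit_vec j : L := delta_mx 0 j.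

Lemma unit_vecE j i : unit_vec j 0 i = (i == j)%:Z.
Proof. by rewrite mxE eqxx/=; case: (i == j). Qed.

Lemma has_sum_bij (h h' : L -> L) f V : cancel h h' -> cancel h' h ->
  has_sum f V -> has_sum (f \o h) V.
Proof.
move=> hK h'K fV; apply: (has_sum_reindex h'K (fun m _ => hK m)).
suff -> : (f \o h) \o h' = f by [].
by apply/funext => m /=; rewrite h'K.
Qed.

Lemma has_sum_shift f V j : has_sum f V -> has_sum (fun m => f (m + unit_vec j)) V.
Proof.
apply: (@has_sum_bij (fun m => m + unit_vec j) (fun m => m - unit_vec j)) => m.
  by rewrite addrK.
by rewrite subrK.
Qed.

(** a product, so that its sum over a box factorizes *)
Definition weight m : R := \prod_j ((1 + `|m 0%R j|%N%:R) ^+ 2)^-1.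

Lemma weight_ge0 m : 0 <= weight m.
Proof. by apply: prodr_ge0 => j _; rewrite invr_ge0 sqr_ge0. Qed.

Lemma sum_inv_sqr (n : nat) : \sum_(k < n.+1) ((1 + k%:R) ^+ 2)^-1 <= 2 - (n%:R + 1)^-1 :> R.
Proof.
elim: n => [|n ih]; first by rewrite big_ord1 add0r addr0 expr1n invr1; lra.
rewrite big_ord_recr/=; apply: le_trans (lerD ih (lexx _)) _.
have n1 : 0 < n%:R + 1 :> R by rewrite ltr_wpDl.
have -> : n.+1%:R = n%:R + 1 :> R by rewrite -natr1.
rewrite [1 + (n%:R + 1)]addrC; set t := n%:R + 1 in n1 *.
rewrite -addrA lerD2l -subr_ge0.
have -> : - (t + 1)^-1 - (- t^-1 + ((t + 1) ^+ 2)^-1) = (t * (t + 1) ^+ 2)^-1.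
  by field; apply/andP; split; apply: lt0r_neq0; lra.
by rewrite invr_ge0 mulr_ge0 ?sqr_ge0// ltW.
Qed.

Lemma sum_weight1 (n : nat) :
  \sum_(k < (n + n).+1) ((1 + `|(k%:Z - n%:Z)%R|%N%:R) ^+ 2)^-1 <= 4 :> R.
Proof.
pose u (k : nat) : R := ((1 + k%:R) ^+ 2)^-1.
have u2 q : \sum_(k < q) u k <= 2.
  case: q => [|q]; first by rewrite big_ord0.
  apply: le_trans (sum_inv_sqr q) _; rewrite gerBl invr_ge0 addr_ge0//.
rewrite -addnS big_split_ord/=.
rewrite (_ : 4 = 2 + 2)%R; last by lra.
apply: lerD.
  rewrite (reindex_inj rev_ord_inj)/=.
  apply: le_trans (u2 n.+1); rewrite big_ord_recl/= -[leLHS]add0r lerD//.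
    by rewrite invr_ge0 sqr_ge0.
  apply: ler_sum => k _; rewrite /u le_eqVlt; apply/orP; left; apply/eqP.
  congr ((_ + _%:R) ^+ 2)^-1; have := ltn_ord k; rewrite /bump leq0n; lia.
apply: le_trans (u2 n.+1); apply: ler_sum => k _.
rewrite /u le_eqVlt; apply/orP; left; apply/eqP.
by congr ((_ + _%:R) ^+ 2)^-1; lia.
Qed.

Lemma fset_bounded J : exists n : nat, forall m, m \in J -> forall j, (`|m 0%R j| <= n)%N.
Proof.
exists (\sum_(m <- J) \sum_j `|m 0%R j|%N)%N => m mJ j.
rewrite (big_fsetD1 m mJ)/= (bigD1 j)//=.
by rewrite -addnA leq_addr.
Qed.

Lemma weight_sum J : \sum_(m <- J) weight m <= 4 ^+ d.
Proof.
have [n hn] := fset_bounded J.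
pose pt (F : {ffun 'I_d -> 'I_(n + n).+1}) : L := \row_j ((F j)%:Z - n%:Z).
have pt_inj : injective pt.
  move=> F G /rowP FG; apply/ffunP => j; have := FG j; rewrite !mxE => h.
  by apply: val_inj => /=; lia.
have ptJ m : m \in J -> exists F, pt F = m.
  move=> /hn mn; exists [ffun j => inord `|(m 0 j + n%:Z)%R|%N].
  apply/rowP => j; rewrite /pt mxE ffunE; have := mn j.
  by move: (m 0 j) => x xn; rewrite inordK; lia.
apply: (@le_trans _ _ (\sum_F weight (pt F))).
  apply: (@le_trans _ _ (\sum_(m <- J) \sum_F (if pt F == m then weight (pt F) else 0))).
    rewrite big_seq [leRHS]big_seq; apply: ler_sum => m /ptJ[F Fm].
    rewrite (bigD1 F)//= Fm eqxx lerDl; apply: sumr_ge0 => G _.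
    by case: ifP => // _; exact: weight_ge0.
  rewrite exchange_big/=; apply: ler_sum => F _.
  case: (boolP (pt F \in J)) => FJ.
    rewrite (big_fsetD1 _ FJ)/= eqxx big_seq_cond big1 ?addr0//.
    by move=> m /andP[+ _]; rewrite !inE => /andP[/negbTE mF _]; rewrite eq_sym mF.
  rewrite big_seq big1 ?weight_ge0// => m mJ.
  by case: eqP => // E; move: FJ; rewrite E mJ.
rewrite /weight; under eq_bigr do under eq_bigr do rewrite mxE.
rewrite -(bigA_distr_bigA (fun _ (k : 'I_(n + n).+1) => ((1 + `|(k%:Z - n%:Z)%R|%N%:R) ^+ 2)^-1 : R)).
rewrite prodr_const card_ord lerXn2r ?nnegrE//; last exact: sum_weight1.
by apply: sumr_ge0 => k _; rewrite invr_ge0 sqr_ge0.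
Qed.

(** the Japanese bracket 1 + |m|, with the maximum norm *)
Definition bracket m : R := 1 + (norm_inf (absv m))%:R.

Lemma bracket_ge1 m : 1 <= bracket m.
Proof. by rewrite lerDl. Qed.

Lemma bracket_gt0 m : 0 < bracket m.
Proof. exact: lt_le_trans (bracket_ge1 m). Qed.

Lemma bracket_ge0 m : 0 <= bracket m.
Proof. exact: ltW (bracket_gt0 m). Qed.

Lemma leq_norm_inf m j : (`|m 0%R j| <= norm_inf (absv m))%N.
Proof.
rewrite /norm_inf; apply: leq_trans (leq_bigmax j).
by rewrite mxE (ord1 ord0).
Qed.

Lemma bracket_shift m j : bracket (m + unit_vec j) <= 2 * bracket m.
Proof.
apply: (@le_trans _ _ (1 + (norm_inf (absv m)).+1%:R)).
  rewrite lerD2l ler_nat; apply/bigmax_leqP => i _; rewrite mxE (ord1 ord0) mxE unit_vecE.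
  by have := leq_norm_inf m i; case: (i == j) => /=; lia.
rewrite /bracket -natr1; set t := _%:R; have : 0 <= t by rewrite /t.
lra.
Qed.

Lemma bracket_unshift m j : bracket m <= 2 * bracket (m + unit_vec j).
Proof.
apply: (@le_trans _ _ (1 + (norm_inf (absv (m + unit_vec j))).+1%:R)).
  rewrite lerD2l ler_nat; apply/bigmax_leqP => i _; rewrite mxE (ord1 ord0).
  by have := leq_norm_inf (m + unit_vec j) i; rewrite mxE unit_vecE; case: (i == j) => /=; lia.
rewrite /bracket -natr1; set t := _%:R; have : 0 <= t by rewrite /t.
lra.
Qed.

Lemma bracket_weight m : (bracket m ^+ (2 * d))^-1 <= weight m.
Proof.
have -> : (bracket m ^+ (2 * d))^-1 = \prod_(j < d) (bracket m ^+ 2)^-1.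
  by rewrite prodr_const card_ord exprVn exprM.
apply: ler_prod => j _; rewrite invr_ge0 sqr_ge0/=.
have t0 : 0 < 1 + `|m 0%R j|%N%:R :> R by rewrite ltr_wpDr.
rewrite lef_pV2 ?posrE ?exprn_gt0 ?bracket_gt0//.
rewrite lerXn2r ?nnegrE ?addr_ge0 ?bracket_ge0//.
by rewrite lerD2l ler_nat leq_norm_inf.
Qed.

Definition diff j f m := f (m + unit_vec j) - f m.

(** the characters of (Z / 2) ^ d *)
Definition sgn S m : C := \prod_(j in S) (-1) ^+ `|m 0%R j|%N.

Lemma sgn_shift S j m : j \in S -> sgn S (m + unit_vec j) = - sgn S m.
Proof.
move=> jS; rewrite /sgn (bigD1 j)//= [in RHS](bigD1 j)//= -mulNr; congr (_ * _).
  rewrite mxE unit_vecE eqxx -signr_odd -[in RHS]signr_odd.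
  have -> : odd `|(m 0 j + true%:Z)%R| = ~~ odd `|m 0%R j| by lia.
  by rewrite signrN.
apply: eq_bigr => i /andP[_ ij]; rewrite mxE unit_vecE (negbTE ij).
by rewrite addr0.
Qed.

Lemma normc_sgn S m : normc (sgn S m) = 1.
Proof.
rewrite /sgn; elim/big_ind : _ => [|x y hx hy|j _]; first exact: normc1.
  by rewrite normcM hx hy mulr1.
by rewrite normcX normc_opp normc1 expr1n.
Qed.

(** A unit translation along a coordinate in [S] changes the sign of [sgn S], so
    the average of the sum with its translate is the sum of minus half of the
    differences. *)
Lemma has_sum_iter_diff S j f V k : j \in S -> has_sum (fun m => sgn S m * f m) V ->
  has_sum (fun m => sgn S m * ((- 2^-1) ^+ k * iter k (diff j) f m)) V.
Proof.
move=> jS fV; elim: k => [|k ih].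
  by move: fV; congr has_sum; apply/funext => m; rewrite expr0 mul1r.
have := has_sumZ 2^-1 (has_sumD (has_sum_shift j ih) ih).
have -> : 2^-1 * (V + V) = V by field.
congr has_sum; apply/funext => m; rewrite sgn_shift// iterS /diff exprS.
by ring.
Qed.

(** what remains of 2 ^ d times the indicator of the even sublattice, the sum of
    all characters, after subtracting the full lattice *)
Definition parity_weight m : C := \sum_(S : {set 'I_d} | S != finset.set0) sgn S m.

Lemma parity_weightE m :
  parity_weight m = (if [forall j, ~~ odd `|m 0%R j|] then 2 ^+ d else 0) - 1.
Proof.
have E : \sum_(S : {set 'I_d}) sgn S m = if [forall j, ~~ odd `|m 0%R j|] then 2 ^+ d else 0.
  transitivity (\prod_j ((-1) ^+ `|m 0%R j|%N + 1) : C).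
    rewrite bigA_distr/=; apply: eq_bigr => S _.
    by rewrite /sgn big_mkcond.
  case: ifPn => [/forallP h|].
    rewrite -[X in 2 ^+ X]card_ord -prodr_const; apply: eq_bigr => j _.
    by rewrite -signr_odd (negbTE (h j)).
  rewrite negb_forall => /existsP[j]; rewrite negbK => oj.
  by rewrite (bigD1 j)//= -signr_odd oj expr1 addNr mul0r.
rewrite -E (bigD1 finset.set0)//= /sgn big_set0 addrC addrK//.
Qed.

(** The outcome of [K] averagings for each character, along one of its
    coordinates: it has the sum of [parity_weight * f] if [f] is summable, and it
    remains summable when [f] grows polynomially and its differences decay. *)
Definition regularize (K : nat) f m : C := \sum_(S : {set 'I_d} | S != finset.set0)
  sgn S m * ((- 2^-1) ^+ K *
    (if [pick j in S] is Some j then iter K (diff j) f m else 0)).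

Lemma iter_diffD j f g k : iter k (diff j) (fun m => f m + g m) =
  (fun m => iter k (diff j) f m + iter k (diff j) g m).
Proof. by elim: k => [//|k ih]; rewrite !iterS ih; apply/funext => m; rewrite /diff; ring. Qed.

Lemma iter_diffZ j c f k : iter k (diff j) (fun m => c * f m) =
  (fun m => c * iter k (diff j) f m).
Proof. by elim: k => [//|k ih]; rewrite !iterS ih; apply/funext => m; rewrite /diff; ring. Qed.

Lemma iter_diff0 j k : iter k (diff j) (fun=> 0) = (fun=> 0).
Proof. by elim: k => [//|k ih]; rewrite !iterS ih; apply/funext => m; rewrite /diff subrr. Qed.

Lemma regularizeD K f g m :
  regularize K (fun m => f m + g m) m = regularize K f m + regularize K g m.
Proof.
rewrite /regularize -big_split/=; apply: eq_bigr => S _.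
by case: pickP => [j _|_]; rewrite ?iter_diffD; ring.
Qed.

Lemma regularizeZ K c f m : regularize K (fun m => c * f m) m = c * regularize K f m.
Proof.
rewrite /regularize mulr_sumr; apply: eq_bigr => S _.
by case: pickP => [j _|_]; rewrite ?iter_diffZ; ring.
Qed.

Lemma regularize0 K m : regularize K (fun=> 0) m = 0.
Proof.
rewrite /regularize big1// => S _.
by case: pickP => [j _|_]; rewrite ?iter_diff0 !mulr0.
Qed.

Lemma regularize_sum K (T : Type) (r : seq T) (P : pred T) (f : T -> L -> C) m :
  regularize K (fun m => \sum_(t <- r | P t) f t m) m =
  \sum_(t <- r | P t) regularize K (f t) m.
Proof.
elim: r => [|t r ih].
  rewrite big_nil -[RHS](regularize0 K m); congr (regularize K _ m).
  by apply/funext => n; rewrite big_nil.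
rewrite big_cons; case: ifP => Pt; last first.
  by rewrite -ih; congr (regularize K _ m); apply/funext => n; rewrite big_cons Pt.
rewrite -ih -regularizeD; congr (regularize K _ m).
by apply/funext => n; rewrite big_cons Pt.
Qed.

Lemma has_sum_regularize K f V c : 0 <= c -> (forall m, normc (f m) <= c * weight m) ->
  has_sum (fun m => parity_weight m * f m) V -> has_sum (regularize K f) V.
Proof.
move=> c0 fw fV.
have sgn_sum S : exists VS, has_sum (fun m => sgn S m * f m) VS.
  apply: (has_sum_dominated weight_ge0 c0 weight_sum) => m.
  by rewrite normcM normc_sgn mul1r.
have [VS hVS] := choice sgn_sum.
have E : V = \sum_(S : {set 'I_d} | S != finset.set0) VS S.
  apply: has_sum_unique fV _.
  rewrite (_ : (fun _ => _) = fun m => \sum_(S : {set 'I_d} | S != finset.set0) sgn S m * f m).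
    by apply: has_sum_big => S _; exact: hVS.
  by apply/funext => m; rewrite /parity_weight mulr_suml.
rewrite E; apply: has_sum_big => S S0; case: pickP => [j jS|h].
  exact: has_sum_iter_diff.
by move: S0; rewrite (_ : S = finset.set0) ?eqxx//; apply/finset.setP => j; rewrite inE h.
Qed.

(** Symbols of order [a - b] up to [K] differences along the axes.  The negative
    part of the order is kept on the left-hand side to have natural exponents
    only. *)
Definition symbol1 j (K a b : nat) (c : R) f := forall k m, (k <= K)%N ->
  normc (iter k (diff j) f m) * bracket m ^+ (k + b) <= c * bracket m ^+ a.

Lemma symbol1_diff j K a b c f : symbol1 j K.+1 a b c f -> symbol1 j K a b.+1 c (diff j f).
Proof. by move=> h k m kK; have := h k.+1 m kK; rewrite iterSr addSnnS. Qed.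

Lemma symbol1_shift j K a b c f : 0 <= c -> symbol1 j K a b c f ->
  symbol1 j K a b (2 ^+ (K + b + a) * c) (fun m => f (m + unit_vec j)).
Proof.
move=> c0 h k m kK.
have -> : iter k (diff j) (fun m => f (m + unit_vec j)) m =
    iter k (diff j) f (m + unit_vec j).
  by elim: k m {kK} => [//|k ih] m; rewrite !iterS /diff !ih.
have B0 : 0 <= bracket (m + unit_vec j) by exact: bracket_ge0.
have b0 : 0 <= bracket m by exact: bracket_ge0.
apply: (@le_trans _ _ (normc (iter k (diff j) f (m + unit_vec j)) *
   (2 ^+ (k + b) * bracket (m + unit_vec j) ^+ (k + b)))).
  rewrite ler_wpM2l ?normc_ge0// -exprMn lerXn2r ?nnegrE ?mulr_ge0//.
  exact: bracket_unshift.
rewrite mulrCA; apply: le_trans (ler_wpM2l (exprn_ge0 _ _) (h k _ kK)) _ => //.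
apply: (@le_trans _ _ (2 ^+ (k + b) * (c * (2 ^+ a * bracket m ^+ a)))).
  rewrite !ler_wpM2l ?exprn_ge0// -exprMn lerXn2r ?nnegrE ?mulr_ge0//.
  exact: bracket_shift.
have -> : 2 ^+ (k + b) * (c * (2 ^+ a * bracket m ^+ a)) =
   2 ^+ (k + b) * 2 ^+ a * c * bracket m ^+ a by ring.
rewrite ler_wpM2r ?exprn_ge0// ler_wpM2r// -exprD.
by rewrite ler_eXn2l ?ltr1n// !leq_add2r.
Qed.

(** Leibniz rule, with a constant uniform in the two functions. *)
Lemma symbol1M j K a b a' b' : exists2 M, 0 <= M & forall f g c c',
  0 <= c -> 0 <= c' -> symbol1 j K a b c f -> symbol1 j K a' b' c' g ->
  symbol1 j K (a + a') (b + b') (M * c * c') (fun m => f m * g m).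
Proof.
have base f g c c' b1 b1' m : 0 <= c -> 0 <= c' ->
    normc (f m) * bracket m ^+ b1 <= c * bracket m ^+ a ->
    normc (g m) * bracket m ^+ b1' <= c' * bracket m ^+ a' ->
    normc (f m * g m) * bracket m ^+ (b1 + b1') <= c * c' * bracket m ^+ (a + a').
  move=> c0 c0' hf hg; rewrite normcM !exprD mulrACA [leRHS]mulrACA.
  by apply: ler_pM => //; rewrite mulr_ge0 ?normc_ge0 ?exprn_ge0 ?bracket_ge0.
elim: K b b' => [|K ih] b b'.
  exists 1 => // f g c c' c0 c0' hf hg k m; rewrite leqn0 => /eqP -> /=.
  by rewrite mul1r add0n; apply: base => //; [exact: (hf 0%N)|exact: (hg 0%N)].
have [M1 M10 h1] := ih b.+1 b'; have [M2 M20 h2] := ih b b'.+1.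
exists (1 + (M1 * 2 ^+ (K.+1 + b' + a') + M2)); first by rewrite !addr_ge0 ?mulr_ge0 ?exprn_ge0.
move=> f g c c' c0 c0' hf hg.
have c2 : 0 <= 2 ^+ (K.+1 + b' + a') * c' :> R by rewrite mulr_ge0 ?exprn_ge0.
have cc : 0 <= c * c' by rewrite mulr_ge0.
have restrict a1 b1 c1 h : symbol1 j K.+1 a1 b1 c1 h -> symbol1 j K a1 b1 c1 h.
  by move=> hh k m kK; apply: hh; exact: leqW.
move=> [|k] m kK.
  have := base f g c c' b b' m c0 c0' (hf 0%N m isT) (hg 0%N m isT).
  rewrite add0n /= => /le_trans; apply; rewrite ler_wpM2r ?exprn_ge0 ?bracket_ge0//.
  by rewrite -mulrA; apply: ler_peMl => //; rewrite lerDl addr_ge0 ?mulr_ge0 ?exprn_ge0.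
have E : diff j (fun m => f m * g m) =
    fun m => diff j f m * g (m + unit_vec j) + f m * diff j g m.
  by apply/funext => n; rewrite /diff; ring.
rewrite iterSr E iter_diffD; apply: le_trans (ler_wpM2r _ (ler_normcD _ _)) _.
  by rewrite exprn_ge0// bracket_ge0.
have p1 := h1 _ _ _ _ c0 c2 (symbol1_diff hf) (restrict _ _ _ _ (symbol1_shift c0' hg)) k m kK.
have p2 := h2 _ _ _ _ c0 c0' (restrict _ _ _ _ hf) (symbol1_diff hg) k m kK.
rewrite (addSn b b') in p1; rewrite (addnS b b') in p2.
have -> : (k.+1 + (b + b') = k + (b + b').+1)%N by rewrite addSnnS.
rewrite mulrDl; apply: le_trans (lerD p1 p2) _.
rewrite -mulrDl ler_wpM2r ?exprn_ge0 ?bracket_ge0//.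
rewrite (_ : M1 * c * _ + _ = (M1 * 2 ^+ (K.+1 + b' + a') + M2) * c * c'); last by ring.
by rewrite !ler_wpM2r// lerDr.
Qed.

End lattice.

(** * Finite differences and derivatives on the real line *)

Section line_calculus.
Context {R : realType}.

Definition fdiff (u : R -> R) t := u (t + 1) - u t.

Lemma is_derive1D (u v : R -> R) (t a b : R) : is_derive t 1 u a -> is_derive t 1 v b ->
  is_derive t 1 (fun t => u t + v t) (a + b).
Proof. by move=> hu hv; exact: is_deriveD. Qed.

Lemma is_derive1B (u v : R -> R) (t a b : R) : is_derive t 1 u a -> is_derive t 1 v b ->
  is_derive t 1 (fun t => u t - v t) (a - b).
Proof. by move=> hu hv; exact: is_deriveB. Qed.

Lemma is_derive1M (u v : R -> R) (t a b : R) : is_derive t 1 u a -> is_derive t 1 v b ->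
  is_derive t 1 (fun t => u t * v t) (a * v t + u t * b).
Proof.
move=> hu hv; apply: (is_derive_eq (is_deriveM hu hv)).
by rewrite addrC mulrC.
Qed.

Lemma is_derive1_addr (u : R -> R) (t a c : R) : is_derive (t + c) 1 u a ->
  is_derive t 1 (fun t => u (t + c)) a.
Proof.
move=> hu; have h : is_derive t (1 : R) (shift c) 1 := is_derive_shift t 1 c.
have := @is_derive1_comp R u (shift c) t a 1 hu h.
by rewrite mulr1.
Qed.

Lemma is_derive_iter_fdiff (u u' : R -> R) k (t : R) :
  (forall y : R, t <= y <= t + k%:R -> is_derive y 1 u (u' y)) ->
  is_derive t 1 (iter k fdiff u) (iter k fdiff u' t).
Proof.
elim: k t => [|k ih] t h; first by apply: h; rewrite addr0 lexx.
rewrite !iterS; apply: is_derive1B; last first.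
  apply: ih => y /andP[ty yt]; apply: h; rewrite ty (le_trans yt)// -natr1.
  by rewrite lerD2l lerDl.
apply: is_derive1_addr; apply: ih => y /andP[ty yt]; apply: h.
by rewrite (le_trans _ ty) ?lerDl//= -nat1r addrA.
Qed.

(** The mean value theorem gains one derivative for each difference. *)
Lemma fdiff_MVT (u u' : R -> R) k (t : R) :
  (forall y : R, t <= y <= t + k.+1%:R -> is_derive y 1 u (u' y)) ->
  exists2 xi, t <= xi <= t + 1 & iter k.+1 fdiff u t = iter k fdiff u' xi.
Proof.
move=> h; have dv y : t <= y <= t + 1 ->
    is_derive y 1 (iter k fdiff u) (iter k fdiff u' y).
  move=> /andP[ty yt]; apply: is_derive_iter_fdiff => x /andP[yx xy].
  apply: h; rewrite (le_trans ty yx) (le_trans xy)// -nat1r addrA lerD2r//.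
have t1 : t < t + 1 by rewrite ltrDl.
have cv : {within `[t, t + 1], continuous (iter k fdiff u)}.
  by apply: derivable_within_continuous => x; rewrite in_itv/= => /dv[dx _].
have dv' x : x \in `]t, t + 1[ -> is_derive x 1 (iter k fdiff u) (iter k fdiff u' x).
  by rewrite in_itv/= => /andP[tx xt]; apply: dv; rewrite !ltW.
have [xi] := MVT t1 dv' cv.
rewrite in_itv/= => /andP[tx xt] E; exists xi; first by rewrite !ltW.
by rewrite ?iterS /fdiff E addrAC subrr add0r mulr1.
Qed.

(** the restrictions to the axis lines of the real and imaginary parts of the
    complex powers of the Euclidean norm, [q + t ^+ 2] being its square, closed
    under differentiation *)
Definition line_power (sig tau q : R) (a b : nat) (th t : R) : R :=
  t ^+ a * (expR (- (b%:R + sig / 2) * ln (q + t ^+ 2)) *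
            cos (tau / 2 * ln (q + t ^+ 2) + th)).

Lemma is_derive_line_power (sig tau q : R) a b (th t : R) : 0 < q + t ^+ 2 ->
  is_derive t 1 (line_power sig tau q a b th)
   (a%:R * line_power sig tau q a.-1 b th t
    - (2 * b%:R + sig) * line_power sig tau q a.+1 b.+1 th t
    + tau * line_power sig tau q a.+1 b.+1 (th + pi / 2) t).
Proof.
move=> Q0.
have dQ : is_derive t (1 : R) (fun t => q + t ^+ 2) (2 * t).
  apply: (is_derive_eq (is_derive1D (is_derive_cst q t 1) (is_deriveX 2 (is_derive_id t (1 : R))))).
  by rewrite add0r /= expr1 -[_ *: _]/(_ * _) mulr1.
have dl := @is_derive1_comp R (@ln R) (fun t => q + t ^+ 2) t _ _ (is_derive1_ln Q0) dQ.
have dE := @is_derive1_comp R expR (fun t => - (b%:R + sig / 2) * ln (q + t ^+ 2)) t _ _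
  (is_derive_expR _) (is_derive1M (is_derive_cst (- (b%:R + sig / 2)) t 1) dl).
have dC := @is_derive1_comp R cos (fun t => tau / 2 * ln (q + t ^+ 2) + th) t _ _
  (is_derive_cos _)
  (is_derive1D (is_derive1M (is_derive_cst (tau / 2) t 1) dl) (is_derive_cst th t 1)).
have dP : is_derive t (1 : R) (fun t => t ^+ a) (a%:R * t ^+ a.-1).
  split; first exact: exprn_derivable.
  by rewrite exp_derive -[_ *: 1]/(_ * 1) mulr1.
apply: (@is_derive_eq _ _ _ (line_power sig tau q a b th) t 1 _ _
  (is_derive1M dP (is_derive1M dE dC))).
rewrite /line_power /= addrA cosDpihalf.
have -> : expR (- (b.+1%:R + sig / 2) * ln (q + t ^+ 2)) =
    expR (- (b%:R + sig / 2) * ln (q + t ^+ 2)) / (q + t ^+ 2).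
  rewrite -natr1 (_ : - (b%:R + 1 + sig / 2) * _ =
    - (b%:R + sig / 2) * ln (q + t ^+ 2) - ln (q + t ^+ 2)); last by ring.
  by rewrite expRB lnK.
rewrite !exprS; have qn : q + t * t != 0 by rewrite -expr2 gt_eqF.
set E := expR _; set c := cos _; set sn := sin _.
case: a dP => [|a] _ /=; field; rewrite ?qn//.
Qed.

End line_calculus.

Section symbols.
Context {R : realType} {d : nat}.
Local Notation C := R[i].
Local Notation L := 'rV[int]_d.
Implicit Types (m : L) (f g : L -> C) (i j : 'I_d).

Definition symbol (K a : nat) (c : R) f := forall j, symbol1 j K a 0 c f.

Lemma symbolM K a a' : exists2 M : R, 0 <= M & forall f g c c',
  0 <= c -> 0 <= c' -> symbol K a c f -> symbol K a' c' g ->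
  symbol K (a + a') (M * c * c') (fun m => f m * g m).
Proof.
have hM j : exists M : R, 0 <= M /\ forall f g c c',
  0 <= c -> 0 <= c' -> symbol1 j K a 0 c f -> symbol1 j K a' 0 c' g ->
  symbol1 j K (a + a') 0 (M * c * c') (fun m => f m * g m).
  by have [M1 ? ?] := @symbol1M R d j K a 0 a' 0; exists M1.
have [M' hM'] := choice hM.
exists (\sum_j M' j); first by apply: sumr_ge0 => j _; case: (hM' j).
move=> f g c c' c0 c0' hf hg j k m kK.
have [_ /(_ _ _ _ _ c0 c0' (hf j) (hg j) k m kK)] := hM' j => /le_trans; apply.
rewrite ler_wpM2r ?exprn_ge0 ?bracket_ge0// !ler_wpM2r//.
by rewrite (bigD1 j)//= lerDl sumr_ge0// => i _; case: (hM' i).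
Qed.

(** [K] differences bring a symbol of order [a] down to the order [a - K]. *)
Lemma regularize_symbol K a c f : 0 <= c -> (a + 2 * d <= K)%N -> symbol K a c f ->
  forall m, normc (regularize K f m) <= (#|{set 'I_d}|%:R * c) * weight m.
Proof.
move=> c0 aK hf m; have B0 : 0 < bracket m :> R by exact: bracket_gt0.
have main j : normc (iter K (diff j) f m) <= c * weight m.
  have := hf j K m (leqnn K); rewrite addn0 -ler_pdivlMr ?exprn_gt0// => /le_trans; apply.
  rewrite -mulrA ler_wpM2l//; apply: le_trans (bracket_weight m).
  rewrite ler_pdivrMr ?exprn_gt0// mulrC ler_pdivlMr ?exprn_gt0// -exprD.
  by rewrite ler_weXn2l// bracket_ge1.
apply: le_trans (normc_sum _ _ _) _.
apply: (@le_trans _ _ (\sum_(S : {set 'I_d}) c * weight m)).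
  rewrite [leRHS](bigID (fun S => S != finset.set0))/= -[leLHS]addr0 lerD//; last first.
    by apply: sumr_ge0 => S _; rewrite mulr_ge0// weight_ge0.
  apply: ler_sum => S _; rewrite !normcM normc_sgn mul1r.
  case: pickP => [j _|_]; last by rewrite normc0 mulr0 mulr_ge0// weight_ge0.
  apply: le_trans (main j); rewrite ler_piMl ?normc_ge0// normcX normc_opp normcV.
  rewrite -[2]/(2%:R) -(rmorph_nat (@real_complex_def R (Phant R))) normc_real.
  by rewrite exprn_ile1 ?invr_ge0// normr_nat invf_le1// ler1n.
by rewrite sumr_const -[leLHS]mulr_natl mulrA.
Qed.

Lemma iter_diff_line (phi : C -> R) j k m f (u : R -> R) t :
  {morph phi : x y / x - y} ->
  (forall n, (n <= k)%N -> phi (f (m + unit_vec j *+ n)) = u (t + n%:R)) ->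
  phi (iter k (diff j) f m) = iter k fdiff u t.
Proof.
move=> phiB; elim: k m t => [|k ih] m t h.
  by have := h 0%N isT; rewrite mulr0n !addr0.
rewrite !iterS /diff /fdiff phiB (ih m t); last first.
  by move=> n nk; apply: h; exact: leqW.
rewrite (ih _ (t + 1))// => n nk.
by rewrite -!addrA -mulrS nat1r; exact: h.
Qed.

End symbols.

Section power_symbol.
Context {R : realType}.

Lemma iter_fdiff_lin (a b c : R) (u v w : R -> R) k t :
  iter k fdiff (fun t => a * u t - b * v t + c * w t) t =
  a * iter k fdiff u t - b * iter k fdiff v t + c * iter k fdiff w t.
Proof. by elim: k t => [//|k ih] t; rewrite !iterS /fdiff !ih; ring. Qed.

Lemma line_power_bound (Lam : R) (a b : nat) (rho sig tau q th t : R) :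
  1 <= rho -> -1 <= sig -> 0 <= q ->
  rho ^+ 2 <= q + t ^+ 2 <= (Lam * rho) ^+ 2 -> 0 <= Lam ->
  `|line_power sig tau q a b th t| * rho ^+ (2 * b) <= Lam ^+ a.+1 * rho ^+ a.+1.
Proof.
move=> rho1 sig1 q0 /andP[Q1 Q2] Lam0; set Q := q + t ^+ 2 in Q1 Q2 *.
have rho0 : 0 < rho by exact: lt_le_trans rho1.
have Q0 : 0 < Q by apply: lt_le_trans Q1; rewrite exprn_gt0.
have Q01 : 1 <= Q by apply: le_trans Q1; rewrite exprn_ege1.
have lam0 : 0 <= Lam * rho by rewrite mulr_ge0// ltW.
rewrite /line_power -/Q !normrM.
have c1 : `|cos (tau / 2 * ln Q + th)| <= 1 by rewrite ler_norml cos_geN1 cos_le1.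
have t1 : `|t ^+ a| <= (Lam * rho) ^+ a.
  rewrite normrX lerXn2r ?nnegrE//.
  rewrite -(ler_pXn2r (_ : 0 < 2)%N) ?nnegrE// real_normK ?num_real//.
  by apply: le_trans Q2; rewrite lerDr.
have E1 : `|expR (- (b%:R + sig / 2) * ln Q)| * rho ^+ (2 * b) <= Lam * rho.
  rewrite ger0_norm ?expR_ge0//.
  have -> : - (b%:R + sig / 2) * ln Q = - sig / 2 * ln Q - b%:R * ln Q by ring.
  rewrite expRB mulrAC -mulrA.
  have -> : expR (b%:R * ln Q) = Q ^+ b by rewrite expRM_natl lnK.
  apply: (@le_trans _ _ (expR (- sig / 2 * ln Q))).
    rewrite ler_piMr ?expR_ge0// ler_pdivrMr ?exprn_gt0// mul1r exprM.
    by rewrite lerXn2r ?nnegrE ?sqr_ge0// ltW.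
  rewrite -(ler_pXn2r (_ : 0 < 2)%N) ?nnegrE ?expR_ge0//.
  apply: le_trans Q2; rewrite -expRM_natl -[leRHS](lnK Q0) ler_expR mulrA.
  rewrite -[leRHS]mul1r ler_wpM2r ?ln_ge0//; lra.
move: t1 c1 E1; set P := `|t ^+ a|; set E := `|expR _|; set c := `|cos _| => t1 c1 E1.
have E0 : 0 <= E * rho ^+ (2 * b) by rewrite mulr_ge0 ?normr_ge0 ?exprn_ge0 ?(ltW rho0).
rewrite -[leLHS]mulrA exprSr [rho ^+ a.+1]exprSr mulrACA -exprMn.
have P0 : 0 <= P by exact: normr_ge0.
have c0 : 0 <= c by exact: normr_ge0.
apply: ler_pM => //; first by rewrite mulrAC mulr_ge0.
by rewrite mulrAC; apply: le_trans E1; rewrite ler_piMr.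
Qed.

(** The mean value theorem trades a difference for a derivative, which is a
    combination of members of the same family with one power of [rho] less. *)
Lemma line_power_diff (B Lam : R) k a b : 0 <= Lam -> exists2 M : R, 0 <= M &
  forall rho sig tau q th t : R, 1 <= rho -> -1 <= sig <= B -> `|tau| <= B -> 0 <= q ->
  (forall y, t <= y <= t + k%:R -> rho ^+ 2 <= q + y ^+ 2 <= (Lam * rho) ^+ 2) ->
  `|iter k fdiff (line_power sig tau q a b th) t| * rho ^+ (k + 2 * b) <= M * rho ^+ a.+1.
Proof.
move=> Lam0; elim: k a b => [|k ih] a b.
  exists (Lam ^+ a.+1); first by rewrite exprn_ge0.
  move=> rho sig tau q th t rho1 /andP[sig1 _] _ q0 hy.
  by rewrite add0n /=; apply: line_power_bound => //; apply: hy; rewrite lexx lerDl ler0n.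
have [M1 M10 h1] := ih a.-1 b; have [M2 M20 h2] := ih a.+1 b.+1.
exists (a%:R * M1 + (2 * b%:R + `|B| + 1) * M2 + `|B| * M2).
  by rewrite !addr_ge0 ?mulr_ge0 ?addr_ge0 ?mulr_ge0.
move=> rho sig tau q th t rho1 sigB tauB q0 hy.
have rho0 : 0 < rho by exact: lt_le_trans rho1.
have [xi /andP[txi xit] ->] := fdiff_MVT (fun y hy' => @is_derive_line_power R sig tau q a b th y
  (lt_le_trans (exprn_gt0 2 rho0) (proj1 (andP (hy y hy'))))).
have hxi y : xi <= y <= xi + k%:R -> rho ^+ 2 <= q + y ^+ 2 <= (Lam * rho) ^+ 2.
  move=> /andP[y1 y2]; apply: hy; rewrite (le_trans txi y1) (le_trans y2)//.
  by rewrite -nat1r addrA lerD2r.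
rewrite iter_fdiff_lin; set X := iter _ _ _ _; set Y := iter _ _ _ _; set Z := iter _ _ _ _.
have k1 : `|a%:R * X| * rho ^+ (k.+1 + 2 * b) <= a%:R * M1 * rho ^+ a.+1.
  rewrite normrM normr_nat; case: (posnP a) => [->|a0]; first by rewrite !mul0r.
  rewrite -!mulrA ler_wpM2l// addSn exprS mulrCA -(prednK a0) exprS mulrCA.
  rewrite mulrCA [leRHS]mulrCA ler_wpM2l ?(ltW rho0)//.
  by have := h1 rho sig tau q th xi rho1 sigB tauB q0 hxi; rewrite (prednK a0).
have k2' W th' : W = iter k fdiff (line_power sig tau q a.+1 b.+1 th') xi ->
    `|W| * rho ^+ (k.+1 + 2 * b) <= M2 * rho ^+ a.+1.
  move=> ->; have := h2 rho sig tau q th' xi rho1 sigB tauB q0 hxi.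
  have -> : (k + 2 * b.+1 = (k.+1 + 2 * b).+1)%N by rewrite mulnS addnCA.
  rewrite [rho ^+ (k.+1 + 2 * b).+1]exprSr [rho ^+ a.+2]exprSr !mulrA.
  by rewrite ler_pM2r.
have k2 : `|(2 * b%:R + sig) * Y| * rho ^+ (k.+1 + 2 * b) <=
    (2 * b%:R + `|B| + 1) * M2 * rho ^+ a.+1.
  rewrite normrM -!mulrA; apply: ler_pM => //.
  - by rewrite mulr_ge0 ?exprn_ge0// ltW.
  - apply: le_trans (ler_normD _ _) _; rewrite -addrA lerD//.
      by rewrite ger0_norm// mulr_ge0.
    move: sigB => /andP[s1 s2]; rewrite ler_norml; apply/andP; split.
      by have := normr_ge0 B; lra.
    by have := ler_norm B; lra.
  - exact: k2' erefl.
have k3 : `|tau * Z| * rho ^+ (k.+1 + 2 * b) <= `|B| * M2 * rho ^+ a.+1.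
  rewrite normrM -!mulrA; apply: ler_pM => //.
  - by rewrite mulr_ge0 ?exprn_ge0// ltW.
  - by apply: le_trans tauB _; exact: ler_norm.
  - exact: k2' erefl.
apply: (@le_trans _ _ ((`|a%:R * X| + `|(2 * b%:R + sig) * Y| + `|tau * Z|) *
    rho ^+ (k.+1 + 2 * b))).
  rewrite ler_wpM2r ?exprn_ge0 ?(ltW rho0)//.
  apply: le_trans (ler_normD _ _) _; rewrite lerD2r; exact: ler_normB.
rewrite 2!(mulrDl _ _ (rho ^+ (k.+1 + 2 * b))) 2!(mulrDl _ _ (rho ^+ a.+1)).
by apply: lerD => //; exact: lerD.
Qed.

End power_symbol.

Section norm_power.
Context {R : realType} {d : nat}.
Local Notation C := R[i].
Local Notation L := 'rV[int]_d.
Implicit Types (m : L) (f g : L -> C) (i j : 'I_d).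

Definition sqnorm m : R := \sum_j (m 0%R j)%:~R ^+ 2.

Lemma enorm_grid1 m : enorm (grid_point 1 m) = Num.sqrt (sqnorm m) :> R.
Proof. by rewrite /enorm; congr Num.sqrt; apply: eq_bigr => j _; rewrite mxE mulr1. Qed.

Lemma sqnorm_ge0 m : 0 <= sqnorm m.
Proof. by apply: sumr_ge0 => j _; exact: sqr_ge0. Qed.

Lemma sqnorm_ge m j : (m 0%R j)%:~R ^+ 2 <= sqnorm m.
Proof. by rewrite /sqnorm (bigD1 j)//= lerDl sumr_ge0// => i _; exact: sqr_ge0. Qed.

Lemma sqr_absz (n : int) : (n%:~R ^+ 2 : R) = `|n|%N%:R ^+ 2.
Proof. by rewrite natr_absz intr_norm real_normK// num_real. Qed.

Lemma norm_inf_attained m (i : 'I_d) : exists j, norm_inf (absv m) = `|m 0%R j|%N.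
Proof.
have [|j E] := @bigop.eq_bigmax 'I_d (fun j => absv m ord0 j).
  by rewrite card_ord; case: d i => [[]|].
by exists j; rewrite /norm_inf E mxE (ord1 ord0).
Qed.

Lemma sqnorm_ge_inf m : (norm_inf (absv m))%:R ^+ 2 <= sqnorm m.
Proof.
have [ [i _] | d0] := pselect (exists i : 'I_d, True).
  by have [j ->] := norm_inf_attained m i; rewrite -sqr_absz sqnorm_ge.
rewrite /norm_inf big1 ?expr0n ?sqnorm_ge0// => i _.
by case: d0; exists i.
Qed.

Lemma sqnorm_le_inf m : sqnorm m <= d%:R * (norm_inf (absv m))%:R ^+ 2.
Proof.
apply: (@le_trans _ _ (\sum_(j < d) (norm_inf (absv m))%:R ^+ 2)).
  apply: ler_sum => j _; rewrite sqr_absz lerXn2r ?nnegrE// ler_nat.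
  exact: leq_norm_inf.
by rewrite sumr_const card_ord -[leLHS]mulr_natl.
Qed.

Lemma norm_inf_eq0 m : (norm_inf (absv m) == 0%N) = (m == 0).
Proof.
apply/eqP/eqP => [E|->].
  apply/rowP => j; have := leq_norm_inf m j; rewrite E leqn0 absz_eq0 => /eqP ->.
  by rewrite mxE.
by rewrite /norm_inf big1// => j _; rewrite !mxE.
Qed.

Lemma sqnorm_ge1 m : m != 0 -> 1 <= sqnorm m.
Proof.
move=> m0; apply: le_trans (sqnorm_ge_inf m).
by rewrite exprn_ege1// ler1n lt0n norm_inf_eq0.
Qed.

Definition norm_pow (z : C) m : C :=
  if m == 0 then 0 else cpow (Num.sqrt (sqnorm m)) (- z).

Lemma cpow_sqrt_line (z : C) (q t : R) : 0 < q + t ^+ 2 ->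
  cpow (Num.sqrt (q + t ^+ 2)) (- z) =
    line_power (complex.Re z) (- complex.Im z) q 0 0 0 t +i*
    line_power (complex.Re z) (- complex.Im z) q 0 0 (- (pi / 2)) t.
Proof.
move=> Q0; case: z => sig tau; rewrite /cpow /line_power /=.
set Q := q + t ^+ 2 in Q0 *.
have lnsqrt : ln (Num.sqrt Q) = ln Q / 2.
  rewrite -[in RHS](sqr_sqrtr (ltW Q0)) lnXn ?sqrtr_gt0//.
  by field.
rewrite /powR gt_eqF ?sqrtr_gt0// lnsqrt !expr0 !mul1r add0r.
rewrite cosB cos_pihalf mulr0 add0r sin_pihalf mulr1 addr0; simpc.
have -> : sig * (ln Q / 2) = sig / 2 * ln Q by ring.
by have -> : tau * (ln Q / 2) = tau / 2 * ln Q by ring.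
Qed.

Lemma normc_norm_pow z m : -1 <= complex.Re z ->
  normc (norm_pow z m) <= d%:R * bracket m.
Proof.
move=> z1; rewrite /norm_pow; case: eqP => [_|/eqP m0].
  by rewrite normc0 mulr_ge0// bracket_ge0.
have Q1 := sqnorm_ge1 m0; have Q0 : 0 < sqnorm m by exact: lt_le_trans Q1.
rewrite normc_cpow ReN; apply: (@le_trans _ _ (Num.sqrt (sqnorm m) `^ 1)).
  apply: ler_powR; last by rewrite lerNl.
  by rewrite -[leLHS]sqrtr1 ler_wsqrtr.
rewrite powRr1 ?sqrtr_ge0// -(ler_pXn2r (_ : 0 < 2)%N) ?nnegrE ?sqrtr_ge0 ?mulr_ge0 ?bracket_ge0//.
rewrite sqr_sqrtr ?sqnorm_ge0//; apply: le_trans (sqnorm_le_inf m) _.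
rewrite exprMn; apply: ler_pM => //.
  rewrite -natrX ler_nat expnS expn1; case: d => // d'.
  by rewrite leq_pmulr.
by rewrite lerXn2r ?nnegrE ?bracket_ge0// /bracket lerDr.
Qed.

Lemma iter_diff_trivial f (c : R) j k m : 0 <= c ->
  (forall m, normc (f m) <= c * bracket m) ->
  normc (iter k (diff j) f m) <= 3 ^+ k * c * bracket m.
Proof.
move=> c0 fc; elim: k m => [|k ih] m; first by rewrite expr0 mul1r.
rewrite iterS /diff; apply: le_trans (ler_normcB _ _) _.
apply: le_trans (lerD (ih _) (ih _)) _.
rewrite (_ : 3 ^+ k.+1 * c * bracket m = 3 ^+ k * c * (2 * bracket m) + 3 ^+ k * c * bracket m);
  last by rewrite exprS; ring.
by rewrite lerD2r ler_wpM2l ?mulr_ge0 ?exprn_ge0// bracket_shift.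
Qed.

(** On a lattice line far from the origin the differences are controlled by the
    derivatives; near the origin the bracket is bounded. *)
Lemma norm_pow_symbol K (B : R) : exists2 M : R, 0 <= M & forall z,
  -1 <= complex.Re z <= B -> `|complex.Im z| <= B -> symbol K 1 M (norm_pow z).
Proof.
pose Lam : R := 2 * (d%:R + 4).
have Lam0 : 0 <= Lam by rewrite mulr_ge0// addr_ge0.
have hM k : exists M : R, 0 <= M /\ forall rho sig tau q th t : R,
    1 <= rho -> -1 <= sig <= B -> `|tau| <= B -> 0 <= q ->
    (forall y, t <= y <= t + k%:R -> rho ^+ 2 <= q + y ^+ 2 <= (Lam * rho) ^+ 2) ->
    `|iter k fdiff (line_power sig tau q 0 0 th) t| * rho ^+ k <= M * rho.
  have [M M0 h] := line_power_diff B k 0 0 Lam0; exists M; split => //.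
  by move=> rho sig tau q th t h1 h2 h3 h4 h5; have := h rho sig tau q th t h1 h2 h3 h4 h5;
    rewrite muln0 addn0 expr1.
have [M hM'] := choice hM.
pose M' := \sum_(k < K.+1) M k.
have M'0 : 0 <= M' by apply: sumr_ge0 => k _; case: (hM' k).
exists (2 * 3 ^+ K * M' + 3 ^+ K * d%:R * (2 * K%:R + 3) ^+ K).
  by rewrite !addr_ge0 ?mulr_ge0 ?exprn_ge0 ?addr_ge0 ?mulr_ge0.
move=> z zB zi j k m kK; rewrite addn0 expr1.
have [Nbig|Nsmall] := leqP (2 * K).+2 (norm_inf (absv m)); last first.
  have b1 : bracket m <= 2 * K%:R + 3 :> R.
    rewrite /bracket; have : (norm_inf (absv m))%:R <= (2 * K).+1%:R :> R by rewrite ler_nat.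
    by rewrite -natr1 natrM; lra.
  have bk : bracket m ^+ k <= (2 * K%:R + 3) ^+ K :> R.
    apply: (@le_trans _ _ (bracket m ^+ K)); first by rewrite ler_weXn2l ?bracket_ge1.
    by rewrite lerXn2r ?nnegrE ?bracket_ge0 ?addr_ge0 ?mulr_ge0.
  have z1 : -1 <= complex.Re z by case/andP: zB.
  have := @iter_diff_trivial (norm_pow z) d%:R j k m (ler0n _ _) (fun m => normc_norm_pow m z1).
  move=> /(ler_pM (normc_ge0 _) (exprn_ge0 k (bracket_ge0 m)))/(_ bk)/le_trans; apply.
  rewrite [leRHS]mulrDl ler_wpDl ?mulr_ge0 ?exprn_ge0 ?bracket_ge0//.
  rewrite [leRHS]mulrAC ler_wpM2r ?exprn_ge0 ?addr_ge0 ?mulr_ge0//.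
  rewrite ler_wpM2r ?bracket_ge0// ler_wpM2r// ler_weXn2l// ler1n//.
set N := norm_inf (absv m) in Nbig *.
(* a segment of [k] steps from a point of maximum norm [N > 2 * K + 1] stays
   between the radii [rho] and [Lam * rho] *)
pose rho : R := N%:R / 2.
have N2 : (2 * K).+2%:R <= N%:R :> R by rewrite ler_nat.
have N2' : 2 * K%:R + 2 <= N%:R :> R by move: N2; rewrite -!natr1 natrM; lra.
have K0 : 0 <= K%:R :> R by [].
have rho1 : 1 <= rho by rewrite /rho; lra.
have rho0 : 0 < rho by exact: lt_le_trans rho1.
pose x : R := (m 0%R j)%:~R; pose q := sqnorm m - x ^+ 2.
have q0 : 0 <= q by rewrite subr_ge0 sqnorm_ge.
have xN : `|x| <= N%:R.
  by rewrite /x -intr_norm -natr_absz ler_nat leq_norm_inf.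
have kKR : k%:R <= K%:R :> R by rewrite ler_nat.
have hy y : x <= y <= x + k%:R -> rho ^+ 2 <= q + y ^+ 2 <= (Lam * rho) ^+ 2.
  move=> /andP[xy yx]; apply/andP; split.
    have [i Ei] := norm_inf_attained m j.
    have [ij|ij] := eqVneq i j.
      apply: (@le_trans _ _ (y ^+ 2)); last by rewrite lerDr.
      have xE : `|x| = N%:R by rewrite /x -intr_norm -natr_absz -ij -Ei.
      rewrite -(real_normK (num_real y)) lerXn2r ?nnegrE ?(ltW rho0)// /rho.
      have h1 : N%:R - K%:R <= `|y|.
        rewrite -xE; have -> : y = x + (y - x) by ring.
        apply: le_trans (lerB_normD _ _); rewrite lerD2l lerN2 ger0_norm ?subr_ge0//.
        by rewrite lerBlDl (le_trans yx)// lerD2l.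
      by lra.
    apply: (@le_trans _ _ (N%:R ^+ 2)).
      by rewrite lerXn2r ?nnegrE ?(ltW rho0)// /rho; lra.
    apply: (@le_trans _ _ q); last by rewrite lerDl sqr_ge0.
    rewrite /q /sqnorm (bigD1 j)//= addrC addrK (bigD1 i)//= /N Ei -sqr_absz lerDl.
    by apply: sumr_ge0 => l _; exact: sqr_ge0.
  have yN : `|y| <= 2 * N%:R.
    have -> : y = x + (y - x) by ring.
    apply: le_trans (ler_normD _ _) _; rewrite (@ger0_norm _ (y - x)) ?subr_ge0//.
    have : y - x <= k%:R by rewrite lerBlDl.
    by lra.
  have y2 : y ^+ 2 <= 4 * N%:R ^+ 2.
    rewrite -(real_normK (num_real y)); apply: (@le_trans _ _ ((2 * N%:R) ^+ 2)).
      by rewrite lerXn2r ?nnegrE ?mulr_ge0.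
    by rewrite le_eqVlt; apply/orP; left; apply/eqP; ring.
  have qN : q <= d%:R * N%:R ^+ 2.
    by apply: le_trans (sqnorm_le_inf m); rewrite /q lerBlDr lerDl sqr_ge0.
  apply: le_trans (lerD qN y2) _; rewrite -mulrDl.
  have -> : Lam * rho = (d%:R + 4) * N%:R by rewrite /Lam /rho; field.
  rewrite exprMn ler_wpM2r ?sqr_ge0// expr2 ler_peMr ?addr_ge0//.
  by rewrite -natrD ler1n addn4.
have npE n : (n <= k)%N -> norm_pow z (m + unit_vec j *+ n) =
    line_power (complex.Re z) (- complex.Im z) q 0 0 0 (x + n%:R) +i*
    line_power (complex.Re z) (- complex.Im z) q 0 0 (- (pi / 2)) (x + n%:R).
  move=> nk; have Q0 : 0 < q + (x + n%:R) ^+ 2.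
    apply: lt_le_trans (_ : rho ^+ 2 <= _); first by rewrite exprn_gt0.
    have /hy/andP[] : x <= x + n%:R <= x + k%:R by rewrite lerDl ler0n/= lerD2l ler_nat.
    by [].
  have QE : sqnorm (m + unit_vec j *+ n) = q + (x + n%:R) ^+ 2.
    rewrite /q /sqnorm (bigD1 j)//= [in RHS](bigD1 j)//= [x ^+ 2 + _]addrC addrK addrC.
    congr (_ + _); last by rewrite mxE mulmxnE unit_vecE eqxx rmorphD rmorphMn.
    apply: eq_bigr => i ij; rewrite mxE mulmxnE unit_vecE (negbTE ij).
    by rewrite mul0rn addr0.
  rewrite /norm_pow; case: eqP => [E|_].
    by move: Q0; rewrite -QE E /sqnorm big1 ?ltxx// => l _; rewrite mxE expr0n.
  by rewrite QE cpow_sqrt_line.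
have zi' : `|- complex.Im z| <= B by rewrite normrN.
have [Mk0 hk] := hM' k.
have rhob : bracket m <= 3 * rho by rewrite /bracket -/N /rho; lra.
have brho : rho <= bracket m by rewrite /bracket -/N /rho; lra.
have MkM : M k <= M'.
  by rewrite /M' (bigD1 (Ordinal (kK : (k < K.+1)%N)))//= lerDl sumr_ge0// => i _; case: (hM' i).
have part (phi : C -> R) th : {morph phi : u v / u - v} ->
    (forall n, (n <= k)%N -> phi (norm_pow z (m + unit_vec j *+ n)) =
      line_power (complex.Re z) (- complex.Im z) q 0 0 th (x + n%:R)) ->
    `|phi (iter k (diff j) (norm_pow z) m)| * bracket m ^+ k <= 3 ^+ K * M' * bracket m.
  move=> phiB hphi; rewrite (iter_diff_line phiB hphi).
  have h := hk _ _ _ _ th _ rho1 zB zi' q0 hy.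
  apply: (@le_trans _ _ (`|iter k fdiff (line_power (complex.Re z) (- complex.Im z) q 0 0 th) x|
     * (3 * rho) ^+ k)).
    by rewrite ler_wpM2l// lerXn2r ?nnegrE ?bracket_ge0 ?mulr_ge0 ?(ltW rho0).
  rewrite exprMn mulrCA; apply: le_trans (ler_wpM2l (exprn_ge0 _ _) h) _ => //.
  rewrite mulrA; apply: ler_pM; rewrite ?mulr_ge0 ?exprn_ge0 ?(ltW rho0)//.
  by apply: ler_pM; rewrite ?exprn_ge0 ?ler_weXn2l ?ler1n.
apply: (@le_trans _ _ ((3 ^+ K * M' + 3 ^+ K * M') * bracket m)); last first.
  rewrite ler_wpM2r ?bracket_ge0//.
  have -> : 2 * 3 ^+ K * M' = 3 ^+ K * M' + 3 ^+ K * M' :> R by ring.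
  rewrite lerDl.
  by rewrite ?mulr_ge0 ?exprn_ge0 ?addr_ge0 ?mulr_ge0.
apply: le_trans (ler_wpM2r (exprn_ge0 _ (bracket_ge0 _)) (normc_le_ReIm _)) _.
rewrite mulrDl [leRHS]mulrDl; apply: lerD.
  apply: (part (@complex.Re R) 0) => [u v|n nk]; first by rewrite ReD ReN.
  by rewrite npE.
apply: (part (@complex.Im R) (- (pi / 2))) => [u v|n nk]; first by rewrite ImD ImN.
by rewrite npE.
Qed.

(** Words of coordinates rather than exponents, so that induction multiplies by
    one coordinate at a time. *)
Definition mon (l : seq 'I_d) m : C := \prod_(i <- l) (m 0%R i)%:~R.

Lemma symbol_cst K (c : C) : symbol K 0 (normc c) (fun _ : L => c).
Proof.
move=> j [|k] m kK; first by rewrite /= !expr0.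
have -> : iter k.+1 (diff j) (fun _ : L => c) = fun=> 0.
  by rewrite iterSr (_ : diff j _ = fun=> 0) ?iter_diff0//; apply/funext => n; rewrite /diff subrr.
by rewrite normc0 mul0r mulr_ge0 ?normc_ge0.
Qed.

Lemma symbol_coord K i : symbol K 1 1 (fun m => (m 0%R i)%:~R : C).
Proof.
move=> j [|[|k]] m kK; rewrite ?addn0 mul1r expr1.
- rewrite /= expr0 mulr1 -[_%:~R](rmorph_int (@real_complex_def R (Phant R))) normc_real.
  by rewrite -intr_norm -natr_absz (le_trans _ (_ : (norm_inf (absv m))%:R <= _))// ?ler_nat ?leq_norm_inf// lerDr.
- rewrite /= /diff mxE rmorphD/= addrAC subrr add0r unit_vecE.
  rewrite ler_piMl ?bracket_ge0//; case: (i == j).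
    by rewrite -[1%:~R]/1 normc1.
  by rewrite -[_%:~R]/0 normc0.
have -> : iter k.+2 (diff j) (fun m : L => (m 0%R i)%:~R : C) = fun=> 0.
  rewrite !iterSr (_ : diff j (diff j _) = fun=> 0) ?iter_diff0//; apply/funext => n.
  by rewrite /diff !mxE !rmorphD/=; ring.
by rewrite normc0 mul0r bracket_ge0.
Qed.

Lemma symbol_mon K (l : seq 'I_d) : exists2 M : R, 0 <= M & symbol K (size l) M (mon l).
Proof.
elim: l => [|i l [M M0 ih]].
  exists 1 => //; rewrite (_ : mon [::] = fun=> 1); last by apply/funext => m; rewrite /mon big_nil.
  by rewrite -(@normc1 R); exact: symbol_cst.
have [M1 M10 h] := @symbolM R d K 1 (size l).
exists (M1 * 1 * M); first by rewrite !mulr_ge0.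
rewrite (_ : mon (i :: l) = fun m => (m 0%R i)%:~R * mon l m); last first.
  by apply/funext => m; rewrite /mon big_cons.
by apply: h => //; exact: symbol_coord.
Qed.

Lemma mon_norm_pow_symbol K (B : R) (l : seq 'I_d) : exists2 M : R, 0 <= M & forall z,
  -1 <= complex.Re z <= B -> `|complex.Im z| <= B ->
  symbol K (size l).+1 M (fun m => mon l m * norm_pow z m).
Proof.
have [M1 M10 h1] := norm_pow_symbol K B; have [M2 M20 h2] := symbol_mon K l.
have [M3 M30 h3] := @symbolM R d K (size l) 1.
exists (M3 * M2 * M1); first by rewrite !mulr_ge0.
by move=> z zB zi; rewrite -addn1; apply: h3 => //; exact: h1.
Qed.

End norm_power.

(** * Taylor expansion along the coordinate axes *)

Section taylor.
Context {R : realType} {d : nat}.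
Local Notation V := 'rV[R]_d.
Implicit Types (f : V -> R) (x : V) (i j : 'I_d).

Definition ax j : V := delta_mx 0 j.
(** locked, lest unification unfold iterated derivatives *)
Definition pd j f : V -> R := locked ('D_(ax j) f).

Lemma pdE j f : pd j f = 'D_(ax j) f.
Proof. by rewrite /pd -lock. Qed.

Lemma partial_derivative_rcons l j f :
  partial_derivative (rcons l j) f = partial_derivative l (pd j f).
Proof. by rewrite /partial_derivative foldr_rcons pdE. Qed.

Lemma smooth_pd j f : smooth f -> smooth (pd j f).
Proof.
by move=> sf l; have := sf (rcons l j); rewrite partial_derivative_rcons.
Qed.

Lemma smooth_continuous f : smooth f -> continuous f.
Proof. by move=> sf; have [] := sf [::]. Qed.

Lemma smooth_derivable f : smooth f -> forall j x, derivable f x (ax j).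
Proof. by move=> sf j x; have [_ h] := sf [::]; exact: h. Qed.

(** one-variable derivatives along the axis lines, to which the mean value
    theorem applies *)
Definition line_deriv j f (g : V -> R) := forall x (t : R),
  is_derive t 1 (fun t => f (x + t *: ax j)) (g (x + t *: ax j)).

Lemma smooth_line_deriv f j : smooth f -> line_deriv j f (pd j f).
Proof.
move=> sf x t; have := @smooth_derivable f sf j (x + t *: ax j).
have E : (fun h : R => h^-1 *: (f (h *: ax j + (x + t *: ax j)) - f (x + t *: ax j))) =
    (fun h : R => h^-1 *: (f (x + (h *: (1 : R) + t) *: ax j) - f (x + t *: ax j))).
  apply/funext => h; congr (_ *: (f _ - _)).
  by rewrite -[h *: 1]/(h * 1) mulr1 scalerDl addrCA.
rewrite /derivable E => h; split; first exact: h.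
by rewrite pdE /derive E.
Qed.

Lemma line_deriv_MVT f g j x (t : R) : line_deriv j f g -> exists2 xi : R, `|xi| <= `|t| &
  f (x + t *: ax j) - f x = t * g (x + xi *: ax j).
Proof.
move=> fg; pose u (t : R) := f (x + t *: ax j).
have du (y : R) : is_derive y 1 u (g (x + y *: ax j)) by exact: fg.
have cu a b : {within `[a, b], continuous u}.
  by apply: derivable_within_continuous => y _; have [] := du y.
have u0 : u 0 = f x by rewrite /u scale0r addr0.
have [t0|t0] := leP 0 t.
  have [xi] := MVT_segment t0 (fun y _ => du y) (cu 0 t).
  rewrite in_itv/= => /andP[xi0 xit] E; exists xi; first by rewrite !ger0_norm.
  by rewrite -u0 -/(u t) E subr0 mulrC.
have [xi] := MVT_segment (ltW t0) (fun y _ => du y) (cu t 0).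
rewrite in_itv/= => /andP[xit xi0] E; exists xi.
  by rewrite !ler0_norm ?lerN2 ?(ltW t0).
by rewrite -u0 -/(u t) -opprB E sub0r mulrN opprK mulrC.
Qed.

Lemma line_derivB j f1 f2 g1 g2 : line_deriv j f1 g1 -> line_deriv j f2 g2 ->
  line_deriv j (fun x => f1 x - f2 x) (fun x => g1 x - g2 x).
Proof. by move=> h1 h2 x t; apply: is_derive1B; [exact: h1|exact: h2]. Qed.

Lemma line_derivD j f1 f2 g1 g2 : line_deriv j f1 g1 -> line_deriv j f2 g2 ->
  line_deriv j (fun x => f1 x + f2 x) (fun x => g1 x + g2 x).
Proof. by move=> h1 h2 x t; apply: is_derive1D; [exact: h1|exact: h2]. Qed.

Lemma line_derivM j f1 f2 g1 g2 : line_deriv j f1 g1 -> line_deriv j f2 g2 ->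
  line_deriv j (fun x => f1 x * f2 x) (fun x => g1 x * f2 x + f1 x * g2 x).
Proof. by move=> h1 h2 x t; apply: is_derive1M; [exact: h1|exact: h2]. Qed.

Lemma line_deriv_cst j (c : R) : line_deriv j (fun=> c) (fun=> 0).
Proof. by move=> x t; exact: is_derive_cst. Qed.

Lemma line_deriv_sum (T : Type) (r : seq T) j (f g : T -> V -> R) :
  (forall k : T, line_deriv j (f k) (g k)) ->
  line_deriv j (fun x => \sum_(k <- r) f k x) (fun x => \sum_(k <- r) g k x).
Proof.
move=> h; elim: r => [|k r ih].
  have E (u : T -> V -> R) : (fun x => \sum_(n <- [::]) u n x) = fun=> 0.
    by apply/funext => x; rewrite big_nil.
  by rewrite !E; exact: line_deriv_cst.
have E (u : T -> V -> R) : (fun x => \sum_(n <- k :: r) u n x) =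
    fun x => u k x + \sum_(n <- r) u n x.
  by apply/funext => x; rewrite big_cons.
by rewrite !E; apply: line_derivD ih.
Qed.

Lemma line_deriv_coord j i : line_deriv j (fun x => x 0%R i) (fun=> (i == j)%:R).
Proof.
move=> x t.
have -> : (fun t : R => (x + t *: ax j) 0%R i) = fun t => x 0%R i + t * (i == j)%:R.
  by apply/funext => s; rewrite !mxE eqxx.
have h : is_derive t 1 (fun t : R => x 0%R i + t * (i == j)%:R)
    (0 + (1 * (i == j)%:R + t * 0)) :=
  is_derive1D (is_derive_cst (x 0%R i) t 1)
    (is_derive1M (is_derive_id t (1 : R)) (is_derive_cst ((i == j)%:R : R) t 1)).
by move: h; rewrite mulr0 addr0 add0r mul1r.
Qed.

Lemma line_deriv_eq j f g g' : (forall x, g x = g' x) -> line_deriv j f g -> line_deriv j f g'.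
Proof. by move=> /funext ->. Qed.

Definition maxnorm x : R := \big[Num.max/0]_j `|x 0%R j|.

Lemma maxnorm_ge0 x : 0 <= maxnorm x.
Proof. by rewrite /maxnorm; elim/big_ind : _ => // a b a0 b0; rewrite le_max a0. Qed.

Lemma ler_maxnorm x j : `|x 0%R j| <= maxnorm x.
Proof. by rewrite /maxnorm (bigD1 j)//= le_max lexx. Qed.

Lemma maxnorm_le x (c : R) : 0 <= c -> (forall j, `|x 0%R j| <= c) -> maxnorm x <= c.
Proof.
move=> c0 h; rewrite /maxnorm; elim/big_ind : _ => // a b ac bc.
by rewrite ge_max ac bc.
Qed.

(** Symmetry of second derivatives: the mean value theorem computes the second
    difference in both orders. *)
Lemma clairaut f i j x : smooth f -> pd i (pd j f) x = pd j (pd i f) x.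
Proof.
move=> sf; apply/eqP; rewrite -subr_eq0 -normr_le0; apply/ler_addgt0Pr => e e0.
have e2 : 0 < e / 2 by rewrite divr_gt0.
have near_x (g : V -> R) : continuous g -> exists2 r : R, 0 < r & forall y,
    (forall k, `|(y - x) 0%R k| < r) -> `|g x - g y| <= e / 2.
  move=> /(_ x)/cvgrPdist_le/(_ _ e2)/nbhs_ballP[r /= r0 hr].
  exists r => // y hy; apply: hr; split => // k l; rewrite ord1 /ball/=.
  by have := hy l; rewrite !mxE distrC.
have [r1 r10 h1] := near_x _ (smooth_continuous (smooth_pd i (smooth_pd j sf))).
have [r2 r20 h2] := near_x _ (smooth_continuous (smooth_pd j (smooth_pd i sf))).
pose t := Num.min r1 r2 / 4.
have t0 : 0 < t by rewrite divr_gt0// lt_min r10.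
have close (a b r : R) k l : `|a| <= `|t| -> `|b| <= `|t| -> Num.min r1 r2 <= r ->
    forall m, `|(x + a *: ax k + b *: ax l - x) 0%R m| < r.
  move=> at' bt rr m; have -> : x + a *: ax k + b *: ax l - x = a *: ax k + b *: ax l.
    by apply/rowP => n; rewrite !mxE; ring.
  rewrite !mxE; apply: le_lt_trans (ler_normD _ _) _; rewrite !normrM.
  have D1 n : `|(((0 : 'I_1) == 0) && (m == n))%:R| <= 1 :> R.
    by case: (m == n); rewrite /= ?normr1 ?normr0.
  apply: (@le_lt_trans _ _ (`|t| + `|t|)).
    by apply: lerD; rewrite -[leRHS]mulr1; apply: ler_pM.
  by rewrite ger0_norm ?(ltW t0)// /t; apply: lt_le_trans rr; move: t0; rewrite /t; lra.
have second k l : exists a b : R, [/\ `|a| <= `|t|, `|b| <= `|t| &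
    f (x + t *: ax k + t *: ax l) - f (x + t *: ax k) - (f (x + t *: ax l) - f x) =
    t * (t * pd l (pd k f) (x + a *: ax k + b *: ax l))].
  have dg : line_deriv k (fun y => f (y + t *: ax l) - f y)
      (fun y => pd k f (y + t *: ax l) - pd k f y).
    apply: line_derivB; last exact: smooth_line_deriv.
    move=> y s; have := smooth_line_deriv k sf (y + t *: ax l) s.
    rewrite [y + _ + _]addrAC; congr is_derive; apply/funext => s'.
    by rewrite addrAC.
  have [a at' Ea] := line_deriv_MVT x t dg.
  have [b bt Eb] := line_deriv_MVT (x + a *: ax k) t (smooth_line_deriv l (smooth_pd k sf)).
  by exists a, b; split => //; rewrite -Eb -Ea.
have [a1 [b1 [a1t b1t E1]]] := second j i.
have [a2 [b2 [a2t b2t E2]]] := second i j.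
have E : pd i (pd j f) (x + a1 *: ax j + b1 *: ax i) = pd j (pd i f) (x + a2 *: ax i + b2 *: ax j).
  have tn0 : t != 0 by rewrite gt_eqF.
  apply: (mulfI tn0); apply: (mulfI tn0).
  apply: etrans (esym E1) _; apply: etrans _ E2.
  rewrite [x + t *: ax j + _]addrAC.
  by move: (f _) (f _) (f _) (f _) => c0 c1 c2 c3; ring.
have k1 := h1 _ (close _ _ r1 j i a1t b1t (ltac:(by rewrite ge_min lexx))).
have k2 := h2 _ (close _ _ r2 i j a2t b2t (ltac:(by rewrite ge_min lexx orbT))).
rewrite add0r [leRHS](splitr e).
move: k1 k2; rewrite E; move: (pd i (pd j f) x) (pd j (pd i f) x) => A B.
move: (pd j (pd i f) _) => c k1 k2.
rewrite (_ : A - B = (A - c) - (B - c)); last by ring.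
by apply: le_trans (ler_normB _ _) _; exact: lerD.
Qed.

(** The homogeneous part of degree [k] of the Taylor polynomial at the origin,
    computed by Euler's identity, a form that commutes with [pd]. *)
Fixpoint taylor_part (k : nat) f x : R :=
  if k is k'.+1 then k'.+1%:R^-1 * \sum_(i < d) x 0%R i * taylor_part k' (pd i f) x else f 0.

Lemma taylor_partS k f x : taylor_part k.+1 f x =
  k.+1%:R^-1 * \sum_(i < d) x 0%R i * taylor_part k (pd i f) x.
Proof. by []. Qed.

Lemma sum_delta j (F : 'I_d -> R) : \sum_(i < d) (i == j)%:R * F i = F j.
Proof.
rewrite (bigD1 j)//= eqxx mul1r big1 ?addr0// => i ij.
by rewrite (negbTE ij) mul0r.
Qed.

Lemma taylor_part_deriv k f j : smooth f ->
  line_deriv j (taylor_part k.+1 f) (taylor_part k (pd j f)).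
Proof.
elim: k f => [|k ih] f sf.
  apply: (@line_deriv_eq j _ _ _ _ (line_derivM (line_deriv_cst j 1%:R^-1)
    (line_deriv_sum (index_enum 'I_d) (fun i => line_derivM (line_deriv_coord j i)
      (line_deriv_cst j (pd i f 0)))))).
  move=> x; rewrite mul0r add0r big_split/= sum_delta invr1 mul1r.
  by rewrite big1 ?addr0// => i _; rewrite mulr0.
apply: (@line_deriv_eq j _ _ _ _ (line_derivM (line_deriv_cst j k.+2%:R^-1)
    (line_deriv_sum (index_enum 'I_d) (fun i => line_derivM (line_deriv_coord j i)
      (ih _ (smooth_pd i sf)))))).
move=> x; rewrite mul0r add0r big_split sum_delta.
rewrite (_ : \sum_(i < d) x 0%R i * taylor_part k (pd j (pd i f)) x =
    k.+1%:R * taylor_part k.+1 (pd j f) x); last first.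
  rewrite taylor_partS mulrA mulfV ?pnatr_eq0// mul1r.
  have C i : pd j (pd i f) = pd i (pd j f) by apply/funext => y; exact: clairaut.
  apply: eq_bigr => i _.
  rewrite (C i).
  by [].
move: (taylor_part _ _ _) => T.
by rewrite -[X in _ * (X + _)]mul1r -mulrDl nat1r mulrA mulVf ?mul1r// pnatr_eq0.
Qed.

Definition taylor_rem (M : nat) f x : R := f x - \sum_(k < M) taylor_part k f x.

Lemma taylor_rem_deriv M f j : smooth f ->
  line_deriv j (taylor_rem M f) (taylor_rem M.-1 (pd j f)).
Proof.
move=> sf; case: M => [|M] /=.
  have E g : taylor_rem 0 g = g by apply/funext => x; rewrite /taylor_rem big_ord0 subr0.
  by rewrite !E; exact: smooth_line_deriv.
have E : taylor_rem M.+1 f = fun x => f x - (f 0 + \sum_(k < M) taylor_part k.+1 f x).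
  by apply/funext => x; rewrite /taylor_rem big_ord_recl.
rewrite E; apply: (@line_deriv_eq j _ _ _ _ (line_derivB (smooth_line_deriv j sf)
  (line_derivD (line_deriv_cst j (f 0)) (line_deriv_sum (index_enum 'I_M)
    (fun k : 'I_M => taylor_part_deriv k j sf))))).
by move=> x; rewrite add0r.
Qed.

Lemma taylor_rem_at0 M f : taylor_rem M.+1 f 0 = 0.
Proof.
rewrite /taylor_rem big_ord_recl /= big1 ?addr0 ?subrr// => k _.
by rewrite big1 ?mulr0// => i _; rewrite mxE mul0r.
Qed.

Definition bounded_derivs f := smooth f /\
  forall l, exists C : R, forall x, `|partial_derivative l f x| <= C.

Lemma bounded_derivs_pd j f : bounded_derivs f -> bounded_derivs (pd j f).
Proof.
move=> [sf bf]; split; first exact: smooth_pd.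
move=> l; have [C hC] := bf (rcons l j); exists C => x.
by rewrite -partial_derivative_rcons.
Qed.

(** On the path from the origin to [x] that moves one coordinate after the other,
    the mean value theorem reduces the remainder to those of the partial
    derivatives, at one order less. *)
Lemma taylor_rem_bound M f : bounded_derivs f -> exists2 C : R, 0 <= C &
  forall x, `|taylor_rem M f x| <= C * maxnorm x ^+ M.
Proof.
elim: M f => [|M ih] f bf.
  have [_ /(_ [::])[C hC]] := bf; exists `|C| => // x.
  rewrite /taylor_rem big_ord0 subr0 expr0 mulr1.
  by apply: le_trans (hC x) _; exact: ler_norm.
have hpd j : exists C : R, 0 <= C /\
    forall x, `|taylor_rem M (pd j f) x| <= C * maxnorm x ^+ M.
  by have [C] := ih _ (bounded_derivs_pd j bf); exists C.
have [C hC] := choice hpd; pose S := \sum_j C j.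
have S0 : 0 <= S by apply: sumr_ge0 => j _; case: (hC j).
have CS j : C j <= S by rewrite /S (bigD1 j)//= lerDl sumr_ge0// => i _; case: (hC i).
exists (d%:R * S); first by rewrite mulr_ge0.
move=> x; set N := maxnorm x; have N0 : 0 <= N by exact: maxnorm_ge0.
pose y (n : nat) : V := \row_j (if (j < n)%N then x 0%R j else 0).
have yx : y d = x by apply/rowP => j; rewrite mxE ltn_ord.
have y0 : y 0%N = 0 by apply/rowP => j; rewrite !mxE.
suff H n : (n <= d)%N -> `|taylor_rem M.+1 f (y n)| <= n%:R * S * N ^+ M.+1.
  by have := H d (leqnn d); rewrite yx.
elim: n => [|n ihn] nd; first by rewrite y0 taylor_rem_at0 normr0 !mul0r.
pose j := Ordinal nd.
have yS : y n.+1 = y n + x 0%R j *: ax j.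
  apply/rowP => i; rewrite !mxE eqxx/= ltnS leq_eqVlt.
  have -> : (i == j) = (val i == n) by [].
  case: eqP => [E|] /=; last by rewrite mulr0 addr0.
  by rewrite E ltnn mulr1 add0r; congr (x _ _); apply: val_inj.
have [xi hxi E] := line_deriv_MVT (y n) (x 0%R j) (taylor_rem_deriv M.+1 j (proj1 bf)).
rewrite yS -(subrK (taylor_rem M.+1 f (y n)) (taylor_rem M.+1 f _)) E.
apply: le_trans (ler_normD _ _) _; rewrite addrC.
apply: le_trans (lerD (ihn (ltnW nd)) (lexx _)) _.
rewrite -natr1 !mulrDl mul1r lerD2l normrM exprS mulrCA.
apply: ler_pM => //; first exact: ler_maxnorm.
have [_ /(_ (y n + xi *: ax j))] := hC j => /le_trans; apply.
apply: ler_pM => //; first by case: (hC j).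
  by rewrite exprn_ge0 ?maxnorm_ge0.
rewrite lerXn2r ?nnegrE ?maxnorm_ge0//; apply: maxnorm_le => // i.
rewrite !mxE eqxx/=; have [E'|ij] := eqVneq i j.
  rewrite E' /= ltnn add0r mulr1; apply: le_trans hxi _; exact: ler_maxnorm.
rewrite mulr0 addr0; case: ifP => _; last by rewrite normr0.
exact: ler_maxnorm.
Qed.

(** words of coordinates, to match the lattice monomials [mon] *)
Definition hom_poly (k : nat) (P : V -> R) := exists s : seq (R * seq 'I_d),
  (forall cl, cl \in s -> size cl.2 = k) /\
  forall x, P x = \sum_(cl <- s) cl.1 * \prod_(i <- cl.2) x 0%R i.

Lemma hom_poly_sum (T : Type) (r : seq T) k (P : T -> V -> R) :
  (forall n : T, hom_poly k (P n)) -> hom_poly k (fun x => \sum_(n <- r) P n x).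
Proof.
move=> h; elim: r => [|n r [s [s1 s2]]].
  by exists [::]; split => // x; rewrite !big_nil.
have [s' [s'1 s'2]] := h n; exists (s' ++ s); split.
  by move=> cl; rewrite mem_cat => /orP[/s'1|/s1].
by move=> x; rewrite big_cons big_cat/= s2 s'2.
Qed.

Lemma hom_poly_coord k (c : R) i P : hom_poly k P -> hom_poly k.+1 (fun x => c * (x 0%R i * P x)).
Proof.
move=> [s [s1 s2]]; exists [seq (c * cl.1, i :: cl.2) | cl <- s]; split.
  by move=> _ /mapP[cl /s1 <- ->].
move=> x; rewrite s2 big_map !mulr_sumr; apply: eq_bigr => cl _.
by rewrite big_cons/=; ring.
Qed.

Lemma taylor_part_hom k f : hom_poly k (taylor_part k f).
Proof.
elim: k f => [|k ih] f.
  exists [:: (f 0, [::])]; split; first by move=> cl; rewrite inE => /eqP ->.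
  by move=> x; rewrite big_seq1 big_nil mulr1.
have -> : taylor_part k.+1 f =
    fun x => \sum_(i < d) k.+1%:R^-1 * (x 0%R i * taylor_part k (pd i f) x).
  by apply/funext => x; rewrite /= mulr_sumr.
by apply: hom_poly_sum => i; exact: hom_poly_coord.
Qed.

End taylor.

(** * The scaled Taylor remainder as a symbol *)

Section vanishing.
Context {R : realType} {d : nat}.
Local Notation V := 'rV[R]_d.
Implicit Types (f : V -> R) (x : V) (i j : 'I_d).

Definition vanishes_outside (a : R) f := forall x j, a < `|x 0%R j| -> f x = 0.

Lemma near_outside (a : R) x j : a < `|x 0%R j| -> nbhs x [set y : V | a < `|y 0%R j|].
Proof.
move=> h; apply/nbhs_ballP; exists (`|x 0%R j| - a) => /=; first by rewrite subr_gt0.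
move=> y [_ /(_ 0 j)]; rewrite /ball/= => hy.
have := ler_normD (x 0%R j - y 0%R j) (y 0%R j); rewrite subrK /= => h1.
by move: h hy h1; clear; move: `|_| `|_| `|_| => b c e; lra.
Qed.

Lemma vanishes_outside_pd a f j : vanishes_outside a f -> vanishes_outside a (pd j f).
Proof.
move=> vf x j0 h; rewrite pdE (@near_eq_derive _ _ _ f (fun=> 0)) ?derive_cst//.
by near=> y; apply: (vf y j0); near: y; exact: near_outside.
Unshelve. all: by end_near.
Qed.

Lemma vanishes_outside_boundary a f x j : continuous f -> vanishes_outside a f ->
  a <= `|x 0%R j| -> f x = 0.
Proof.
move=> cf vf ax'; apply/eqP; rewrite -normr_le0; apply/ler_addgt0Pr => e e0; rewrite add0r.
move: (cf x) => /cvgrPdist_le/(_ _ e0)/nbhs_ballP[r /= r0 hr].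
have [v v1 hv] : exists2 v : R, `|v| <= r / 2 & a < `|x 0%R j + v|.
  have [x0|x0] := leP 0 (x 0%R j).
    exists (r / 2); first by rewrite ger0_norm ?divr_ge0 ?(ltW r0).
    by rewrite ger0_norm ?addr_ge0 ?divr_ge0 ?(ltW r0)//; move: ax'; rewrite ger0_norm//; lra.
  exists (- (r / 2)); first by rewrite normrN ger0_norm ?divr_ge0 ?(ltW r0).
  by rewrite ltr0_norm; move: ax'; rewrite ltr0_norm//; lra.
have /hr : ball x r (x + v *: ax j).
  split => // k l; rewrite ord1 /ball/= !mxE opprD addrA subrr add0r normrN eqxx/= normrM.
  apply: (@le_lt_trans _ _ (r / 2 * 1)); last by lra.
  by apply: ler_pM => //; case: (l == j); rewrite ?normr1 ?normr0.
by rewrite (vf (x + v *: ax j) j) ?subr0// !mxE !eqxx mulr1.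
Qed.

Lemma vanishes_outside_bounded a f : continuous f -> vanishes_outside a f ->
  exists C : R, forall x, `|f x| <= C.
Proof.
move=> cf vf.
have cK : compact [set x : V | forall j, `[- a, a]%classic (x 0%R j)].
  by apply: (@rV_compact _ _ (fun=> `[- a, a]%classic)) => j; exact: segment_compact.
have cg : continuous (fun x => `|f x|).
  by move=> x; apply: (@continuous_comp _ _ _ f Num.norm); [exact: cf|exact: norm_continuous].
have [K0|] := pselect ([set x : V | forall j, `[- a, a]%classic (x 0%R j)] !=set0); last first.
  move=> K0; exists 0 => x; rewrite normr_le0; apply/eqP.
  have [j hj] : exists j, a < `|x 0%R j|.
    apply: contrapT => h; apply: K0; exists x => j /=.
    rewrite in_itv/= -ler_norml leNgt; apply/negP => hj; apply: h; by exists j.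
  exact: vf hj.
have [c _ hc] := @EVT_max_rV R d (fun x => `|f x|) _ K0 cK (continuous_subspaceT cg).
exists `|f c| => x.
have [[j hj]|h] := pselect (exists j, a < `|x 0%R j|); first by rewrite (vf x j hj) normr0.
apply: hc; apply/mem_set => j /=; rewrite in_itv/= -ler_norml leNgt; apply/negP => hj.
by apply: h; exists j.
Qed.

Lemma vanishes_outside_bounded_derivs a f : smooth f -> vanishes_outside a f -> bounded_derivs f.
Proof.
move=> sf vf; split => // l; have [cl _] := sf l.
apply: (@vanishes_outside_bounded a) => //.
elim: l {cl} => [|j l ih] //=; have := vanishes_outside_pd j ih.
by rewrite pdE.
Qed.

Lemma maxnorm_grid (eta : R) m j (x : R) : 0 <= eta -> 0 <= x ->
  maxnorm (grid_point eta m + (x * eta) *: ax j) <= eta * (bracket m + x).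
Proof.
move=> e0 x0; apply: maxnorm_le.
  by rewrite mulr_ge0// addr_ge0// bracket_ge0.
move=> i; rewrite !mxE eqxx/=; apply: le_trans (ler_normD _ _) _.
rewrite mulrDr; apply: lerD.
  rewrite normrM (ger0_norm e0) mulrC ler_wpM2l// -intr_norm -natr_absz.
  by apply: (@le_trans _ _ (norm_inf (absv m))%:R); rewrite ?ler_nat ?leq_norm_inf// lerDr.
rewrite !normrM (ger0_norm e0) (ger0_norm x0) [eta * x]mulrC -[leRHS]mulr1.
apply: ler_wpM2l; first by rewrite mulr_ge0.
by case: (i == j); rewrite ?normr1 ?normr0.
Qed.

Lemma bracket_grid (eta : R) m j (x : R) : (0 < d)%N -> 0 <= eta -> 0 <= x ->
  eta * bracket m <= maxnorm (grid_point eta m + (x * eta) *: ax j) + eta * (1 + x).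
Proof.
move=> d0 e0 x0; rewrite /bracket !mulrDr mulr1 addrCA lerD2l.
have [i ->] : exists i : 'I_d, norm_inf (absv m) = `|m 0%R i|%N.
  have [i E] := @bigop.eq_bigmax 'I_d (fun j => absv m ord0 j) (ltac:(by rewrite card_ord)).
  by exists i; rewrite /norm_inf E mxE (ord1 ord0).
have := ler_maxnorm (grid_point eta m + (x * eta) *: ax j) i.
rewrite !mxE eqxx/= => h.
have := ler_normD ((m 0%R i)%:~R * eta + x * eta * (i == j)%:R) (- (x * eta * (i == j)%:R)).
rewrite addrK normrN normrM (ger0_norm e0) -intr_norm -natr_absz mulrC => /le_trans; apply.
apply: lerD => //; rewrite !normrM (ger0_norm e0) (ger0_norm x0) [eta * x]mulrC -[leRHS]mulr1.
apply: ler_wpM2l; first by rewrite mulr_ge0.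
by case: (i == j); rewrite ?normr1 ?normr0.
Qed.

Lemma iter_fdiff_MVT (u : nat -> R -> R) k (t : R) :
  (forall n y, is_derive (y : R) 1 (u n) (u n.+1 y)) ->
  exists2 xi, t <= xi <= t + k%:R & iter k fdiff (u 0%N) t = u k xi.
Proof.
move=> h; suff H n s : exists2 xi, s <= xi <= s + k%:R & iter k fdiff (u n) s = u (n + k)%N xi.
  by have [xi ? ?] := H 0%N t; exists xi.
elim: k n s => [|k ih] n s.
  by exists s; rewrite ?addr0 ?lexx// addn0.
have [xi /andP[x1 x2] ->] := @fdiff_MVT R (u n) (u n.+1) k s (fun y _ => h n y).
have [xi' /andP[x3 x4] ->] := ih n.+1 xi; exists xi'; last by rewrite addSnnS.
by rewrite (le_trans x1 x3)/= (le_trans x4)// -nat1r addrA lerD2r.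
Qed.

Lemma iter_diff_real j k (r : 'rV[int]_d -> R) :
  exists r', iter k (diff j) (fun m => (r m)%:C) = fun m => (r' m)%:C.
Proof.
elim: k => [|k [r' ih]]; first by exists r.
exists (fun m => r' (m + unit_vec j) - r' m); apply/funext => m.
by rewrite iterS ih /diff rmorphB.
Qed.

(** The [k]-th difference along an axis is [eta ^ k] times the [k]-th derivative at
    a nearby point [y], that is the remainder of order [M - k] of a derivative of
    [f], bounded by |y| ^ (M - k). For [k > M] the derivative is merely bounded, but
    it vanishes unless |y| <= a, where [eta * bracket m] is bounded. *)
Lemma taylor_rem_symbol a M K f : (0 < d)%N -> smooth f -> vanishes_outside a f ->
  exists2 C : R, 0 <= C & forall eta, 0 < eta <= a ->
    symbol K M C (fun m => ((eta ^+ M)^-1 * taylor_rem M f (grid_point eta m))%:C).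
Proof.
move=> d0 sf vf.
have sk k j : smooth (iter k (pd j) f) by elim: k => [|k ih]; [exact: sf|rewrite iterS; exact: smooth_pd].
have vk k j : vanishes_outside a (iter k (pd j) f).
  by elim: k => [|k ih]; [exact: vf|rewrite iterS; exact: vanishes_outside_pd].
have hc (jk : 'I_d * 'I_K.+1) : exists c : R, 0 <= c /\ forall x,
    `|taylor_rem (M - jk.2) (iter jk.2 (pd jk.1) f) x| <= c * maxnorm x ^+ (M - jk.2).
  have [c c0 h] := taylor_rem_bound (M - jk.2)
    (vanishes_outside_bounded_derivs (sk jk.2 jk.1) (@vk jk.2 jk.1)).
  by exists c.
have {hc}[c hc] := choice hc.
pose S := \sum_jk c jk.
have S0 : 0 <= S by apply: sumr_ge0 => jk _; case: (hc jk).
have cS jk : c jk <= S by rewrite /S (bigD1 jk)//= lerDl sumr_ge0// => jk' _; case: (hc jk').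
exists (S * ((1 + K%:R) ^+ M + (1 + (K%:R + 2) * `|a|) ^+ K)).
  by rewrite mulr_ge0// addr_ge0 ?exprn_ge0 ?addr_ge0 ?mulr_ge0 ?addr_ge0.
move=> eta /andP[e0 ea] j k m kK; rewrite addn0.
have a0 : 0 < a by exact: lt_le_trans ea.
pose u (n : nat) (y : R) := eta ^+ n / eta ^+ M *
  taylor_rem (M - n) (iter n (pd j) f) (grid_point eta m + (y * eta) *: ax j).
have en0 : eta != 0 by rewrite gt_eqF.
have du (n : nat) (y : R) : is_derive y 1 (u n) (u n.+1 y).
  have dl : is_derive y (1 : R) (fun y => y * eta) eta.
    have h := is_derive1M (is_derive_id y (1 : R)) (is_derive_cst (eta : R) y 1).
    by move: h; rewrite mulr0 addr0 mul1r.
  have h1 := taylor_rem_deriv (M - n) j (sk n j) (grid_point eta m) (y * eta).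
  have h2 := is_derive1M (is_derive_cst (eta ^+ n / eta ^+ M : R) y 1)
    (@is_derive1_comp R (fun t => taylor_rem (M - n) (iter n (pd j) f)
      (grid_point eta m + t *: ax j)) (fun y => y * eta) y _ _ h1 dl).
  apply: (@is_derive_eq _ _ _ (u n) y 1 _ _ h2).
  by rewrite mul0r add0r /u /= subnS exprSr; ring.
have -> : normc (iter k (diff j) (fun m => ((eta ^+ M)^-1 *
    taylor_rem M f (grid_point eta m))%:C) m) = `|iter k fdiff (u 0%N) 0|.
  rewrite -(@iter_diff_line R d (@complex.Re R) j k m (fun m => ((eta ^+ M)^-1 *
    taylor_rem M f (grid_point eta m))%:C) (u 0%N) 0).
  - have [r ->] := iter_diff_real j k (fun m => (eta ^+ M)^-1 * taylor_rem M f (grid_point eta m)).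
    by rewrite normc_real.
  - by move=> x y; rewrite ReD ReN.
  move=> n nk; rewrite /u expr0 mul1r subn0 add0r /=; congr (_ * taylor_rem M f _).
  apply/rowP => i; rewrite !mxE mulmxnE unit_vecE eqxx andTb.
  rewrite rmorphD rmorphMn mulrDl; congr (_ + _); case: (i == j); last by rewrite !mulr0 mul0rn mul0r.
  by rewrite mulr1.
have [xi /andP[xi0 xik] ->] := iter_fdiff_MVT k 0 du.
rewrite add0r in xik.
have xiK : xi <= K%:R by apply: le_trans xik _; rewrite ler_nat.
have b1 : 1 <= bracket m :> R by exact: bracket_ge1.
have b0 : 0 <= bracket m :> R by exact: bracket_ge0.
have [_ /(_ (grid_point eta m + (xi * eta) *: ax j)) hr] := hc (j, Ordinal (kK : (k < K.+1)%N)).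
have hj := cS (j, Ordinal (kK : (k < K.+1)%N)).
move: hr hj; have [+ _] := hc (j, Ordinal (kK : (k < K.+1)%N)).
move: (c _) => c1 /= c10 hr hj.
rewrite /u normrM (ger0_norm (_ : 0 <= eta ^+ k / eta ^+ M)); last first.
  by rewrite mulr_ge0 ?invr_ge0 ?exprn_ge0 ?(ltW e0).
set T := taylor_rem _ _ _ in hr *; set N := maxnorm _ in hr.
have [kM|Mk] := leqP k M.
  have N1 : N <= eta * ((1 + K%:R) * bracket m).
    apply: le_trans (maxnorm_grid m j (ltW e0) xi0) _; rewrite ler_wpM2l ?(ltW e0)//.
    rewrite mulrDl mul1r lerD2l; apply: le_trans xiK _; by rewrite ler_peMr.
  apply: (@le_trans _ _ (eta ^+ k / eta ^+ M * (c1 * (eta * ((1 + K%:R) * bracket m)) ^+ (M - k))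
      * bracket m ^+ k)).
    rewrite ler_wpM2r ?exprn_ge0// ler_wpM2l ?mulr_ge0 ?invr_ge0 ?exprn_ge0 ?(ltW e0)//.
    apply: le_trans hr _; rewrite ler_wpM2l// lerXn2r ?nnegrE ?maxnorm_ge0//.
    by rewrite !mulr_ge0 ?(ltW e0) ?addr_ge0.
  have -> : eta ^+ k / eta ^+ M * (c1 * (eta * ((1 + K%:R) * bracket m)) ^+ (M - k))
      * bracket m ^+ k = c1 * (1 + K%:R) ^+ (M - k) * bracket m ^+ M.
    have E (x : R) : x ^+ M = x ^+ (M - k) * x ^+ k by rewrite -exprD subnK.
    rewrite (E eta) (E (bracket m)) !exprMn; field.
    by rewrite !expf_neq0.
  rewrite ler_wpM2r ?exprn_ge0//; apply: ler_pM => //.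
  apply: (@le_trans _ _ ((1 + K%:R) ^+ M)); last first.
    by rewrite lerDl exprn_ge0 ?addr_ge0 ?mulr_ge0 ?addr_ge0.
  by rewrite ler_weXn2l ?lerDl ?leq_subr.
have [aN|Na] := ltP a N.
  have /eqP : T = 0.
    have [i hi] : exists i, a < `|(grid_point eta m + (xi * eta) *: ax j) 0%R i|.
      apply: contrapT => h; move: aN; rewrite ltNge => /negP; apply.
      apply: maxnorm_le => [|i]; first exact: ltW.
      by rewrite leNgt; apply/negP => hi; apply: h; exists i.
    rewrite /T (_ : (M - k)%N = 0%N); last by apply/eqP; rewrite subn_eq0 ltnW.
    by rewrite /taylor_rem big_ord0 subr0 (vk k j _ i hi).
  move=> /eqP ->; rewrite normr0 mulr0 mul0r.
  by rewrite !mulr_ge0 ?addr_ge0 ?exprn_ge0 ?addr_ge0 ?mulr_ge0 ?addr_ge0.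
have eb : eta * bracket m <= 1 + (K%:R + 2) * `|a|.
  apply: le_trans (bracket_grid m j d0 (ltW e0) xi0) _.
  apply: (@le_trans _ _ (a + a * (1 + K%:R))).
    by apply: lerD => //; apply: ler_pM; rewrite ?(ltW e0) ?addr_ge0// lerD2l.
  rewrite ger0_norm ?(ltW a0)//.
  by rewrite (_ : a + a * (1 + K%:R) = (K%:R + 2) * a) ?lerDr//; ring.
apply: (@le_trans _ _ (c1 * (eta * bracket m) ^+ (k - M) * bracket m ^+ M)).
  have -> : c1 * (eta * bracket m) ^+ (k - M) * bracket m ^+ M =
      eta ^+ k / eta ^+ M * c1 * bracket m ^+ k.
    have E (x : R) : x ^+ k = x ^+ (k - M) * x ^+ M by rewrite -exprD subnK// ltnW.
    rewrite (E eta) (E (bracket m)) !exprMn; field.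
    by rewrite !expf_neq0.
  rewrite ler_wpM2r ?exprn_ge0// ler_wpM2l ?mulr_ge0 ?invr_ge0 ?exprn_ge0 ?(ltW e0)//.
  by move: hr; rewrite (_ : (M - k)%N = 0%N) ?expr0 ?mulr1//; apply/eqP; rewrite subn_eq0 ltnW.
rewrite ler_wpM2r ?exprn_ge0//; apply: ler_pM => //.
  by rewrite exprn_ge0 ?mulr_ge0 ?(ltW e0).
apply: (@le_trans _ _ ((1 + (K%:R + 2) * `|a|) ^+ (k - M))).
  rewrite lerXn2r ?nnegrE ?mulr_ge0 ?(ltW e0)// addr_ge0 ?mulr_ge0 ?addr_ge0//.
rewrite -[leLHS]add0r; apply: lerD; first by rewrite exprn_ge0 ?addr_ge0.
rewrite ler_weXn2l ?lerDl ?mulr_ge0 ?addr_ge0//.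
by rewrite (leq_trans (leq_subr _ _)).
Qed.

End vanishing.

(** * Regularized lattice sums and the zeta functions *)

Section regularized_zeta.
Context {R : realType} {d : nat}.
Local Notation C := R[i].
Local Notation L := 'rV[int]_d.
Implicit Types (m : L) (f g : L -> C) (i j : 'I_d) (l : seq 'I_d).

Definition mon_pow l z m : C := mon l m * norm_pow z m.

Lemma has_sum_regularize_mon_pow K l z : ((size l).+1 + 2 * d <= K)%N ->
  -1 <= complex.Re z -> exists V, has_sum (regularize K (mon_pow l z)) V.
Proof.
move=> lK z1; have [M M0 hM] := @mon_norm_pow_symbol R d K (normc z) l.
have zB : complex.Re z <= normc z by apply: le_trans (ler_norm _) (ler_normc_Re z).
have hs := hM z (ltac:(by rewrite z1)) (ler_normc_Im z).
apply: (has_sum_dominated weight_ge0 _ weight_sum (regularize_symbol M0 lK hs)).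
by rewrite mulr_ge0.
Qed.

Lemma cdiff_iter_diff j k m (f : C -> L -> C) z : (forall n, cdiff (fun z => f z n) z) ->
  cdiff (fun z => iter k (diff j) (f z) m) z.
Proof.
move=> df; elim: k m => [|k ih] m; first exact: df.
by rewrite /=; apply: cdiffB.
Qed.

Lemma cdiff_regularize K m (f : C -> L -> C) z : (forall n, cdiff (fun z => f z n) z) ->
  cdiff (fun z => regularize K (f z) m) z.
Proof.
move=> df; rewrite /regularize.
under eq_fun do rewrite -big_filter.
apply: cdiff_sum => S /=.
apply: cdiffM; first exact: cdiff_cst.
apply: cdiffM; first exact: cdiff_cst.
by case: pickP => [j _|_]; [exact: cdiff_iter_diff|exact: cdiff_cst].
Qed.

Lemma cdiff_comp_opp (F : C -> C) z : (forall z, cdiff F z) -> cdiff (fun z => F (- z)) z.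
Proof.
move=> dF; have [l hl] := dF (- z); exists (- l) => e e0.
have [r r0 hr] := hl e e0; exists r => // h hh.
have := hr (- h); rewrite normc_opp => /(_ hh).
by rewrite mulrN mulNr -opprD.
Qed.

Lemma cdiff_mon_pow l m z : cdiff (fun z => mon_pow l z m) z.
Proof.
apply: cdiffM; first exact: cdiff_cst.
rewrite /norm_pow; case: eqVneq => [_|m0]; first exact: cdiff_cst.
apply: cdiff_comp_opp => y; apply: cdiff_cpow.
by rewrite sqrtr_gt0; exact: lt_le_trans (sqnorm_ge1 m0).
Qed.

Lemma cpowM (x y : R) z : 0 < x -> 0 < y -> cpow (x * y) z = cpow x z * cpow y z.
Proof.
move=> x0 y0; rewrite /cpow powRM ?(ltW x0) ?(ltW y0)// lnM ?posrE//.
rewrite mulrDr cosD sinD rmorphM/=; simpc; congr (_ +i* _); ring.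
Qed.

Lemma cpow2_nat n : cpow 2 n%:R = 2 ^+ n :> C.
Proof.
rewrite (_ : n%:R = (n%:R)%:C :> C); last by rewrite rmorph_nat.
by rewrite cpow_real powR_mulrn// rmorphXn/= rmorph_nat.
Qed.

Lemma mon_nonneg_bound l m : normc (mon l m : C) <= bracket m ^+ size l.
Proof.
elim: l => [|j l ih]; first by rewrite /mon big_nil normc1.
rewrite /mon big_cons -/(mon l m) normcM exprS; apply: ler_pM; rewrite ?normc_ge0//.
rewrite -[_%:~R](rmorph_int (@real_complex_def R (Phant R))) normc_real.
rewrite -intr_norm -natr_absz (le_trans _ (_ : (norm_inf (absv m))%:R <= _))//.
  by rewrite ler_nat leq_norm_inf.
by rewrite lerDr.
Qed.

(** for a real part this large the series converges absolutely *)
Lemma mon_pow_weight l z : ((size l + 2 * d).+1)%:R <= complex.Re z -> forall m,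
  normc (mon_pow l z m) <= 2 `^ complex.Re z * weight m.
Proof.
move=> hz m; rewrite /mon_pow /norm_pow; case: eqVneq => [_|m0].
  by rewrite mulr0 normc0 mulr_ge0 ?powR_ge0 ?weight_ge0.
rewrite normcM normc_cpow.
have b0 : 0 < bracket m :> R by exact: bracket_gt0.
have sq0 : 0 < Num.sqrt (sqnorm m) :> R by rewrite sqrtr_gt0; exact: lt_le_trans (sqnorm_ge1 m0).
have sqb : bracket m / 2 <= Num.sqrt (sqnorm m) :> R.
  apply: (@le_trans _ _ (norm_inf (absv m))%:R).
    have : 1 <= (norm_inf (absv m))%:R :> R by rewrite ler1n lt0n norm_inf_eq0.
    by rewrite /bracket; lra.
  by rewrite -(ger0_norm (ler0n R (norm_inf (absv m)))) -sqrtr_sqr ler_wsqrtr// sqnorm_ge_inf.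
have z0 : 0 <= complex.Re z by apply: le_trans hz.
apply: (@le_trans _ _ (bracket m ^+ size l * (2 `^ complex.Re z * bracket m `^ (- complex.Re z)))).
  apply: ler_pM; rewrite ?normc_ge0 ?powR_ge0 ?mon_nonneg_bound//= powRN.
  apply: (@le_trans _ _ ((bracket m / 2) `^ complex.Re z)^-1).
    rewrite ReN powRN lef_pV2 ?posrE ?powR_gt0 ?divr_gt0//.
    by rewrite ge0_ler_powR ?nnegrE// ?divr_ge0 ?(ltW b0)// ltW.
  rewrite powRM ?(ltW b0)// invfM -powRN mulrC; apply: ler_wpM2r; first exact: powR_ge0.
  by rewrite -powRN -powR_inv1// -powRrM mulN1r opprK.
rewrite mulrCA ler_wpM2l ?powR_ge0//; apply: le_trans (bracket_weight m).
rewrite -powR_mulrn ?(ltW b0)// -powRD; last by rewrite (gt_eqF b0) implybT.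
rewrite -powR_mulrn ?(ltW b0)// -powRN.
apply: ler_powR; first exact: bracket_ge1.
by move: hz; rewrite -addn1 !natrD; lra.
Qed.

Lemma mon_double l m : mon l (m *+ 2) = 2 ^+ size l * mon l m :> C.
Proof.
elim: l => [|j l ih]; first by rewrite /mon !big_nil mulr1.
rewrite /mon !big_cons -!/(mon l _) ih mulmxnE rmorphMn exprS -mulr_natl /=; ring.
Qed.

Lemma norm_pow_double z m : norm_pow z (m *+ 2) = cpow 2 (- z) * norm_pow z m :> C.
Proof.
have E : (m *+ 2 == 0) = (m == 0).
  apply/eqP/eqP => [h|->]; last by rewrite mul0rn.
  apply/rowP => j; move/rowP/(_ j): h; rewrite mulmxnE !mxE.
  by move/eqP; rewrite mulrn_eq0 /= => /eqP.
rewrite /norm_pow E; case: eqVneq => [_|m0]; first by rewrite mulr0.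
have sq0 : 0 < Num.sqrt (sqnorm m) :> R by rewrite sqrtr_gt0; exact: lt_le_trans (sqnorm_ge1 m0).
rewrite -cpowM//; congr cpow.
have -> : sqnorm (m *+ 2) = 2 ^+ 2 * sqnorm m :> R.
  rewrite /sqnorm mulr_sumr; apply: eq_bigr => j _.
  by rewrite mulmxnE rmorphMn -mulr_natl exprMn.
by rewrite sqrtrM ?sqr_ge0// sqrtr_sqr ger0_norm.
Qed.

(** The parity weight is 2 ^ d times the indicator of the even sublattice, minus
    one. *)
Lemma has_sum_parity_weight f V W : has_sum f V -> has_sum (fun m => f (m *+ 2)) W ->
  has_sum (fun m => parity_weight m * f m) (2 ^+ d * W - V).
Proof.
move=> hV hW; pose h m : L := m *+ 2.
pose g m : L := map_mx (fun x => divz x 2) m.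
have hK : cancel h g.
  by move=> m; apply/rowP => j; rewrite mxE mulmxnE -(mulr_natr (m 0%R j)) mulzK.
pose ev m := [forall j, ~~ odd `|m 0%R j|%N].
have hE : has_sum (fun m => (if ev m then 2 ^+ d else 0) * f m) (2 ^+ d * W).
  apply: (has_sum_reindex hK) => [m|].
    rewrite /ev; case: ifPn => [/forallP hm _|_]; last by rewrite mul0r eqxx.
    apply/rowP => j; have := hm j; rewrite mulmxnE mxE -(mulr_natr (m 0%R j %/ 2)%Z).
    by move=> ej; rewrite divzK// dvdzE dvdn2.
  have := has_sumZ (2 ^+ d) hW; congr has_sum.
  apply/funext => m /=; rewrite (_ : ev (h m))//.
  by apply/forallP => j; rewrite /h mulmxnE -(mulr_natr (m 0%R j)); lia.
have := has_sumD hE (has_sumZ (-1) hV); rewrite mulN1r.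
by congr has_sum; apply/funext => m; rewrite parity_weightE mulrBl mul1r mulN1r.
Qed.

Lemma has_sum_parity_mon_pow l z V : has_sum (mon_pow l z) V ->
  has_sum (fun m => parity_weight m * mon_pow l z m) ((cpow 2 ((d + size l)%:R - z) - 1) * V).
Proof.
move=> hV; have h : has_sum (fun m => mon_pow l z (m *+ 2)) (2 ^+ size l * cpow 2 (- z) * V).
  have := has_sumZ (2 ^+ size l * cpow 2 (- z)) hV; congr has_sum; apply/funext => m.
  by rewrite /mon_pow mon_double norm_pow_double; ring.
have := has_sum_parity_weight hV h; congr has_sum.
by rewrite cpowD// cpow2_nat exprD; ring.
Qed.

Lemma cdiff_cpow_sub (x : R) (c z : C) : 0 < x -> cdiff (fun z => cpow x (c - z)) z.
Proof.
move=> x0; under eq_fun do rewrite cpowD//.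
apply: cdiffM; first exact: cdiff_cst.
by apply: cdiff_comp_opp => y; exact: cdiff_cpow.
Qed.

(** Both sides are holomorphic in the exponent and agree where the series
    converges absolutely. *)
Lemma regularized_continuation K l (zeta g : C -> C) (z0 : C) k (s X : R) V :
  ((size l).+1 + 2 * d <= K)%N -> 0 < s -> entire g ->
  (forall z, X < complex.Re z -> has_sum (mon_pow l z) (zeta z)) ->
  (forall z, X < complex.Re z -> g z = (z - z0) ^+ k * zeta z) ->
  has_sum (regularize K (mon_pow l s%:C)) V ->
  (s%:C - z0) ^+ k * V = (cpow 2 ((d + size l)%:R - s%:C) - 1) * g s%:C.
Proof.
move=> lK s0 eg hzeta hg hV.
have [lam hlam] : exists lam : C -> C, forall z, -1 <= complex.Re z ->
    has_sum (regularize K (mon_pow l z)) (lam z).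
  have h (z : C) : exists v, -1 <= complex.Re z -> has_sum (regularize K (mon_pow l z)) v.
    have [z1|z1] := leP (-1) (complex.Re z); last by exists 0.
    by have [v hv] := has_sum_regularize_mon_pow lK z1; exists v.
  by have [lam hlam] := choice h; exists lam.
have [J hJ] : exists J : nat -> {fset L}, forall n, tail_le (@weight R d) (J n) n.+1%:R^-1.
  have h (n : nat) : exists v, tail_le (@weight R d) v n.+1%:R^-1.
    by apply: (bounded_tail weight_ge0 weight_sum); rewrite invr_gt0.
  by have [J hJ] := choice h; exists J.
pose tw (z : C) : C := cpow 2 ((d + size l)%:R - z) - 1.
pose F (z : C) := (z - z0) ^+ k * lam z - tw z * g z.
pose Fn n (z : C) := (z - z0) ^+ k * (\sum_(m <- J n) regularize K (mon_pow l z) m) - tw z * g z.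
pose x0 := Num.max (s + 1) (Num.max (X + 1) (size l + 2 * d).+1%:R).
suff F0 : F s%:C = 0.
  have E : lam s%:C = V.
    by apply: has_sum_unique hV; apply: hlam => /=; apply: le_trans (ltW s0); rewrite lerN10.
  by move/eqP: F0; rewrite /F E subr_eq0 => /eqP.
apply: (@identity_limit R Fn F s x0).
- by rewrite lt_max ltrDl ltr01.
- move=> n z _; apply: cdiffB.
    apply: cdiffM.
      by apply: cdiffX; apply: cdiffB; [exact: cdiff_id|exact: cdiff_cst].
    apply: cdiff_sum => m; apply: cdiff_regularize => m'; exact: cdiff_mon_pow.
  apply: cdiffM; last by apply/cdiffP; exact: eg.
  by apply: cdiffB; [exact: cdiff_cpow_sub|exact: cdiff_cst].
- move=> B e e0.
  have [M M0 hM] := @mon_norm_pow_symbol R d K `|B| l.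
  pose c := #|{set 'I_d}|%:R * M; pose A := (`|B| + normc z0) ^+ k.
  have c0 : 0 <= c by rewrite mulr_ge0.
  have A0 : 0 <= A by rewrite exprn_ge0// addr_ge0// normc_ge0.
  exists (Num.truncn (A * c / e)) => z zs zB.
  set n := Num.truncn _.
  have zB' : normc z <= `|B| by apply: le_trans zB _; exact: ler_norm.
  have z1 : -1 <= complex.Re z by apply: le_trans zs; rewrite lerBrDr addNr ltW.
  have hs : symbol K (size l).+1 M (mon_pow l z).
    apply: hM; last by apply: le_trans (ler_normc_Im z) _.
    by rewrite z1 (le_trans (ler_norm _))// (le_trans (ler_normc_Re z)).
  have hr := regularize_symbol M0 lK hs.
  have ht := has_sum_tail weight_ge0 c0 hr (hlam z z1) (hJ n).
  rewrite (_ : Fn n z - F z = (z - z0) ^+ k *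
    - (lam z - \sum_(m <- J n) regularize K (mon_pow l z) m)); last first.
    by rewrite /Fn /F; move: (tw z * g z) => q; ring.
  rewrite normcM normc_opp; apply: (@le_trans _ _ (A * (c * n.+1%:R^-1))).
    apply: ler_pM; rewrite ?normc_ge0//.
    rewrite normcX lerXn2r ?nnegrE ?normc_ge0 ?addr_ge0 ?normc_ge0//.
    by apply: le_trans (ler_normcB _ _) _; rewrite lerD2r.
  rewrite mulrA ler_pdivrMr// -ler_pdivrMl// mulrC ltW//.
  exact: truncnS_gt.
move=> z; rewrite !ge_max => /and3P[_ hX hw].
have XR : X < complex.Re z by apply: lt_le_trans hX; rewrite ltrDl.
have hp := has_sum_parity_mon_pow (hzeta z XR).
have h := has_sum_regularize K (powR_ge0 _ _) (mon_pow_weight hw) hp.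
have z1 : -1 <= complex.Re z by apply: le_trans hw; apply: le_trans (ler0n _ _); rewrite lerN10.
rewrite /F (has_sum_unique (hlam z z1) h) (hg z XR) /tw.
by move: (cpow _ _ - 1) => q; ring.
Qed.

Lemma monE l m : mon l m = \prod_j (m 0%R j)%:~R ^+ count_mem j l :> C.
Proof.
elim: l => [|i l ih].
  by rewrite /mon big_nil big1// => j _; rewrite expr0.
rewrite /mon big_cons -/(mon l m) ih (bigD1 i)//= [in RHS](bigD1 i)//= eqxx exprS -mulrA.
congr (_ * (_ * _)); apply: eq_bigr => j ji.
by rewrite eq_sym (negbTE ji).
Qed.

Lemma size_count l : size l = (\sum_j count_mem j l)%N.
Proof.
elim: l => [|i l ih]; first by rewrite big1.
rewrite /= ih (bigD1 i)//= [in RHS](bigD1 i)//= eqxx add1n addSn; congr (_ + _).+1.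
by apply: eq_bigr => j ji; rewrite eq_sym (negbTE ji).
Qed.

Definition half_exponent l : 'rV[nat]_d := \row_j (count_mem j l)./2.

Definition even_exponents l := [forall j, ~~ odd (count_mem j l)].

Lemma mon_even l m : even_exponents l -> mon l m = (monomial2 (half_exponent l) m)%:~R :> C.
Proof.
move=> /forallP el; rewrite monE /monomial2 rmorph_prod; apply: eq_bigr => j _.
rewrite rmorphXn mxE mul2n; congr (_ ^+ _).
by rewrite -[LHS]odd_double_half (negbTE (el j)).
Qed.

Lemma size_even l : even_exponents l -> size l = (2 * norm1 (half_exponent l))%N.
Proof.
move=> /forallP el; rewrite size_count /norm1 big_distrr/=; apply: eq_bigr => j _.
by rewrite mxE mul2n -[LHS]odd_double_half (negbTE (el j)).
Qed.

Lemma zeta_term_mon_pow l z m : even_exponents l ->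
  zeta_term (half_exponent l) z m = mon_pow l z m.
Proof.
move=> el; rewrite /zeta_term /mon_pow /norm_pow (mon_even _ el).
case: eqVneq => [_|m0]; first by rewrite mulr0.
rewrite enorm_grid1 cpowN// sqrtr_gt0; exact: lt_le_trans (sqnorm_ge1 m0).
Qed.

(** The point [s] lies to the left of the pole, so the power of [z - z0] can be
    cancelled there. *)
Lemma regularized_even K l (Z : C -> C) (s : R) V : ((size l).+1 + 2 * d <= K)%N ->
  0 < s < d%:R -> even_exponents l -> is_generalized_zeta (half_exponent l) Z ->
  has_sum (regularize K (mon_pow l s%:C)) V ->
  V = (cpow 2 ((d + size l)%:R - s%:C) - 1) * Z s%:C.
Proof.
move=> lK /andP[s0 sd] el [[k [g [eg hg]]] hZ] hV.
set z0 : C := (d + 2 * norm1 (half_exponent l))%:R in hg.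
have Rz0 : z0 = ((d + 2 * norm1 (half_exponent l))%:R : R)%:C by rewrite rmorph_nat.
have h1 z : (d + 2 * norm1 (half_exponent l))%:R < complex.Re z -> has_sum (mon_pow l z) (Z z).
  move=> hz; have := has_sum_cvg (hZ z hz); congr has_sum; apply/funext => m.
  exact: zeta_term_mon_pow.
have h2 z : (d + 2 * norm1 (half_exponent l))%:R < complex.Re z -> g z = (z - z0) ^+ k * Z z.
  by move=> hz; apply: hg; apply/eqP => zz; move: hz; rewrite zz Rz0 /= ltxx.
have sz : s%:C != z0.
  rewrite Rz0; apply/eqP => /complexI E; move: sd; rewrite E ltr_nat.
  by rewrite ltnNge leq_addr.
have E := regularized_continuation lK s0 eg h1 h2 hV.
have P0 : (s%:C - z0) ^+ k != 0 by rewrite expf_neq0// subr_eq0.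
by apply: (mulfI P0); rewrite E (hg _ sz); ring.
Qed.

Definition reflect_coord j m : L := \row_i (if i == j then - m 0%R i else m 0%R i).

Lemma reflect_coordK j : involutive (reflect_coord j).
Proof. by move=> m; apply/rowP => i; rewrite !mxE; case: (i == j); rewrite ?opprK. Qed.

Lemma sqnorm_reflect j m : sqnorm (reflect_coord j m) = sqnorm m :> R.
Proof.
apply: eq_bigr => i _; rewrite mxE; case: (i == j) => //.
by rewrite rmorphN sqrrN.
Qed.

Lemma mon_reflect j l m : mon l (reflect_coord j m) = (-1) ^+ count_mem j l * mon l m :> C.
Proof.
rewrite !monE (bigD1 j)//= [in RHS](bigD1 j)//= mxE eqxx rmorphN [in LHS]exprNn -!mulrA.
congr (_ * (_ * _)); apply: eq_bigr => i ij.
by rewrite mxE (negbTE ij).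
Qed.

(** Reflecting an odd coordinate changes the sign of the absolutely convergent
    sums. *)
Lemma regularized_odd K l (s : R) V : ((size l).+1 + 2 * d <= K)%N ->
  0 < s -> ~~ even_exponents l ->
  has_sum (regularize K (mon_pow l s%:C)) V -> V = 0.
Proof.
move=> lK s0; rewrite negb_forall => /existsP[j]; rewrite negbK => oj hV.
have e0 : entire (fun=> 0 : C) by move=> z; exact/cdiffP/cdiff_cst.
have h1 z : (size l + 2 * d).+1%:R < complex.Re z -> has_sum (mon_pow l z) 0.
  move=> hz; have [W hW] := has_sum_dominated weight_ge0 (powR_ge0 _ _) weight_sum (mon_pow_weight (ltW hz)).
  suff W0 : W = 0 by rewrite W0 in hW.
  have h := has_sum_bij (reflect_coordK j) (reflect_coordK j) hW.
  have h' := has_sumD h hW.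
  have : has_sum (fun _ : L => 0 : C) (W + W).
    move: h'; congr has_sum; apply/funext => m.
    rewrite /= /mon_pow mon_reflect -signr_odd oj expr1 /norm_pow sqnorm_reflect.
    have -> : (reflect_coord j m == 0) = (m == 0).
      apply/eqP/eqP => [E|->]; last by apply/rowP => i; rewrite !mxE oppr0; case: ifP.
      by rewrite -(reflect_coordK j m) E; apply/rowP => i; rewrite !mxE oppr0; case: ifP.
    by case: ifP => _; ring.
  move=> /(has_sum_unique (@has_sum0 R L)) /esym/eqP.
  by rewrite -mulr2n mulrn_eq0 /= => /eqP.
have h2 z : (size l + 2 * d).+1%:R < complex.Re z -> 0 = (z - 0) ^+ 0 * 0 :> C.
  by rewrite mulr0.
by have := regularized_continuation lK s0 e0 h1 h2 hV; rewrite expr0 mul1r mulr0.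
Qed.

End regularized_zeta.

(** * Moments of the correction weights *)

Section stencil_moments.
Context {R : realType} {d : nat}.
Local Notation C := R[i].
Local Notation L := 'rV[int]_d.
Implicit Types (m : L) (i j : 'I_d) (l : seq 'I_d).

Lemma finite_box N : finite_set [set m : L | (norm_inf (absv m) <= N)%N].
Proof.
pose u (f : {ffun 'I_d -> 'I_(N + N).+1}) : L := \row_j ((f j : nat)%:Z - N%:Z).
apply: (sub_finite_set _ (finite_seq (codom u))) => m /= mN.
have h j : (absz (m 0%R j + N%:Z)%R < (N + N).+1)%N.
  by have := leq_trans (leq_norm_inf m j) mN; move: (m 0%R j) => x; rewrite ltnS; lia.
have -> : m = u [ffun j => Ordinal (h j)].
  apply/rowP => j; rewrite mxE ffunE /=.
  by have := leq_trans (leq_norm_inf m j) mN; move: (m 0%R j) => x; lia.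
exact: codom_f.
Qed.

Lemma norm_inf_le1 m : (norm_inf (absv m) <= norm1 (absv m))%N.
Proof.
by apply/bigmax_leqP => j _; rewrite /norm1 (bigD1 j)//= leq_addr.
Qed.

Lemma finite_stencil p : finite_set (@stencil d p).
Proof.
apply: sub_finite_set (finite_box p) => m /= mp.
exact: leq_trans (norm_inf_le1 m) mp.
Qed.

Lemma mem_stencil p m : (m \in fset_set (@stencil d p)) = (norm1 (absv m) <= p)%N.
Proof.
rewrite in_fset_set; last exact: finite_stencil.
by apply/idP/idP => [/set_mem|h]//; exact/mem_set.
Qed.

Lemma absv_lift (b : 'rV[nat]_d) : absv (map_mx Posz b) = b.
Proof. by apply/rowP => j; rewrite !mxE. Qed.

Lemma finite_norm1 p : finite_set [set b : 'rV[nat]_d | (norm1 b <= p)%N].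
Proof.
apply: (sub_finite_set _ (finite_image (@absv d) (finite_stencil p))) => b /= bp.
by exists (map_mx Posz b); rewrite /stencil/= absv_lift.
Qed.

Lemma sign_orbitE (b : 'rV[nat]_d) : sign_orbit b = [set m | absv m = b].
Proof.
apply/seteqP; split => m /= h.
  by apply/rowP => j; rewrite mxE; case: (h j) => ->; rewrite ?abszN.
move=> j; have /rowP/(_ j) := h; rewrite mxE => <-.
by have [h0|h0] := leP 0 (m 0%R j); [left|right]; lia.
Qed.

Lemma system_matrix_stencil p (al b : 'rV[nat]_d) : (norm1 b <= p)%N ->
  system_matrix al b = \sum_(m <- fset_set (@stencil d p) | absv m == b) monomial2 al m.
Proof.
move=> bp; have fin : finite_set (sign_orbit b).
  by apply: sub_finite_set (finite_stencil p) => m; rewrite sign_orbitE /stencil /= => ->.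
rewrite /system_matrix fsbig_finite//= -[RHS]big_filter; apply: perm_big; apply: uniq_perm.
- exact: fset_uniq.
- by apply: filter_uniq; exact: fset_uniq.
move=> m; rewrite mem_filter !in_fset_set//; last exact: finite_stencil.
rewrite sign_orbitE; apply/idP/andP => [/set_mem /= E|[/eqP E _]].
  by rewrite E eqxx; split => //; apply/mem_set; rewrite /stencil /= E.
exact/mem_set.
Qed.

(** The stencil splits into the sign orbits that index the unknowns of the linear
    system. *)
Lemma stencil_moment_even (Z : 'rV[nat]_d -> C -> C) (s : R) p w l :
  converged_weights Z s p w -> (size l < 2 * p + 2)%N -> even_exponents l ->
  \sum_(m <- fset_set (@stencil d p)) w (absv m) * mon l m = - Z (half_exponent l) s%:C.
Proof.
move=> hw lp el; have sz := size_even el.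
rewrite -hw; last by lia.
rewrite fsbig_finite; last exact: finite_norm1.
set S := fset_set (@stencil d p); set B := fset_set _.
have mB m : m \in S -> absv m \in B.
  rewrite !in_fset_set; [|exact: finite_norm1|exact: finite_stencil].
  by move=> /set_mem h; apply/mem_set.
transitivity (\sum_(m <- S) \sum_(b <- B | absv m == b) w b * mon l m).
  apply: eq_big_seq => m /mB mS.
  rewrite (big_rem (absv m))//= eqxx big_seq_cond big1 ?addr0// => b /andP[].
  rewrite mem_rem_uniq ?fset_uniq// !inE => /andP[/negbTE nb _].
  by rewrite eq_sym nb.
rewrite (exchange_big_dep xpredT)//=; apply: eq_big_seq => b.
rewrite in_fset_set; last exact: finite_norm1.
move=> /set_mem /= bp; rewrite (system_matrix_stencil _ bp) rmorph_sum mulr_suml.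
by apply: eq_bigr => m _; rewrite (mon_even _ el) mulrC.
Qed.

Lemma stencil_moment_odd p (w : 'rV[nat]_d -> C) l : ~~ even_exponents l ->
  \sum_(m <- fset_set (@stencil d p)) w (absv m) * mon l m = 0.
Proof.
rewrite negb_forall => /existsP[j]; rewrite negbK => oj.
set S := fset_set (@stencil d p).
have ab m : absv (reflect_coord j m) = absv m.
  by apply/rowP => i; rewrite !mxE; case: ifP => _; rewrite ?abszN.
set T := \sum_(m <- S) _.
have E : T = - T.
  rewrite {1}/T -sumrN (perm_big [seq reflect_coord j m | m <- S]) /=.
    rewrite big_map; apply: eq_bigr => m _.
    by rewrite ab mon_reflect -signr_odd oj expr1; ring.
  apply: uniq_perm; first exact: fset_uniq.
    rewrite map_inj_uniq; first exact: fset_uniq.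
    exact: inv_inj (reflect_coordK j).
  move=> m; apply/idP/mapP => [mS|[m' m'S ->]].
    exists (reflect_coord j m); last by rewrite reflect_coordK.
    by rewrite mem_stencil ab -mem_stencil.
  by rewrite mem_stencil ab -mem_stencil.
have : T *+ 2 == 0 by rewrite mulr2n {1}E addNr.
by rewrite mulrn_eq0 /= => /eqP.
Qed.

(** Both terms carry the factor 2 ^ (d + |l| - s) - 1: in [V] it multiplies the zeta
    value, and the moment of the weights is the opposite of that value. *)
Lemma moment_cancel (Z : 'rV[nat]_d -> C -> C) (s : R) p w K l V :
  (forall al, is_generalized_zeta al (Z al)) -> converged_weights Z s p w ->
  0 < s < d%:R -> ((size l).+1 + 2 * d <= K)%N -> (size l < 2 * p + 2)%N ->
  has_sum (regularize K (mon_pow l s%:C)) V ->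
  V + (cpow 2 ((d + size l)%:R - s%:C) - 1) *
    \sum_(m <- fset_set (@stencil d p)) w (absv m) * mon l m = 0.
Proof.
move=> hZ hw sd lK lp hV; have [el|ol] := boolP (even_exponents l).
  by rewrite (stencil_moment_even hw lp el) (regularized_even lK sd el (hZ _) hV); ring.
have s0 : 0 < s by case/andP: sd.
by rewrite (stencil_moment_odd _ _ ol) (regularized_odd lK s0 ol hV) mulr0 addr0.
Qed.

End stencil_moments.

(** * Convergence of the punctured Riemann sums *)

Section boxes.
Context {R : realType}.

Definition box d (I : 'I_d -> set R) : set (d.-tuple (measurableTypeR R)) :=
  [set t | forall j, I j (tnth t j)].

Lemma measurable_box d (I : 'I_d -> set R) : (forall j, measurable (I j)) ->
  measurable (box I).
Proof.
move=> mI; rewrite (_ : box I = \bigcap_(j in [set: 'I_d]) (fun t => tnth t j) @^-1` I j); last first.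
  by apply/seteqP; split => t h j => [_|]; exact: h.
apply: fin_bigcap_measurable; first exact: finite_finset.
move=> j _; rewrite -[X in measurable X]setTI; apply: measurable_tnth => //.
exact: mI.
Qed.

Lemma volume_box d (I : 'I_d -> set R) (c : R) : (forall j, measurable (I j)) ->
  (forall j, lebesgue_measure (I j) = c%:E) -> lebesgue_tuple R d (box I) = (c ^+ d)%:E.
Proof.
elim: d I => [|d ih] I mI Ic.
  rewrite /= /dirac /= indicE mem_set//; by case.
pose I' j := I (lift ord0 j).
have mI' : measurable (box I') by apply: measurable_box => j; exact: mI.
rewrite /= /lebesgue_cons /pushforward.
have -> : @cons_pair R d @^-1` box I = I ord0 `*` box I'.
  apply/seteqP; split => -[x t] /=.
    move=> h; split; first exact: (h ord0).
    by move=> j; have := h (lift ord0 j); rewrite /cons_pair /= tnthS.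
  move=> [h0 h] j; case: (unliftP ord0 j) => [j' ->|->]; last exact: h0.
  by rewrite /cons_pair /= tnthS; exact: h.
have := @product_measure1E _ _ _ _ R (@lebesgue_measure R) (lebesgue_tuple R d) (I ord0) (box I') (mI _) mI'.
move=> ->; rewrite exprS EFinM; congr (_ * _)%E; first exact: Ic.
by apply: ih => j; [exact: mI|exact: Ic].
Qed.

End boxes.

Section riemann_sums.
Context {R : realType} {d : nat}.
Local Notation V := 'rV[R]_d.
Local Notation L := 'rV[int]_d.
Local Notation T := (d.-tuple (measurableTypeR R)).
Local Notation mu := (lebesgue_tuple R d).
Implicit Types (x : V) (m : L) (t : T).

Definition cell (h : R) m : set T :=
  box (fun j => `[(m 0%R j)%:~R * h, ((m 0%R j)%:~R + 1) * h[%classic).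

Definition cell_of (h : R) t : L := \row_j Num.floor (tnth t j / h).

Lemma cellP (h : R) m t : 0 < h -> cell h m t <-> cell_of h t = m.
Proof.
move=> h0; split => [tm|<- j /=].
  apply/rowP => j; rewrite mxE; apply/eqP; rewrite floor_eq.
  have := tm j; rewrite /= in_itv/= => /andP[h1 h2].
  by rewrite ler_pdivlMr// ltr_pdivrMr// h1 rmorphD.
rewrite in_itv/= mxE -ler_pdivlMr// -ltr_pdivrMr//.
by rewrite floor_le -[1]/(1%:~R) -rmorphD/= floorD1_gt.
Qed.

Lemma measurable_cell (h : R) m : measurable (cell h m).
Proof. by apply: measurable_box => j; exact: measurable_itv. Qed.

Lemma volume_cell (h : R) m : 0 < h -> mu (cell h m) = (h ^+ d)%:E.
Proof.
move=> h0; apply: volume_box => j; first exact: measurable_itv.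
rewrite lebesgue_measure_itv/= lte_fin ltr_pM2r// ltrDl ltr01.
by rewrite -EFinB mulrDl mul1r addrAC subrr add0r.
Qed.

Definition box_seq N : seq L := fset_set [set m : L | (norm_inf (absv m) <= N)%N].

Lemma mem_box_seq N m : (m \in box_seq N) = (norm_inf (absv m) <= N)%N.
Proof.
rewrite in_fset_set; last exact: finite_box.
by apply/idP/idP => [/set_mem|h]//; exact/mem_set.
Qed.

(** its integral is the Riemann sum *)
Definition step (f : V -> R) (h : R) N t : R :=
  \sum_(m <- box_seq N) f (grid_point h m) * \1_(cell h m) t.

Lemma stepE f a N t : 0 < a -> vanishes_outside a f ->
  step f (a / N.+1%:R) N.+1 t = f (grid_point (a / N.+1%:R) (cell_of (a / N.+1%:R) t)).
Proof.
move=> a0 vf; set h := a / _; have h0 : 0 < h by rewrite divr_gt0.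
have out m : m \notin box_seq N.+1 -> f (grid_point h m) = 0.
  rewrite mem_box_seq -ltnNge => Nm.
  have [d0|d0] := posnP d.
    by move: Nm; rewrite /norm_inf big1// => j _; move: (ltn_ord j); rewrite {2}d0.
  have [j E] := norm_inf_attained m (Ordinal d0).
  apply: (vf _ j); rewrite mxE normrM (gtr0_norm h0) -intr_norm -natr_absz -E.
  rewrite /h mulrA ltr_pdivlMr// mulrC ltr_pM2r// ltr_nat.
  exact: Nm.
rewrite /step; have [mS|mS] := boolP (cell_of h t \in box_seq N.+1); last first.
  rewrite out// big_seq big1// => m mS'; rewrite indicE memNset ?mulr0//.
  by move/(cellP _ _ h0) => E; move: mS; rewrite E mS'.
rewrite (bigD1_seq (cell_of h t)) ?fset_uniq//= indicE mem_set ?mulr1; last exact/(cellP _ _ h0).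
rewrite big1 ?addr0// => m mt; rewrite indicE memNset ?mulr0//.
by move/(cellP _ _ h0) => E; move: mt; rewrite E eqxx.
Qed.

Lemma measurable_step f h N : measurable_fun setT (step f h N).
Proof.
apply: measurable_sum => m; apply: measurable_funM; first exact: measurable_cst.
apply: measurable_indic; exact: measurable_cell.
Qed.

Lemma integrable_indic_lty (A : set T) : measurable A -> (mu A < +oo)%E ->
  mu.-integrable setT (fun t => (\1_A t : R)%:E).
Proof.
move=> mA Aoo; apply/integrableP; split; first exact/measurable_EFinP/measurable_indic.
under eq_integral do rewrite gee0_abs ?lee_fin//.
by rewrite integral_indic// setIT.
Qed.

Lemma integrable_cell (h : R) m : 0 < h -> mu.-integrable setT (fun t => (\1_(cell h m) t : R)%:E).
Proof.
move=> h0; apply: integrable_indic_lty; first exact: measurable_cell.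
by rewrite volume_cell// ltry.
Qed.

Lemma integral_step f h N : 0 < h -> (\int[mu]_t (step f h N t)%:E)%E =
  (h ^+ d * \sum_(m <- box_seq N) f (grid_point h m))%:E.
Proof.
move=> h0; under eq_integral do rewrite /step -sumEFin.
rewrite integral_sum//.
  rewrite mulr_sumr -sumEFin; apply: eq_bigr => m _.
  under eq_integral do rewrite EFinM.
  rewrite integralZl//; last exact: integrable_cell.
  rewrite integral_indic//; last exact: measurable_cell.
  rewrite setIT mulrC EFinM; congr (_ * _)%E; exact: volume_cell.
move=> m; under eq_fun do rewrite EFinM.
by apply: integrableZl => //; exact: integrable_cell.
Qed.

Lemma geometric_sum_le (q : R) n : 0 <= q < 1 -> \sum_(k < n) q ^+ k <= (1 - q)^-1.
Proof.
move=> /andP[q0 q1]; have q1' : 0 < 1 - q by rewrite subr_gt0.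
suff -> : \sum_(k < n) q ^+ k = (1 - q ^+ n) / (1 - q).
  by rewrite ler_piMl ?invr_ge0 ?(ltW q1')// gerBl exprn_ge0.
elim: n => [|n ih]; first by rewrite big_ord0 expr0 subrr mul0r.
rewrite big_ord_recr/= ih exprS; field.
by rewrite gt_eqF.
Qed.

Lemma vec_grid_cell (h : R) t j : 0 < h ->
  0 <= vec t 0%R j - grid_point h (cell_of h t) 0%R j < h.
Proof.
move=> h0; rewrite !mxE subr_ge0 ltrBlDl -ler_pdivlMr// floor_le/=.
rewrite -[X in _ < _ + X]mul1r -mulrDl -ltr_pdivrMr//.
by rewrite -[X in _ + X]/(1%:~R) -rmorphD/= floorD1_gt.
Qed.

Section domination.
Variables (f : V -> R) (a s B : R).
Hypotheses (a0 : 0 < a) (s0 : 0 < s) (sd : s < d%:R) (B0 : 0 <= B).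
Hypothesis fB : forall x, `|f x| <= B * maxnorm x `^ (- s).
Hypothesis vf : vanishes_outside a f.

Let A : R := 2 * a.
Let A0 : 0 < A. Proof. by rewrite mulr_gt0. Qed.

Definition dyadic_box k : set T := box (fun _ : 'I_d => `[- (A / 2 ^+ k), A / 2 ^+ k]%classic).
Definition dyadic_bound k : R := B * (A / 2 ^+ k.+2) `^ (- s).
(** A function of the size of [maxnorm ^ (- s)] near the origin, written as a
    series over cubes so that only volumes of cubes enter its integral. *)
Definition dominating t : \bar R := (\sum_(k <oo) (dyadic_bound k * \1_(dyadic_box k) t)%:E)%E.

Let two_gt0 k : 0 < 2 ^+ k :> R. Proof. by rewrite exprn_gt0. Qed.

Lemma measurable_dyadic_box k : measurable (dyadic_box k).
Proof. by apply: measurable_box => j; exact: measurable_itv. Qed.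

Lemma volume_dyadic_box k : mu (dyadic_box k) = ((2 * (A / 2 ^+ k)) ^+ d)%:E.
Proof.
apply: volume_box => j; first exact: measurable_itv.
have r0 : 0 < A / 2 ^+ k by rewrite divr_gt0.
rewrite lebesgue_measure_itv/= lte_fin gtrN// -EFinB opprK.
by congr (_%:E); ring.
Qed.

Lemma dyadic_bound_ge0 k : 0 <= dyadic_bound k.
Proof. by rewrite mulr_ge0 ?powR_ge0. Qed.

Let term_ge0 k t : (0 <= (dyadic_bound k * \1_(dyadic_box k) t)%:E)%E.
Proof. by rewrite lee_fin mulr_ge0 ?dyadic_bound_ge0. Qed.

Lemma dyadic_mass k : dyadic_bound k * (2 * (A / 2 ^+ k)) ^+ d =
  dyadic_bound 0 * (2 * A) ^+ d * (2 `^ s / 2 ^+ d) ^+ k.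
Proof.
elim: k => [|k ih]; first by rewrite !expr0 divr1 mulr1.
rewrite [(2 `^ s / 2 ^+ d) ^+ k.+1]exprSr [RHS]mulrA -ih /dyadic_bound.
have -> : A / 2 ^+ k.+3 = A / 2 ^+ k.+2 * 2^-1.
  by rewrite [2 ^+ k.+3]exprS; field; rewrite gt_eqF.
have -> : A / 2 ^+ k.+1 = A / 2 ^+ k * 2^-1.
  by rewrite [2 ^+ k.+1]exprS; field; rewrite gt_eqF.
rewrite powRM ?divr_ge0 ?(ltW A0) ?(ltW (two_gt0 _))//.
have -> : 2^-1 `^ (- s) = 2 `^ s :> R by rewrite -powR_inv1// -powRrM mulN1r opprK.
have -> : 2 * (A / 2 ^+ k * 2^-1) = 2 * (A / 2 ^+ k) * 2^-1 by rewrite mulrA.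
by rewrite [(_ * 2^-1) ^+ d]exprMn exprVn; ring.
Qed.

Lemma dominating_integrable : mu.-integrable setT dominating.
Proof.
have mt k : measurable_fun setT (fun t => (dyadic_bound k * \1_(dyadic_box k) t)%:E).
  apply/measurable_EFinP; apply: measurable_funM; first exact: measurable_cst.
  by apply: measurable_indic; exact: measurable_dyadic_box.
apply/integrableP; split.
  by apply: ge0_emeasurable_sum => // k t _ _; exact: term_ge0.
under eq_integral do rewrite gee0_abs ?nneseries_ge0//.
rewrite /dominating integral_nneseries//; last first.
have mass k : (\int[mu]_t (dyadic_bound k * \1_(dyadic_box k) t)%:E =
    (dyadic_bound 0 * (2 * A) ^+ d * (2 `^ s / 2 ^+ d) ^+ k)%:E)%E.
  under eq_integral do rewrite EFinM.
  rewrite ge0_integralZl//; first last.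
  - by rewrite lee_fin dyadic_bound_ge0.
  - by apply/measurable_EFinP/measurable_indic; exact: measurable_dyadic_box.
  rewrite integral_indic//; last exact: measurable_dyadic_box.
  rewrite setIT -dyadic_mass (EFinM (dyadic_bound k)); congr (_%:E * _)%E.
  exact: volume_dyadic_box.
under eq_eseriesr do rewrite mass.
set C := dyadic_bound 0 * (2 * A) ^+ d; set q := 2 `^ s / 2 ^+ d.
have C0 : 0 <= C.
  apply: mulr_ge0; first exact: dyadic_bound_ge0.
  by apply: exprn_ge0; apply: mulr_ge0 => //; exact: ltW.
have q0 : 0 <= q by rewrite divr_ge0 ?powR_ge0 ?(ltW (two_gt0 _)).
have q1 : q < 1.
  rewrite /q ltr_pdivrMr// mul1r -powR_mulrn// /powR !gt_eqF// ltr_expR ltr_pM2r//.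
  by rewrite ln_gt0 ?ltr1n.
apply: (@le_lt_trans _ _ (C * (1 - q)^-1)%:E); last exact: ltry.
apply: lime_le.
  by apply: is_cvg_nneseries => k _ _; rewrite lee_fin mulr_ge0 ?exprn_ge0.
apply: nearW => n; rewrite sumEFin lee_fin -mulr_sumr ler_wpM2l//.
by rewrite big_mkord; apply: geometric_sum_le; rewrite q0.
Qed.

(** Outside of the cell at the origin, a point is at most twice as far from the
    origin as the corner of its cell. *)
Lemma step_dominated N t :
  (`|(step f (a / N.+1%:R) N.+1 t)%:E| <= dominating t)%E.
Proof.
rewrite (stepE _ _ a0 vf); set h := a / _; have h0 : 0 < h by rewrite divr_gt0.
set m := cell_of h t; set x := grid_point h m.
have G0 : (0 <= dominating t)%E by apply: nneseries_ge0 => k _ _; exact: term_ge0.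
have [->|fx0] := eqVneq (f x) 0; first by rewrite abse0.
have x0 : 0 < maxnorm x.
  rewrite lt_neqAle maxnorm_ge0 andbT; apply/eqP => E.
  move: (fB x); rewrite -E powR0 ?mulr0 ?normr_le0 ?(negbTE fx0)//.
  by rewrite oppr_eq0 gt_eqF.
have xa : maxnorm x <= a.
  apply: maxnorm_le => [|j]; first exact: ltW.
  by rewrite leNgt; apply/negP => /vf E; rewrite E eqxx in fx0.
have hx : h <= maxnorm x.
  have [j xj] : exists j, x 0%R j != 0.
    apply: contrapT => H; move: x0; rewrite ltNge => /negP; apply.
    apply: maxnorm_le => // j; rewrite normr_le0; apply/negPn/negP => xj.
    by apply: H; exists j.
  apply: le_trans (ler_maxnorm x j); move: xj; rewrite mxE => xj.
  rewrite normrM (gtr0_norm h0) ler_peMl ?(ltW h0)// -intr_norm -natr_absz ler1n lt0n absz_eq0.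
  by apply: contra_neq xj => ->; rewrite mul0r.
have tx j : `|tnth t j| <= 2 * maxnorm x.
  have := vec_grid_cell t j h0; rewrite -/m -/x mxE => /andP[e0 e1].
  rewrite -(subrK (x 0%R j) (tnth t j)) mulr2n mulrDl mul1r.
  apply: le_trans (ler_normD _ _) _; apply: lerD; last exact: ler_maxnorm.
  by rewrite ger0_norm// (le_trans (ltW e1)).
pose rho := 2 * maxnorm x.
have rho0 : 0 < rho by rewrite mulr_gt0.
have rhoA : rho <= A by rewrite ler_pM2l.
(* the scale [k] of the term that dominates: A / 2 ^ k.+1 < rho <= A / 2 ^ k *)
have ex : exists k, A / 2 ^+ k < rho.
  have [k hk] : exists k : nat, A / rho < k%:R.
    by exists (Num.truncn (A / rho)).+1; exact: truncnS_gt.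
  exists k; rewrite ltr_pdivrMr// mulrC -ltr_pdivrMr//; apply: lt_le_trans hk _.
  by rewrite -natrX ler_nat ltnW// ltn_expl.
have [[|k] hk mink] := ex_minnP ex.
  by move: hk; rewrite expr0 divr1 ltNge rhoA.
have rk : rho <= A / 2 ^+ k by rewrite leNgt; apply/negP => /mink; rewrite ltnn.
have tk : dyadic_box k t.
  by move=> j /=; rewrite in_itv/= -ler_norml (le_trans (tx j)).
apply: (@le_trans _ _ (dyadic_bound k)%:E).
  rewrite lee_fin; apply: le_trans (fB x) _; rewrite ler_wpM2l// !powRN.
  have h1 : A / 2 ^+ k.+2 <= maxnorm x.
    move: hk; rewrite /rho (exprSr 2 k.+1) => hk; rewrite invfM mulrA ler_pdivrMr// mulrC.
    by rewrite [leLHS]mulrC [leRHS]mulrC ltW.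
  rewrite lef_pV2 ?posrE ?powR_gt0 ?divr_gt0//.
  by apply: ge0_ler_powR; rewrite ?nnegrE ?divr_ge0 ?(ltW s0) ?(ltW A0) ?(ltW x0) ?(ltW (two_gt0 _)).
have := @nneseries_lim_ge R (fun k => (dyadic_bound k * \1_(dyadic_box k) t)%:E) xpredT 0 k.+1
  (fun k _ _ => term_ge0 k t).
apply: le_trans; rewrite big_nat_recr//= indicE mem_set// mulr1 leeDr//.
by apply: sume_ge0 => i _; exact: term_ge0.
Qed.

Hypothesis cf : forall x, x != 0 -> {for x, continuous f}.

Lemma step_cvg t : step f (a / n.+1%:R) n.+1 t @[n --> \oo] --> f (vec t).
Proof.
under eq_fun do rewrite (stepE _ _ a0 vf).
have [t0|t0] := eqVneq (vec t) 0.
  have f0 : f 0 = 0.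
    apply/eqP; rewrite -normr_le0; apply: le_trans (fB 0) _.
    rewrite (_ : maxnorm 0 = 0) ?powR0 ?mulr0// ?oppr_eq0 ?gt_eqF//.
    by apply/eqP; rewrite eq_le maxnorm_ge0 andbT; apply: maxnorm_le => // j; rewrite mxE normr0.
  rewrite (_ : (fun n => _) = fun=> f (vec t)); first exact: cvg_cst.
  apply/funext => n; congr f; rewrite t0; apply/rowP => j; rewrite !mxE.
  by move/rowP/(_ j): t0; rewrite !mxE => ->; rewrite mul0r floor0 mul0r.
apply: (@cvg_comp _ _ _ (fun n => grid_point (a / n.+1%:R) (cell_of (a / n.+1%:R) t))
  f _ _ _ _ (cf t0)).
apply/cvg_ballP => e e0; exists (Num.truncn (a / e)) => // n /= Nn.
have h0 : 0 < a / n.+1%:R by rewrite divr_gt0.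
split => // k j; rewrite ord1 /ball/=.
have /andP[e1 e2] := vec_grid_cell t j h0.
rewrite ger0_norm//; apply: lt_le_trans e2 _.
rewrite ler_pdivrMr// mulrC -ler_pdivrMr//; apply: le_trans (ltW (truncnS_gt _)) _.
by rewrite ler_nat.
Qed.

Lemma riemann_cvg :
  ((a / n.+1%:R) ^+ d * \sum_(m <- box_seq n.+1) f (grid_point (a / n.+1%:R) m))
    @[n --> \oo] --> integral_on (cube a) f.
Proof.
have mf : measurable_fun setT (fun t : T => f (vec t)).
  apply: (@measurable_fun_cvg _ _ _ _ (fun n => step f (a / n.+1%:R) n.+1)).
    by move=> n; exact: measurable_step.
  by move=> t _; exact: step_cvg.
have [] := @dominated_convergence _ _ R mu setT measurableT
  (fun n t => (step f (a / n.+1%:R) n.+1 t)%:E) (fun t => (f (vec t))%:E) dominating.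
- by move=> n; apply/measurable_EFinP; exact: measurable_step.
- exact/measurable_EFinP.
- by apply: aeW => t _; apply: cvg_EFin; [exact: nearW|exact: step_cvg].
- exact: dominating_integrable.
- by apply: aeW => t n _; exact: step_dominated.
move=> If _ H; rewrite /integral_on /Rintegral.
have -> : (\int[mu]_(t in [set t | cube a (vec t)]) (f (vec t))%:E =
    \int[mu]_t (f (vec t))%:E)%E.
  rewrite integral_mkcond; apply: eq_integral => t _; rewrite patchE.
  case: ifPn => // /negP h; congr (_%:E); apply/esym.
  have [j hj] : exists j, a < `|vec t 0%R j|.
    apply: contrapT => H'; apply: h; apply/mem_set => j.
    by rewrite -ler_norml leNgt; apply/negP => hj; apply: H'; exists j.
  exact: vf hj.
have Ifin : (\int[mu]_t (f (vec t))%:E)%E \is a fin_num by exact: integrable_fin_num.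
move: H; rewrite -(fineK Ifin) => /fine_cvg; rewrite /= (_ : fine \o _ =
  (fun n => (a / n.+1%:R) ^+ d * \sum_(m <- box_seq n.+1) f (grid_point (a / n.+1%:R) m)))//.
by apply/funext => n /=; rewrite integral_step// divr_gt0.
Qed.

End domination.

End riemann_sums.

(** * The singular integrand *)

Section integrand.
Context {R : realType} {d : nat}.
Local Notation V := 'rV[R]_d.
Implicit Types (x : V) (phi : V -> R).

Lemma maxnorm_enorm x : maxnorm x <= enorm x.
Proof.
apply: maxnorm_le => [|j]; first exact: sqrtr_ge0.
rewrite -sqrtr_sqr ler_wsqrtr// (bigD1 j)//= lerDl.
by apply: sumr_ge0 => i _; exact: sqr_ge0.
Qed.

Lemma maxnorm_eq0 x : maxnorm x = 0 -> x = 0.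
Proof.
move=> E; apply/rowP => j; rewrite mxE; apply/eqP; rewrite -normr_le0 -E.
exact: ler_maxnorm.
Qed.

Lemma sigma0 (s : R) : s != 0 -> sigma s (0 : V) = 0.
Proof.
move=> s0; rewrite /sigma (_ : enorm 0 = 0) ?powR0 ?invr0//.
by rewrite /enorm big1 ?sqrtr0// => j _; rewrite mxE expr0n.
Qed.

Lemma sigma_le (s : R) x : 0 < s -> `|sigma s x| <= maxnorm x `^ (- s).
Proof.
move=> s0; rewrite ger0_norm ?invr_ge0 ?powR_ge0//.
have [x0|x0] := eqVneq x 0.
  by rewrite x0 sigma0 ?powR_ge0// gt_eqF.
have m0 : 0 < maxnorm x.
  rewrite lt_neqAle maxnorm_ge0 andbT eq_sym; apply/eqP => /maxnorm_eq0 E.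
  by rewrite E eqxx in x0.
have e0 : 0 < enorm x by exact: lt_le_trans (maxnorm_enorm x).
rewrite powRN lef_pV2 ?posrE ?powR_gt0//.
by apply: ge0_ler_powR; rewrite ?nnegrE ?(ltW s0) ?(ltW e0) ?(ltW m0)// maxnorm_enorm.
Qed.

Lemma enorm_continuous : continuous (@enorm R d).
Proof.
move=> x; apply: (@continuous_comp _ _ _ (fun x : V => \sum_j x 0%R j ^+ 2) Num.sqrt); last exact: sqrt_continuous.
elim: (index_enum 'I_d) => [|j r ih].
  rewrite (_ : (fun x : V => _) = fun=> 0); first exact: cst_continuous.
  by apply/funext => y; rewrite big_nil.
rewrite (_ : (fun x : V => _) = fun x => x 0%R j ^+ 2 + \sum_(j <- r) x 0%R j ^+ 2); last first.
  by apply/funext => y; rewrite big_cons.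
apply: continuousD ih; apply: (@continuous_comp _ _ _ (fun x : V => x 0%R j) (fun t : R => t ^+ 2)).
  exact: coord_continuous.
exact: exprn_continuous.
Qed.

Lemma sigma_continuous (s : R) x : x != 0 -> {for x, continuous (@sigma R d s)}.
Proof.
move=> x0; have e0 : 0 < enorm x.
  rewrite lt_neqAle sqrtr_ge0 andbT eq_sym; apply/eqP => E.
  have /maxnorm_eq0 : maxnorm x = 0.
    by apply/eqP; rewrite eq_le maxnorm_ge0 andbT -E maxnorm_enorm.
  by move=> E'; rewrite E' eqxx in x0.
apply: continuousV; first by rewrite powR_eq0 negb_and gt_eqF.
apply: (@continuous_comp _ _ _ (@enorm R d) (fun t : R => t `^ s)); first exact: enorm_continuous.
have c : {for enorm x, continuous (fun t : R => expR (s * ln t))}.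
  apply: (@continuous_comp _ _ _ (fun t : R => s * ln t) expR); last exact: continuous_expR.
  by apply: continuousM; [exact: cst_continuous|exact: continuous_ln].
have E : enorm x `^ s = expR (s * ln (enorm x)) by rewrite /powR gt_eqF.
suff : t `^ s @[t --> enorm x] --> enorm x `^ s by [].
rewrite E; apply: cvg_trans c; apply: near_eq_cvg.
near=> t; rewrite /powR gt_eqF//; near: t; exact: lt_nbhsr.
Unshelve. all: by end_near.
Qed.

Lemma riemann_integrand_cvg (a s : R) phi : 0 < a -> 0 < s < d%:R -> continuous phi ->
  vanishes_outside a phi ->
  ((a / n.+1%:R) ^+ d * \sum_(m <- box_seq n.+1) (phi (grid_point (a / n.+1%:R) m) *
     sigma s (grid_point (a / n.+1%:R) m)))
    @[n --> \oo] --> integral_on (cube a) (fun x => phi x * sigma s x).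
Proof.
move=> a0 /andP[s0 sd] cphi vphi; have [B hB] := vanishes_outside_bounded cphi vphi.
apply: (@riemann_cvg R d (fun x => phi x * sigma s x) a s `|B|) => //.
- move=> x; rewrite normrM; apply: ler_pM => //; last exact: sigma_le.
  by apply: le_trans (hB x) _; exact: ler_norm.
- by move=> x j h; rewrite (vphi x j h) mul0r.
by move=> x x0; apply: continuousM; [exact: cphi|exact: sigma_continuous].
Qed.

(** The half weights sit on the boundary of the cube, where the integrand
    vanishes. *)
Lemma punctured_trapezoidalE (a s : R) phi N : 0 < a -> 0 < s -> (0 < N)%N -> continuous phi ->
  vanishes_outside a phi ->
  punctured_trapezoidal a N (fun x => phi x * sigma s x) =
  (a / N%:R) ^+ d * \sum_(m <- box_seq N) (phi (grid_point (a / N%:R) m) *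
     sigma s (grid_point (a / N%:R) m)).
Proof.
move=> a0 s0 N0 cphi vphi; congr (_ * _); set h := a / N%:R.
have h0 : 0 < h by rewrite divr_gt0 ?ltr0n.
have fin : finite_set [set i : 'rV[int]_d | (0 < norm_inf (absv i) <= N)%N].
  by apply: sub_finite_set (finite_box N) => m /= /andP[].
rewrite fsbig_finite//= (perm_big [seq m <- box_seq N | m != 0]); last first.
  apply: uniq_perm; [exact: fset_uniq|by apply: filter_uniq; exact: fset_uniq|].
  move=> m; rewrite mem_filter mem_box_seq -norm_inf_eq0 -lt0n in_fset_set//.
  by apply/idP/idP => [/set_mem//|h']; exact/mem_set.
rewrite big_filter big_mkcond/=; apply: eq_bigr => m _; case: eqVneq => [->|m0] /=.
  rewrite (_ : grid_point h 0 = 0) ?sigma0 ?mulr0 ?gt_eqF//.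
  by apply/rowP => j; rewrite !mxE mul0r.
rewrite /trapezoidal_weight; set k := #|_|.
have [->|k0] := posnP k; first by rewrite expr0 invr1 mul1r.
have [j] : exists j, j \in [pred j : 'I_d | absv m 0%R j == N] by exact/card_gt0P.
rewrite inE mxE => /eqP E.
have -> : phi (grid_point h m) = 0.
  apply: (@vanishes_outside_boundary R d a phi _ j) => //.
  rewrite mxE normrM (gtr0_norm h0) -intr_norm -natr_absz E /h mulrC divfK//.
  by rewrite pnatr_eq0 -lt0n.
by rewrite mul0r mulr0.
Qed.

End integrand.

(** * Comparison of two consecutive meshes *)

Section halving.
Context {R : realType} {d : nat}.
Local Notation C := R[i].
Local Notation V := 'rV[R]_d.
Local Notation L := 'rV[int]_d.
Implicit Types (x : V) (m : L) (l : seq 'I_d).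

(** the terms of the punctured sum, up to the power of the mesh size *)
Definition lattice_term (phi : V -> R) (s h : R) m : C :=
  (phi (grid_point h m))%:C * norm_pow s%:C m.

Lemma lattice_termE phi (s h : R) m : 0 < h -> s != 0 ->
  ((phi (grid_point h m) * sigma s (grid_point h m)))%:C =
  (h `^ (- s))%:C * lattice_term phi s h m.
Proof.
move=> h0 s0; rewrite /lattice_term /norm_pow; case: eqVneq => [->|m0].
  rewrite (_ : grid_point h 0 = 0) ?sigma0 ?mulr0//.
  by apply/rowP => j; rewrite !mxE mul0r.
rewrite /sigma.
have -> : enorm (grid_point h m) = h * Num.sqrt (sqnorm m).
  rewrite /enorm -[h in RHS](gtr0_norm h0) -sqrtr_sqr -sqrtrM ?sqr_ge0//.
  congr Num.sqrt; rewrite /sqnorm mulr_sumr; apply: eq_bigr => j _.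
  by rewrite mxE exprMn mulrC.
rewrite -rmorphN cpow_real powRM ?sqrtr_ge0 ?(ltW h0)// invfM -!powRN.
by rewrite -!rmorphM/=; congr (_%:C); ring.
Qed.

Lemma lattice_term_out a phi (s h : R) N m : 0 < a -> (0 < N)%N -> vanishes_outside a phi ->
  h = a / N%:R -> m \notin box_seq N -> lattice_term phi s h m = 0.
Proof.
move=> a0 N0 vphi hE; rewrite mem_box_seq -ltnNge => Nm.
have [d0|d0] := posnP d.
  by move: Nm; rewrite /norm_inf big1// => j _; move: (ltn_ord j); rewrite {2}d0.
have h0 : 0 < h by rewrite hE divr_gt0 ?ltr0n.
have [j E] := norm_inf_attained m (Ordinal d0).
rewrite /lattice_term (vphi _ j) ?mul0r// mxE normrM (gtr0_norm h0) -intr_norm -natr_absz -E.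
by rewrite hE mulrA ltr_pdivlMr ?ltr0n// mulrC ltr_pM2r// ltr_nat.
Qed.

Definition lattice_sum a phi (s : R) N : C :=
  \sum_(m <- box_seq N) lattice_term phi s (a / N%:R) m.

Lemma has_sum_lattice_term a phi (s : R) N : 0 < a -> (0 < N)%N -> vanishes_outside a phi ->
  has_sum (lattice_term phi s (a / N%:R)) (lattice_sum a phi s N).
Proof.
move=> a0 N0 vphi; apply: has_sum_finite => m mN.
by apply: (lattice_term_out _ a0 N0 vphi _ mN).
Qed.

Lemma punctured_lattice_sum a phi (s : R) N : 0 < a -> 0 < s -> (0 < N)%N ->
  continuous phi -> vanishes_outside a phi ->
  (punctured_trapezoidal a N (fun x => phi x * sigma s x))%:C =
  ((a / N%:R) `^ (d%:R - s))%:C * lattice_sum a phi s N.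
Proof.
move=> a0 s0 N0 cphi vphi; rewrite punctured_trapezoidalE//.
have h0 : 0 < a / N%:R by rewrite divr_gt0 ?ltr0n.
rewrite rmorphM rmorph_sum /= powRD; last by rewrite (gt_eqF h0) implybT.
rewrite powR_mulrn ?(ltW h0)// rmorphM -mulrA; congr (_ * _).
by rewrite mulr_sumr; apply: eq_bigr => m _; rewrite lattice_termE// gt_eqF.
Qed.

Lemma weight_gt0 m : 0 < weight m :> R.
Proof.
by apply: prodr_gt0 => j _; rewrite invr_gt0 exprn_gt0// ltr_wpDr.
Qed.

Lemma finite_support_weight (f : L -> C) (r : seq L) : (forall m, m \notin r -> f m = 0) ->
  exists2 c : R, 0 <= c & forall m, normc (f m) <= c * weight m.
Proof.
move=> f0; exists (\sum_(m <- r) normc (f m) / weight m).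
  by apply: sumr_ge0 => m _; rewrite divr_ge0 ?normc_ge0 ?weight_ge0.
move=> m; have [mr|/f0 ->] := boolP (m \in r); last first.
  rewrite normc0 mulr_ge0 ?weight_ge0//.
  by apply: sumr_ge0 => n _; rewrite divr_ge0 ?normc_ge0 ?weight_ge0.
rewrite -ler_pdivrMr ?weight_gt0// (big_rem m)//= lerDl.
by apply: sumr_ge0 => n _; rewrite divr_ge0 ?normc_ge0 ?weight_ge0.
Qed.

(** The coarse mesh is the even sublattice of the fine one, so that the
    difference of the two punctured sums carries the parity weight. *)
Lemma has_sum_halving K a phi (s : R) N : 0 < a -> (0 < N)%N -> vanishes_outside a phi ->
  has_sum (regularize K (lattice_term phi s (a / (2 * N)%:R)))
    ((2 `^ (d%:R - s))%:C * lattice_sum a phi s N - lattice_sum a phi s (2 * N)).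
Proof.
move=> a0 N0 vphi; have N2 : (0 < 2 * N)%N by rewrite muln_gt0.
have [c c0 hc] := @finite_support_weight (lattice_term phi s (a / (2 * N)%:R)) _
  (fun m => lattice_term_out s a0 N2 vphi erefl).
apply: (has_sum_regularize K c0 hc).
have h1 := has_sum_lattice_term s a0 N2 vphi.
have h2 : has_sum (fun m => lattice_term phi s (a / (2 * N)%:R) (m *+ 2))
    ((2 `^ (- s))%:C * lattice_sum a phi s N).
  have := has_sumZ (2 `^ (- s))%:C (has_sum_lattice_term s a0 N0 vphi); congr has_sum.
  apply/funext => m; rewrite /lattice_term norm_pow_double -rmorphN cpow_real.
  have -> : grid_point (a / (2 * N)%:R) (m *+ 2) = grid_point (a / N%:R) m.
    apply/rowP => j; rewrite mxE [RHS]mxE mulmxnE rmorphMn natrM -mulr_natl.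
    by field; rewrite pnatr_eq0 -lt0n N0.
  by ring.
have := has_sum_parity_weight h1 h2; congr (has_sum _ (_ - _)).
rewrite powRD; last by rewrite pnatr_eq0 implybT.
by rewrite powR_mulrn// rmorphM rmorphXn/= rmorph_nat mulrA.
Qed.

Lemma taylor_words M (f : V -> R) : exists E : seq (R * seq 'I_d),
  (forall cl, cl \in E -> (size cl.2 < M)%N) /\
  forall x, f x = \sum_(cl <- E) cl.1 * \prod_(i <- cl.2) x 0%R i + taylor_rem M f x.
Proof.
suff [E [h1 h2]] : exists E : seq (R * seq 'I_d),
  (forall cl, cl \in E -> (size cl.2 < M)%N) /\
  forall x, \sum_(k < M) taylor_part k f x = \sum_(cl <- E) cl.1 * \prod_(i <- cl.2) x 0%R i.
  by exists E; split => // x; rewrite /taylor_rem h2 addrC subrK.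
elim: M => [|M [E [h1 h2]]].
  by exists [::]; split => // x; rewrite big_ord0 big_nil.
have [E' [h1' h2']] := taylor_part_hom M f; exists (E ++ E'); split.
  move=> cl; rewrite mem_cat => /orP[/h1/leqW//|/h1' ->].
  exact: ltnSn.
by move=> x; rewrite big_ord_recr/= h2 h2' big_cat.
Qed.

Lemma prod_grid_point l (h : R) m :
  (\prod_(i <- l) grid_point h m 0%R i)%:C = (h ^+ size l)%:C * mon l m :> C.
Proof.
elim: l => [|i l ih]; first by rewrite /mon !big_nil mulr1.
rewrite /mon !big_cons -/(mon l m) /=.
have -> : (grid_point h m 0%R i * \prod_(i <- l) grid_point h m 0%R i)%:C =
    (grid_point h m 0%R i)%:C * (\prod_(i <- l) grid_point h m 0%R i)%:C :> C by rewrite rmorphM.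
rewrite ih mxE exprS !rmorphM/= rmorph_int.
by ring.
Qed.

Definition correction p (w : 'rV[nat]_d -> C) phi (h : R) : C :=
  \sum_(m <- fset_set (@stencil d p)) w (absv m) * (phi (grid_point h m))%:C.

Lemma sincotrapE a (s : R) p w phi N : 0 < a -> 0 < s -> (0 < N)%N ->
  continuous phi -> vanishes_outside a phi ->
  sincotrap a s p w N phi =
  ((a / N%:R) `^ (d%:R - s))%:C * (lattice_sum a phi s N + correction p w phi (a / N%:R)).
Proof.
move=> a0 s0 N0 cphi vphi; rewrite /sincotrap (punctured_lattice_sum a0 s0 N0 cphi vphi).
by rewrite mulrDr fsbig_finite//; exact: finite_stencil.
Qed.

End halving.

Section mesh_difference.
Context {R : realType} {d : nat}.
Local Notation C := R[i].
Local Notation V := 'rV[R]_d.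
Local Notation L := 'rV[int]_d.
Implicit Types (x : V) (m : L) (l : seq 'I_d).

(** In the Taylor expansion of [phi] the monomials of degree below [2 * p + 2]
    cancel between the lattice sum and the correction; the remainder contributes
    [h ^ M] times bounded quantities. *)
Lemma mesh_difference (a s : R) (phi : V -> R) p (Z : 'rV[nat]_d -> C -> C) w :
  (0 < d)%N -> 0 < a -> 0 < s < d%:R -> smooth phi -> vanishes_outside a phi ->
  (forall al, is_generalized_zeta al (Z al)) -> converged_weights Z s p w ->
  exists2 c : R, 0 <= c & forall N, (0 < N)%N ->
    normc (sincotrap a s p w N phi - sincotrap a s p w (2 * N) phi) <=
    c * (a / (2 * N)%:R) `^ ((2 * p + 2 + d)%:R - s).
Proof.
move=> d0 a0 sd sphi vphi hZ hw; have /andP[s0 s_d] := sd.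
have cphi := smooth_continuous sphi.
pose M := (2 * p + 2)%N; pose K := (M.+1 + 2 * d)%N.
have [E [sE hE]] := taylor_words M phi.
have hlam l : exists v, (size l < M)%N -> has_sum (regularize K (mon_pow l s%:C)) v.
  have [lM|_] := ltnP (size l) M; last by exists 0.
  have lK : ((size l).+1 + 2 * d <= K)%N by rewrite leq_add2r ltnS ltnW.
  have s1 : -1 <= complex.Re s%:C :> R by rewrite /= (le_trans _ (ltW s0))// lerN10.
  by have [v hv] := has_sum_regularize_mon_pow lK s1; exists v.
have {hlam}[lam hlam] := choice hlam.
pose mom l : C := \sum_(m <- fset_set (@stencil d p)) w (absv m) * mon l m.
have cancel l : (size l < M)%N ->
    lam l + ((2 `^ (d%:R - s) * 2 ^+ size l)%:C - 1) * mom l = 0.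
  move=> lM; have lK : ((size l).+1 + 2 * d <= K)%N by rewrite leq_add2r ltnS ltnW.
  have := moment_cancel hZ hw sd lK lM (hlam l lM).
  rewrite (_ : (d + size l)%:R - s%:C = (d%:R - s + (size l)%:R)%:C :> C); last first.
    rewrite -(rmorph_nat (real_complex R) (d + size l)) -rmorphB natrD.
    by congr (_%:C); ring.
  by rewrite cpow_real powRD ?pnatr_eq0 ?implybT// powR_mulrn.
pose rem (h : R) m : C := ((h ^+ M)^-1 * taylor_rem M phi (grid_point h m))%:C.
have [c1 c10 hc1] := @taylor_rem_symbol R d a M K phi d0 sphi vphi.
have expand (h : R) m : 0 < h -> (phi (grid_point h m))%:C =
    \sum_(cl <- E) (cl.1 * h ^+ size cl.2)%:C * mon cl.2 m + (h ^+ M)%:C * rem h m.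
  move=> h0; rewrite hE rmorphD rmorph_sum /=; congr (_ + _).
    apply: eq_bigr => cl _; have := prod_grid_point cl.2 h m; rewrite !rmorphM/= => ->.
    by rewrite mulrA.
  by rewrite /rem -rmorphM/= mulrA mulfV ?mul1r// expf_neq0 ?gt_eqF.
pose Y h : C := \sum_(m <- fset_set (@stencil d p)) w (absv m) * rem h m.
pose cY : R := \sum_(m <- fset_set (@stencil d p)) normc (w (absv m)) * (c1 * bracket m ^+ M).
have corrE h : 0 < h -> correction p w phi h =
    \sum_(cl <- E) (cl.1 * h ^+ size cl.2)%:C * mom cl.2 + (h ^+ M)%:C * Y h.
  move=> h0; rewrite /correction /Y mulr_sumr.
  under eq_bigr do rewrite expand// mulrDr mulr_sumr.
  rewrite big_split exchange_big/=; congr (_ + _); apply: eq_bigr => cl _; last by ring.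
  by rewrite /mom mulr_sumr; apply: eq_bigr => m _; ring.
have Yle h : 0 < h <= a -> normc (Y h) <= cY.
  move=> ha; apply: le_trans (normc_sum _ _ _) _; apply: ler_sum => m _.
  rewrite normcM ler_wpM2l ?normc_ge0//.
  by have := hc1 h ha (Ordinal d0) 0%N m isT; rewrite expr0 mulr1.
have [c2 c20 hc2] := @mon_norm_pow_symbol R d K s [::].
have [c3 c30 hc3] := @symbolM R d K M 1.
have npE : (fun m => mon [::] m * norm_pow s%:C m) = norm_pow s%:C :> (L -> C).
  by apply/funext => m; rewrite /mon big_nil mul1r.
have hs : symbol K 1 c2 (norm_pow s%:C : L -> C).
  by rewrite -npE; apply: hc2 => /=; rewrite ?normr0 ?lexx ?andbT ?(ltW s0)// (le_trans _ (ltW s0))// lerN10.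
pose c4 : R := #|{set 'I_d}|%:R * (c3 * c1 * c2).
have c40 : 0 <= c4 by rewrite !mulr_ge0.
have remsum h : 0 < h <= a -> exists2 W, has_sum (regularize K (fun m => rem h m * norm_pow s%:C m)) W &
    normc W <= c4 * 4 ^+ d.
  move=> ha; have hsym := hc3 _ _ _ _ c10 c20 (hc1 h ha) hs.
  have hr := @regularize_symbol R d K (M + 1) _ _ _ _ hsym.
  have {}hr m := hr (mulr_ge0 (mulr_ge0 c30 c10) c20) (ltac:(by rewrite addn1)) m.
  have [W hW] := has_sum_dominated weight_ge0 c40 weight_sum hr.
  exists W => //; exact: has_sum_le weight_ge0 c40 hr hW weight_sum.
pose c5 : R := c4 * 4 ^+ d + 2 `^ (d%:R - s) * 2 ^+ M * cY + cY.
have cY0 : 0 <= cY.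
  by apply: sumr_ge0 => m _; rewrite !mulr_ge0 ?normc_ge0 ?exprn_ge0 ?bracket_ge0.
exists c5.
  by rewrite !addr_ge0 ?mulr_ge0 ?exprn_ge0 ?powR_ge0.
move=> N N0; have N2 : (0 < 2 * N)%N by rewrite muln_gt0.
rewrite !sincotrapE//; set h := a / (2 * N)%:R.
have h0 : 0 < h by rewrite divr_gt0 ?ltr0n.
have hN : a / N%:R = 2 * h.
  by rewrite /h natrM; field; rewrite pnatr_eq0 -lt0n N0.
have Na : a / N%:R <= a by rewrite ler_pdivrMr ?ltr0n// ler_peMr ?(ltW a0)// ler1n.
have h2a : 0 < 2 * h <= a by rewrite -hN Na andbT divr_gt0 ?ltr0n.
have ha : 0 < h <= a.
  by rewrite h0/=; case/andP: h2a => _; apply: le_trans; rewrite ler_peMl ?(ltW h0)// ler1n.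
have [W hW Wle] := remsum h ha.
pose th : C := (2 `^ (d%:R - s))%:C.
have halving : th * lattice_sum a phi s N - lattice_sum a phi s (2 * N) =
    \sum_(cl <- E) (cl.1 * h ^+ size cl.2)%:C * lam cl.2 + (h ^+ M)%:C * W.
  apply: has_sum_unique (has_sum_halving K s a0 N0 vphi) _.
  rewrite -/h (_ : lattice_term phi s h = fun m =>
    \sum_(cl <- E) (cl.1 * h ^+ size cl.2)%:C * mon_pow cl.2 s%:C m +
    (h ^+ M)%:C * (rem h m * norm_pow s%:C m)); last first.
    apply/funext => m; rewrite /lattice_term expand// mulrDl mulr_suml mulrA; congr (_ + _).
    by apply: eq_bigr => cl _; rewrite /mon_pow mulrA.
  rewrite (_ : regularize K _ = fun m =>
    \sum_(cl <- E) (cl.1 * h ^+ size cl.2)%:C * regularize K (mon_pow cl.2 s%:C) m +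
    (h ^+ M)%:C * regularize K (fun m => rem h m * norm_pow s%:C m) m); last first.
    apply/funext => m; rewrite regularizeD regularizeZ regularize_sum; congr (_ + _).
    by apply: eq_bigr => cl _; rewrite regularizeZ.
  apply: has_sumD; last exact: has_sumZ.
  rewrite big_seq (_ : (fun m : L => _) = fun m => \sum_(cl <- E | cl \in E)
    (cl.1 * h ^+ size cl.2)%:C * regularize K (mon_pow cl.2 s%:C) m); last first.
    by apply/funext => m; rewrite big_seq.
  by apply: has_sum_big => cl clE; apply: has_sumZ; apply: hlam; exact: sE.
have hs' : (2 * h) `^ (d%:R - s) = 2 `^ (d%:R - s) * h `^ (d%:R - s).
  by rewrite powRM ?(ltW h0).
rewrite hN hs' rmorphM/= -/th.
have -> : th * (h `^ (d%:R - s))%:C * (lattice_sum a phi s N + correction p w phi (2 * h)) -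
    (h `^ (d%:R - s))%:C * (lattice_sum a phi s (2 * N) + correction p w phi h) =
    (h `^ (d%:R - s))%:C * ((th * lattice_sum a phi s N - lattice_sum a phi s (2 * N)) +
      (th * correction p w phi (2 * h) - correction p w phi h)) by ring.
rewrite halving (corrE h h0) (corrE (2 * h)); last by case/andP: h2a.
have -> : \sum_(cl <- E) (cl.1 * h ^+ size cl.2)%:C * lam cl.2 + (h ^+ M)%:C * W +
   (th * (\sum_(cl <- E) (cl.1 * (2 * h) ^+ size cl.2)%:C * mom cl.2 +
      ((2 * h) ^+ M)%:C * Y (2 * h)) -
    (\sum_(cl <- E) (cl.1 * h ^+ size cl.2)%:C * mom cl.2 + (h ^+ M)%:C * Y h)) =
   (h ^+ M)%:C * (W + th * (2 ^+ M)%:C * Y (2 * h) - Y h).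
  have E0 : \sum_(cl <- E) (cl.1 * h ^+ size cl.2)%:C * lam cl.2 +
     (th * (\sum_(cl <- E) (cl.1 * (2 * h) ^+ size cl.2)%:C * mom cl.2) -
      \sum_(cl <- E) (cl.1 * h ^+ size cl.2)%:C * mom cl.2) = 0.
    rewrite mulr_sumr -sumrB -big_split/= big_seq big1// => cl /sE clM.
    have := cancel cl.2 clM; rewrite [(2 * h) ^+ _]exprMn !rmorphM/= -/th => cc.
    transitivity ((cl.1)%:C * (h ^+ size cl.2)%:C * (lam cl.2 + (th * (2 ^+ size cl.2)%:C - 1) * mom cl.2)).
      by ring.
    by rewrite cc mulr0.
  move: E0; set s1 := \sum_(cl <- E) _; set s2 := \sum_(cl <- E) _; set s3 := \sum_(cl <- E) _ => E0.
  rewrite [(2 * h) ^+ _]exprMn [(2 ^+ M * _)%:C]rmorphM/= -[RHS]add0r -E0; ring.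
rewrite mulrA normcM.
have -> : normc ((h `^ (d%:R - s))%:C * (h ^+ M)%:C) = h `^ ((2 * p + 2 + d)%:R - s).
  rewrite -rmorphM/= normc_real ger0_norm ?mulr_ge0 ?powR_ge0 ?exprn_ge0 ?(ltW h0)//.
  rewrite -powR_mulrn ?(ltW h0)// -powRD; last by rewrite (gt_eqF h0) implybT.
  by congr (_ `^ _); rewrite /M !natrD; ring.
rewrite mulrC ler_wpM2r ?powR_ge0//.
apply: le_trans (ler_normcB _ _) _; apply: lerD; last exact: Yle.
apply: le_trans (ler_normcD _ _) _; apply: lerD => //.
rewrite !normcM !normc_real !ger0_norm ?powR_ge0 ?exprn_ge0//.
by rewrite ler_wpM2l ?mulr_ge0 ?powR_ge0 ?exprn_ge0// Yle.
Qed.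

End mesh_difference.

(** * Summation over the dyadic meshes *)

Section conclusion.
Context {R : realType} {d : nat}.
Local Notation C := R[i].
Local Notation V := 'rV[R]_d.
Local Notation L := 'rV[int]_d.

(** Telescoping along [N], [2 * N], [4 * N] and so on, with geometric increments. *)
Lemma dyadic_telescope (u : nat -> C) (I : C) (a c g : R) : 0 < a -> 0 <= c -> 0 < g ->
  (forall N, (0 < N)%N -> normc (u N - u (2 * N)%N) <= c * (a / (2 * N)%:R) `^ g) ->
  (forall e, 0 < e -> exists n0, forall n, (n0 <= n)%N -> normc (u n - I) <= e) ->
  forall N, (0 < N)%N -> normc (u N - I) <= c / (1 - 2 `^ (- g)) * (a / N%:R) `^ g.
Proof.
move=> a0 c0 g0 hu hI N N0; set q := 2 `^ (- g).
have q0 : 0 <= q by exact: powR_ge0.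
have q1 : q < 1.
  rewrite /q /powR gt_eqF// -[ltRHS]expR0 ltr_expR mulNr oppr_lt0 mulr_gt0// ln_gt0//.
  by rewrite ltr1n.
have r0 : 0 < a / N%:R by rewrite divr_gt0 ?ltr0n.
have half k : (a / (2 ^ k * N)%:R) `^ g = q ^+ k * (a / N%:R) `^ g.
  have -> : a / (2 ^ k * N)%:R = (2^-1) ^+ k * (a / N%:R).
    by rewrite natrM natrX exprVn invfM; ring.
  rewrite [LHS](_ : _ = (2^-1 ^+ k) `^ g * (a / N%:R) `^ g); last first.
    by apply: powRM; rewrite ?exprn_ge0// ltW.
  congr (_ * _).
  elim: k => [|k ih]; first by rewrite !expr0 powR1.
  rewrite !exprS powRM ?exprn_ge0// ih; congr (_ * _).
  by rewrite /q -powR_inv1// -powRrM mulN1r.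
have step k : normc (u N - u (2 ^ k * N)%N) <= c * (a / N%:R) `^ g * \sum_(j < k) q ^+ j.
  elim: k => [|k ih].
    by rewrite expn0 mul1n subrr normc0 big_ord0 mulr0.
  rewrite big_ord_recr/= mulrDr.
  rewrite (_ : u N - u (2 ^ k.+1 * N)%N =
    (u N - u (2 ^ k * N)%N) + (u (2 ^ k * N)%N - u (2 * (2 ^ k * N))%N)); last first.
    by rewrite expnS mulnA; ring.
  apply: le_trans (ler_normcD _ _) _; apply: lerD => //.
  apply: le_trans (hu _ _) _; first by rewrite muln_gt0 expn_gt0.
  rewrite mulnA -expnS half exprS -!mulrA; apply: ler_wpM2l => //.
  rewrite [leRHS]mulrC; apply: ler_piMl; last exact: ltW.
  by rewrite mulr_ge0 ?exprn_ge0 ?powR_ge0.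
apply/ler_addgt0Pr => e e0; have [n0 hn0] := hI e e0.
have n0le : (n0 <= 2 ^ n0 * N)%N.
  by rewrite (leq_trans (ltnW (ltn_expl n0 (ltnSn 1))))// leq_pmulr.
rewrite (_ : u N - I = (u N - u (2 ^ n0 * N)%N) + (u (2 ^ n0 * N)%N - I)); last by ring.
apply: le_trans (ler_normcD _ _) _; apply: lerD; last exact: hn0.
apply: le_trans (step n0) _; rewrite mulrAC; apply: ler_wpM2r; first exact: powR_ge0.
by apply: ler_wpM2l => //; apply: geometric_sum_le; rewrite q0.
Qed.

(** The correction has the size of the positive power [d - s] of the mesh. *)
Lemma sincotrap_cvg (a s : R) (phi : V -> R) p w : 0 < a -> 0 < s < d%:R -> continuous phi ->
  vanishes_outside a phi -> forall e, 0 < e -> exists n0, forall n, (n0 <= n)%N ->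
  normc (sincotrap a s p w n phi - (integral_on (cube a) (fun x => phi x * sigma s x))%:C) <= e.
Proof.
move=> a0 sd cphi vphi e e0; have /andP[s0 s_d] := sd.
have e2 : 0 < e / 2 by rewrite divr_gt0.
have := riemann_integrand_cvg a0 sd cphi vphi => /cvgrPdist_le/(_ _ e2)[n1 _ h1].
have [B hB] := vanishes_outside_bounded cphi vphi.
pose cX := \sum_(m <- fset_set (@stencil d p)) normc (w (absv m)) * `|B|.
have cX0 : 0 <= cX by apply: sumr_ge0 => m _; rewrite mulr_ge0 ?normc_ge0.
have g0 : 0 < d%:R - s by rewrite subr_gt0.
pose r := (e / 2 / (cX + 1)) `^ (d%:R - s)^-1.
have c1 : 0 < cX + 1 by rewrite ltr_wpDl.
have r0 : 0 < r by rewrite powR_gt0 ?divr_gt0.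
exists (maxn n1.+1 (Num.truncn (a / r)).+1) => n; rewrite geq_max => /andP[n1n nr].
have n0 : (0 < n)%N by exact: leq_trans nr.
have h0 : 0 < a / n%:R by rewrite divr_gt0 ?ltr0n.
have hr : a / n%:R <= r.
  rewrite ler_pdivrMr ?ltr0n// mulrC -ler_pdivrMr//; apply: le_trans (ltW (truncnS_gt _)) _.
  by rewrite ler_nat.
rewrite /sincotrap addrAC; apply: le_trans (ler_normcD _ _) _; rewrite [leRHS](splitr e).
apply: lerD.
  rewrite punctured_trapezoidalE// -rmorphB/= normc_real distrC.
  by case: n n0 n1n {nr h0 hr} => // n _ n1n; exact: h1.
rewrite normcM normc_real ger0_norm ?powR_ge0//.
have hX : normc (\sum_(m \in @stencil d p) w (absv m) * (phi (grid_point (a / n%:R) m))%:C) <= cX.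
  rewrite fsbig_finite/=; last exact: finite_stencil.
  apply: le_trans (normc_sum _ _ _) _; apply: ler_sum => m _.
  rewrite normcM ler_wpM2l ?normc_ge0// normc_real.
  by apply: le_trans (hB _) _; exact: ler_norm.
apply: (@le_trans _ _ (e / 2 / (cX + 1) * (cX + 1))); last by rewrite divfK// gt_eqF.
apply: ler_pM; rewrite ?powR_ge0 ?normc_ge0//; last by apply: le_trans hX _; rewrite lerDl.
apply: (@le_trans _ _ (r `^ (d%:R - s))).
  by apply: ge0_ler_powR; rewrite ?nnegrE ?(ltW g0) ?(ltW h0) ?(ltW r0).
by rewrite /r -powRrM mulVf ?gt_eqF// powRr1// ltW// divr_gt0.
Qed.

End conclusion.

Theorem theorem3p2 (R : realType) (d : nat) (hd : (1 <= d)%N)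
    (a : R) (ha : 0 < a) (s : R) (hs0 : 0 < s) (hsd : s < d%:R)
    (phi : 'rV[R]_d -> R)
    (hphi : smooth_compactly_supported_in (cube a) phi)
    (p : nat)
    (Z : 'rV[nat]_d -> R[i] -> R[i])
    (hZ : forall alpha : 'rV[nat]_d, is_generalized_zeta alpha (Z alpha))
    (w : 'rV[nat]_d -> R[i]) (hw : converged_weights Z s p w) :
  (fun N : nat =>
     (integral_on (cube a) (fun x => phi x * sigma s x))%:C : R[i]^o)
  = (fun N : nat => sincotrap a s p w N phi : R[i]^o)
    +O_\oo (fun N : nat =>
              ((a / N%:R) `^ ((2 * p + 2 + d)%:R - s))%:C : R[i]^o).
Proof.
have [sphi _ supp] := hphi.
have vphi : vanishes_outside a phi.
  move=> x j ax; apply: contrapT => /eqP fx.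
  have /(_ j) : cube a x by apply: supp; exact: subset_closure.
  by rewrite -ler_norml leNgt ax.
have sd : 0 < s < d%:R by rewrite hs0.
have [c c0 hc] := mesh_difference hd ha sd sphi vphi hZ hw.
have g0 : 0 < (2 * p + 2 + d)%:R - s by rewrite subr_gt0 (lt_le_trans hsd)// ler_nat leq_addl.
have main := dyadic_telescope ha c0 g0 hc
  (sincotrap_cvg p w ha sd (smooth_continuous sphi) vphi).
set g := _ - s in main *; set I := integral_on _ _ in main *.
apply/eqaddOP/bigO_exP.
have k0 : 0 < `|c / (1 - 2 `^ (- g))| + 1 by rewrite ltr_wpDl.
exists ((`|c / (1 - 2 `^ (- g))| + 1)%:C); first by rewrite ltcR.
exists 1%N => // N /= N0.
rewrite !normr_normc -rmorphM/= lecR -normc_opp opprB normc_real (ger0_norm (powR_ge0 _ _)).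
apply: le_trans (main N N0) _; rewrite ler_wpM2r ?powR_ge0//.
by rewrite (le_trans (ler_norm _))// lerDl.
Qed.
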